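(* Let $(X,\mathcal B,m,T)$ be an invertible, conservative, ergodic, measure preserving transformation and let $\Omega\in\mathcal B$, $0<m(\Omega)<\infty$, be a set whose interarrival process $(\varphi_\Omega\circ T_\Omega^n)_{n\ge0}$, considered on the probability space $(\Omega,\mathcal B(\Omega),m_\Omega)$, is continued fraction mixing with coefficients satisfying $\sum_{n=1}^\infty\frac{\vartheta(n)}n<\infty$. Then the following are equivalent: (a) there exist constants $a_n>0$ $(n\ge 1)$ such that for every $A\in\mathcal B$ with $0<m(A)<\infty$, $\Sigma_n(1_A)(x)\asymp a_n$ for $m$-a.e. $x\in X$; (b) $$\sum_{n=1}^\infty n\cdot\left(\frac{m_\Omega([\varphi_\Omega\ge n])}{L_\Omega(n)}\right)^2<\infty .$$ Moreover, in this case, if $m(X)=\infty$, then $$\beta(T)=1\quad\text{and}\quad \underline\beta(T)=\tfrac12 .$$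
   Context: $(X,\mathcal B,m)$ is a (standard) $\sigma$-finite measure space. Induced transformation. For $\Omega\in\mathcal B$ with $0<m(\Omega)<\infty$: $m_\Omega:=m(\cdot\,|\,\Omega)$; $\varphi_\Omega:\Omega\to\mathbb N$, $\varphi_\Omega(x):=\min\{n\ge1:T^nx\in\Omega\}$ is the first return time; $T_\Omega x:=T^{\varphi_\Omega(x)}x$ is the induced transformation of $\Omega$, which preserves $m_\Omega$. Put $$L_\Omega(t):=\int_\Omega(\varphi_\Omega\wedge t)\,dm_\Omega .$$ Continued fraction mixing. A stochastic process $(X_1,X_2,\dots)$ is continued fraction mixing if $\vartheta(1)<\infty$ and $\vartheta(n)\downarrow0$, where $$\vartheta(n):=\sup\left\{\left|\frac{\mathbb P(A\cap B)}{\mathbb P(A)\mathbb P(B)}-1\right|:\ A\in\sigma_1^k,\ B\in\sigma_{k+n}^\infty,\ \mathbb P(A)\mathbb P(B)>0,\ k\ge1\right\}$$ and $\sigma_k^N$ is the $\sigma$-algebra generated by $\{X_j:k\le j<N+1\}$, for $k<N+1\le\infty$. The numbers $\vartheta(n)$ are its coefficients. (Here $X_{n+1}=\varphi_\Omega\circ T_\Omega^{n}$, $n\ge0$.) Symmetric sums. $\Sigma_n(f)(x):=\sum_{|k|<n}f(T^kx)$. For eventually positive sequences $a_n\asymp b_n$ means that there is $M>1$ with $M^{-1}<\frac{a_n}{b_n}<M$ for all large $n$. Constants. Condition (a) implies that $T$ is boundedly rationally ergodic: there are $A\in\mathcal B$, $0<m(A)<\infty$, and $M>0$ with $\sum_{k=0}^{n-1}1_A(T^kx)\le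 M a_n(A)$ for a.e. $x\in A$ and all $n\ge1$, where $a_n(A):=\sum_{k=0}^{n-1}\frac{m(A\cap T^{-k}A)}{m(A)^2}$. The return sequence is $a_n(T):=a_n(A)$ for such $A$ (it is independent of the choice of such $A$ up to asymptotic equivalence). Then there are constants $\underline\beta(T)\in[0,1]$ and $\beta(T)\in[1,\infty]$ such that for every nonnegative $f\in L^1(m)$, a.e., $$\varlimsup_{n\to\infty}\frac1{2a_n(T)}\Sigma_n(f)=\beta(T)\int_Xf\,dm,\qquad \varliminf_{n\to\infty}\frac1{2a_n(T)}\Sigma_n(f)=\underline\beta(T)\int_Xf\,dm .$$ *)

(* Defs.v *)
From HB Require Import structures.
From mathcomp Require Import all_boot all_order all_algebra.
From mathcomp Require Import all_classical all_reals all_analysis.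

Set Implicit Arguments.
Unset Strict Implicit.
Unset Printing Implicit Defensive.

Import Order.TTheory GRing.Theory Num.Theory.
Import numFieldNormedType.Exports.

Local Open Scope classical_set_scope.
Local Open Scope ring_scope.

(* Standard Borel space: isomorphic to a Polish space (complete metric, with
   a countable basis) equipped with its Borel sets. *)
Definition standard_space (R : realType) d (X : measurableType d) : Prop :=
  exists (P : completePseudoMetricType R) (f : X -> P),
    [/\ hausdorff_space P, @second_countable P, bijective f &
        @measurable d X = preimage_set_system setT f <<s (@open P) >>].

Section transformations.
Context {R : realType} {d : measure_display} {X : measurableType d}.
Variables (m : {measure set X -> \bar R}).

Record invertible_mpt (T Tinv : X -> X) : Prop := InvertibleMPT {
  mpt_cancel : cancel T Tinv;
  mpt_cancel_inv : cancel Tinv T;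
  mpt_measurable : measurable_fun setT T;
  mpt_measurable_inv : measurable_fun setT Tinv;
  mpt_preserve : forall A, measurable A -> m (T @^-1` A) = m A }.

Definition wandering (T : X -> X) (W : set X) : Prop :=
  measurable W /\ trivIset setT (fun n : nat => iter n T @^-1` W).

Definition conservative (T : X -> X) : Prop :=
  forall W, wandering T W -> m W = 0%E.

Definition ergodic (T : X -> X) : Prop :=
  forall A, measurable A -> T @^-1` A = A -> m A = 0%E \/ m (~` A) = 0%E.

Definition symmetric_sum (T Tinv : X -> X) (n : nat) (f : X -> R) (x : X) : R :=
  \sum_(0 <= k < n) f (iter k T x) + \sum_(1 <= k < n) f (iter k Tinv x).

Definition avg_return (T : X -> X) (A : set X) (n : nat) : R :=
  \sum_(0 <= k < n) fine (m (A `&` iter k T @^-1` A)) / (fine (m A)) ^+ 2.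

(* A witnesses that T is boundedly rationally ergodic; avg_return T A is then
   the return sequence of T. *)
Definition bre_set (T : X -> X) (A : set X) : Prop :=
  [/\ measurable A, (0 < m A)%E, (m A < +oo)%E &
    exists2 M : R, 0 < M &
      {ae m, forall x, A x -> forall n, (1 <= n)%N ->
        \sum_(0 <= k < n) \1_A (iter k T x) <= M * avg_return T A n}].

Definition boundedly_rationally_ergodic (T : X -> X) : Prop :=
  exists A, bre_set T A.

(* beta(T) = b. The return sequence is defined only up to asymptotic
   equivalence, so the limit is required along each of its versions. *)
Definition has_upper_constant (T Tinv : X -> X) (b : \bar R) : Prop :=
  boundedly_rationally_ergodic T /\
  forall A, bre_set T A ->
  forall f : X -> R, (forall x, 0 <= f x) -> m.-integrable setT (EFin \o f) ->
  {ae m, forall x,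
    limn_esup (fun n =>
      (symmetric_sum T Tinv n f x / (2 * avg_return T A n))%:E) =
    (b * \int[m]_y (f y)%:E)%E}.

Definition has_lower_constant (T Tinv : X -> X) (b : \bar R) : Prop :=
  boundedly_rationally_ergodic T /\
  forall A, bre_set T A ->
  forall f : X -> R, (forall x, 0 <= f x) -> m.-integrable setT (EFin \o f) ->
  {ae m, forall x,
    limn_einf (fun n =>
      (symmetric_sum T Tinv n f x / (2 * avg_return T A n))%:E) =
    (b * \int[m]_y (f y)%:E)%E}.

(* The junk value 0 is taken only at points that never return to Omega; then
   induced_map fixes such a point, so it maps Omega into itself. *)
Definition return_time (T : X -> X) (Omega : set X) (x : X) : nat :=
  xget 0%N [set n | [/\ (1 <= n)%N, Omega (iter n T x) &
    forall k, (1 <= k < n)%N -> ~ Omega (iter k T x)]].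

Definition induced_map (T : X -> X) (Omega : set X) (x : X) : X :=
  iter (return_time T Omega x) T x.

(* Indexed from 1: the j-th variable is phi \o T_Omega^(j-1). *)
Definition interarrival (T : X -> X) (Omega : set X) (j : nat) (x : X) : nat :=
  return_time T Omega (iter j.-1 (induced_map T Omega) x).

Lemma inv_mass_ge0 (Omega : set X) : 0 <= (fine (m Omega))^-1.
Proof. by rewrite invr_ge0 fine_ge0// measure_ge0. Qed.

(* m_Omega as a measure on X concentrated on Omega; a probability when
   0 < m Omega < +oo. *)
Definition cond_measure (Omega : set X) (mOmega : measurable Omega) :
    {measure set X -> \bar R} :=
  mscale (NngNum (inv_mass_ge0 Omega)) (mrestr m mOmega).

Definition truncated_mean (T : X -> X) (Omega : set X)
    (mOmega : measurable Omega) (t : R) : R :=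
  fine (\int[cond_measure mOmega]_(x in Omega)
    (Num.min (return_time T Omega x)%:R t)%:E).

End transformations.

Section mixing.
Context {R : realType} {X : Type} {d' : measure_display}.
Context {E : measurableType d'}.
(* A process on the probability space (D, P), where D is a subset of X; its
   sigma-algebras consist of subsets of D. *)
Variables (D : set X) (P : set X -> \bar R) (Y : nat -> X -> E).

Definition process_sigma (J : set nat) : set_system X :=
  <<s D, \bigcup_(j in J) preimage_set_system D (Y j) measurable >>.

Definition mixing_coef (n : nat) : \bar R :=
  ereal_sup [set z | exists (k : nat) (A B : set X),
    [/\ (1 <= k)%N,
        process_sigma [set j | (1 <= j <= k)%N] A,
        process_sigma [set j | (k + n <= j)%N] B,
        (0 < P A * P B)%E &
        z = `|fine (P (A `&` B)) / (fine (P A) * fine (P B)) - 1|%:E]].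

Definition continued_fraction_mixing : Prop :=
  [/\ (mixing_coef 1 < +oo)%E,
      forall n, (1 <= n)%N -> (mixing_coef n.+1 <= mixing_coef n)%E &
      mixing_coef n @[n --> \oo] --> 0%E].

End mixing.

Definition asymp {R : realType} (a b : nat -> R) : Prop :=
  exists2 M : R, 1 < M &
    \forall n \near \oo, M^-1 < a n / b n /\ a n / b n < M.

(* Main.v *)
Require Import Defs.
From HB Require Import structures.
From mathcomp Require Import all_boot all_order all_algebra.
From mathcomp Require Import all_classical all_reals all_analysis.
From mathcomp Require Import measurable_realfun.
From mathcomp Require Import ring lra.
From mathcomp Require Import zify.

Set Implicit Arguments.
Unset Strict Implicit.
Unset Printing Implicit Defensive.

Import Order.TTheory GRing.Theory Num.Theory.
Import numFieldNormedType.Exports.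

Local Open Scope classical_set_scope.
Local Open Scope ring_scope.

(** Let [phi] be the return time to [Om], [tau] the induced map and
    [P] the normalized measure on [Om].  The time of the [k]-th return to [Om]
    is the sum of the first [k] values of [phi] along [tau], so that the visits
    of an orbit to [Om] are counted by the inverse of a process of partial sums.
    With [L n] the mean of [phi] truncated at [n], the natural normalization is
    [rate n = n / L n].  On the dyadic scale [i] it becomes
    [scale i = 2 ^ i / L (2 ^ i)], the number of returns that should take time
    [2 ^ i].  The [hazard i = 2 ^ i * P (phi >= 2 ^ i) / L (2 ^ i)] is, up to
    constants, the probability that a single one of them takes all this time,
    and Cauchy condensation turns the series of the theorem into the series of
    the squares of the hazards: the sum over the scales of the probabilities
    that such a long return occurs both in the near past and in the near future.

    If this series converges, each sum of [scale i] returns obeys a strong law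
    except for single long returns.  Truncation levels are chosen scale by scale
    ([truncation_levels]).  Below the level, Chebyshev's inequality and the
    summability of [th n / n] control the truncated sum.  Between the level and
    a small fraction of [2 ^ i], a first passage argument raises Markov's bound
    to its fourth power ([pr_sum_doubling]).  Hence, almost surely, returns are
    not early ([bdd_early]), and they are not late in both directions of time at
    once, since this takes two long returns ([bdd_late_twice]).  So neither
    direction ever exceeds its share [rate n] of visits asymptotically
    ([ae_upper_all]), and at each time one of them has its full share
    ([ae_full_all]): two-sided visits lie between [rate n] and [2 * rate n] up
    to small errors, and Hopf's ratio theorem carries this over to all sets of
    finite measure ([asymp_rate]).

    If the series diverges, a second moment argument gives, with positive
    probability, infinitely many scales with a long return on both sides
    ([two_sided_bursts]).  At these times the two-sided visits are a small
    multiple of [rate].  But any normalization comparable to the symmetric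
    visits dominates [rate], by Markov's inequality ([rate_dominated]), and
    ergodicity makes the comparison uniform; this is a contradiction.

    As for the constants, the visits are asymptotic to [rate] in probability,
    and almost everywhere along subsequences of any set of times.  Dominated
    convergence then identifies the return sequence of every set that witnesses
    bounded rational ergodicity with [rate] over the mass of [Om]
    ([rate_over_avg]).  The upper constant comes from times when both directions
    are full.  If the total mass is infinite, the hazards are not summable
    ([hazard_diverges]), and forward bursts recur almost surely ([ae_stalls]):
    at such times the forward visits are negligible, the backward ones full, and
    the lower constant is one half. *)


(** * Series with bounded partial sums *)

Section bounded_series.
Context {R : realType}.
Implicit Types u v : nat -> R.

Lemma sum_nat_shift u n m :
  \sum_(m <= i < n + m) u i = \sum_(0 <= i < n) u (i + m)%N.
Proof. by rewrite -{1}[m]add0n big_addn addnK. Qed.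

(** For nonnegative terms this is summability; it is stable under comparison
    and under shifts without any mention of the sum. *)
Definition bdd_series u := exists C, forall n, \sum_(0 <= i < n) u i <= C.

Lemma bdd_series_shift u k : bdd_series (fun i => u (i + k)%N) -> bdd_series u.
Proof.
move=> [C HC]; have C0 : 0 <= C by have := HC 0%N; rewrite big_geq.
exists (C + \sum_(0 <= i < k) `|u i|) => n.
case: (leqP n k) => nk.
  apply: (@le_trans _ _ (\sum_(0 <= i < k) `|u i|)); last by rewrite lerDr.
  rewrite (@big_cat_nat _ _ _ n 0%N k) //= -[leLHS]addr0 lerD ?sumr_ge0//.
  by apply: ler_sum => i _; exact: ler_norm.
rewrite (@big_cat_nat _ _ _ k 0%N n) //= ?(ltnW nk)// addrC lerD//; last first.
  by apply: ler_sum => i _; exact: ler_norm.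
by rewrite -{1}(subnK (ltnW nk)) sum_nat_shift.
Qed.

Lemma bdd_series_le_from u v C i0 : 0 <= C -> (forall i, 0 <= v i) ->
  (forall i, (i0 <= i)%N -> u i <= C * v i) -> bdd_series v -> bdd_series u.
Proof.
move=> C0 v0 uv [D HD]; apply: (@bdd_series_shift _ i0).
exists (C * D) => n; apply: (@le_trans _ _ (\sum_(0 <= i < n) C * v (i + i0)%N)).
  by apply: ler_sum => i _; apply: uv; rewrite leq_addl.
rewrite -mulr_sumr ler_wpM2l//; apply: le_trans (HD (n + i0)%N).
rewrite (@big_cat_nat _ _ _ i0 0%N (n + i0)) ?leq_addl//=.
by rewrite sum_nat_shift lerDr sumr_ge0.
Qed.

Lemma bdd_series_le u v : (forall i, u i <= v i) -> bdd_series v -> bdd_series u.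
Proof.
move=> uv [C HC]; exists C => n; apply: le_trans (HC n).
by apply: ler_sum => i _; exact: uv.
Qed.

Lemma bdd_seriesD u v : bdd_series u -> bdd_series v ->
  bdd_series (fun i => u i + v i).
Proof.
by move=> [C HC] [D HD]; exists (C + D) => n; rewrite big_split/= lerD.
Qed.

Lemma bdd_seriesZ u C : 0 <= C -> bdd_series u -> bdd_series (fun i => C * u i).
Proof.
by move=> C0 [D HD]; exists (C * D) => n; rewrite -mulr_sumr ler_wpM2l.
Qed.

(** Adding up the recursion bounds [1 - q] times the partial sums. This is
    how the geometric growth of the scales yields summable errors. *)
Lemma bdd_series_recursion u v q : q < 1 -> (forall i, 0 <= u i) ->
  (forall i, u i.+1 <= q * u i + v i) -> bdd_series v -> bdd_series u.
Proof.
move=> q1 u0 uv [C HC]; exists ((u 0%N + C) / (1 - q)) => n.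
rewrite ler_pdivlMr ?subr_gt0//.
suff H : (1 - q) * \sum_(0 <= i < n) u i + u n <= u 0%N + \sum_(0 <= i < n) v i.
  by have := u0 n; have := HC n; nra.
elim: n => [|n IH]; first by rewrite !big_geq//; lra.
by rewrite !big_nat_recr//=; have := uv n; lra.
Qed.

Lemma bdd_series_tail u k : (forall i, 0 <= u i) -> bdd_series u ->
  bdd_series (fun i => u (i + k)%N).
Proof.
move=> u0 [C HC]; exists C => n; apply: le_trans (HC (n + k)%N).
rewrite [leRHS](@big_cat_nat _ _ _ k) ?leq_addl//=.
by rewrite sum_nat_shift lerDr sumr_ge0.
Qed.

Lemma bdd_series_small u eps : (forall i, 0 <= u i) -> bdd_series u ->
  0 < eps -> exists N, forall i, (N <= i)%N -> u i <= eps.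
Proof.
move=> u0 [C HC] e0.
have cu : cvgn (series u).
  apply: nondecreasing_is_cvgn.
    by apply/nondecreasing_series => n _ _; exact: u0.
  by exists C => _ [n _ <-]; exact: HC.
have /cvgrPdist_le /(_ _ e0) [N _ HN] := cvg_series_cvg_0 cu.
exists N => i Ni; have := HN i Ni.
by rewrite /= sub0r normrN ger0_norm.
Qed.

Lemma bdd_series_tail_unbounded u m C : ~ bdd_series u ->
  exists2 n, (m <= n)%N & C < \sum_(m <= i < n) u i.
Proof.
move=> nu; apply: contrapT => H; apply: nu; apply: (@bdd_series_shift _ m).
exists C => n; rewrite leNgt; apply/negP => Cn; apply: H.
by exists (n + m)%N; rewrite ?leq_addl// sum_nat_shift.
Qed.

Lemma bdd_series_nneseries u k : (forall i, 0 <= u i) ->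
  bdd_series u <-> (\sum_(k <= i <oo) (u i)%:E < +oo)%E.
Proof.
move=> u0; split=> [[C HC]|].
  apply: (@le_lt_trans _ _ C%:E); last exact: ltry.
  apply: lime_le; first by apply: is_cvg_nneseries => i _ _; rewrite lee_fin.
  apply: nearW => n; rewrite sumEFin lee_fin.
  apply: le_trans (HC n).
  case: (leqP k n) => kn; last by rewrite big_geq ?(ltnW kn)// sumr_ge0.
  by rewrite (@big_cat_nat _ _ _ k 0%N n)//= lerDr sumr_ge0.
move=> H; apply: (@bdd_series_shift _ k).
have F : (\sum_(k <= i <oo) (u i)%:E)%E \is a fin_num.
  by rewrite ge0_fin_numE// nneseries_ge0// => i _ _; rewrite lee_fin.
exists (fine (\sum_(k <= i <oo) (u i)%:E)%E) => n.
rewrite -lee_fin fineK// -sum_nat_shift -sumEFin.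
by apply: nneseries_lim_ge => i _ _; rewrite lee_fin.
Qed.

End bounded_series.

(** * Moments of finite sums of indicators *)

Section finite_moments.
Context {R : realType} {d : measure_display} {X : measurableType d}.
Variable P : {measure set X -> \bar R}.
Hypothesis PT : P setT = 1%E.

Definition rprob (A : set X) : R := fine (P A).
Local Notation pr := rprob.

Lemma prE A : measurable A -> P A = (pr A)%:E.
Proof.
move=> mA; rewrite fineK// ge0_fin_numE//.
apply: (@le_lt_trans _ _ 1%E); last exact: ltry.
by rewrite -PT; apply: le_measure; rewrite ?inE//; exact: measurableT.
Qed.

(** Integrate the pointwise inequality; all moment inequalities below reduce
    to this one. *)
Lemma pr_linear_ge0 (I : eqType) (s : seq I) (c : I -> R) (A : I -> set X) :
  (forall i, i \in s -> measurable (A i)) ->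
  (forall x, 0 <= \sum_(i <- s) c i * \1_(A i) x) ->
  0 <= \sum_(i <- s) c i * pr (A i).
Proof.
move=> mA H.
pose A' i := if i \in s then A i else set0.
have mA' i : measurable (A' i) by rewrite /A'; case: ifPn => // /mA.
have -> : \sum_(i <- s) c i * pr (A i) = \sum_(i <- s) c i * pr (A' i).
  by apply: eq_big_seq => i si; rewrite /A' si.
have H' x : 0 <= \sum_(i <- s) c i * \1_(A' i) x.
  by under eq_big_seq => i si do rewrite /A' si.
have Ifin i : P.-integrable setT (EFin \o (\1_(A' i) : X -> R)).
  apply/integrableP; split; first exact/measurable_EFinP.
  under eq_integral do rewrite /= ger0_norm ?indicE//.
  by rewrite -/(\1_(A' i)) integral_indic// setIT prE// ltry.
suff -> : \sum_(i <- s) c i * pr (A' i) =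
    fine (\int[P]_x (\sum_(i <- s) c i * \1_(A' i) x)%:E).
  by apply: fine_ge0; apply: integral_ge0 => x _; rewrite lee_fin.
under eq_integral do rewrite -sumEFin.
rewrite integral_sum//; last first.
  move=> i; under eq_fun do rewrite EFinM.
  by apply: (@integrableZl _ _ _ _ _ measurableT); exact: Ifin.
rewrite (eq_bigr (fun i => (c i * pr (A' i))%:E)) ?sumEFin// => i _.
under eq_integral do rewrite EFinM.
rewrite integralZl//; last exact: Ifin.
by rewrite integral_indic// setIT prE// EFinM.
Qed.

Lemma pr_ge0 A : 0 <= pr A.
Proof. exact/fine_ge0. Qed.

Lemma prT : pr setT = 1. Proof. by rewrite /rprob PT. Qed.

Lemma pr0 : pr set0 = 0. Proof. by rewrite /rprob measure0. Qed.

Lemma pr_le A B : measurable A -> measurable B -> A `<=` B -> pr A <= pr B.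
Proof.
move=> mA mB AB; rewrite -lee_fin -!prE//.
by apply: le_measure => //; rewrite inE.
Qed.

Lemma pr_leU A B C : measurable A -> measurable B -> measurable C ->
  A `<=` B `|` C -> pr A <= pr B + pr C.
Proof.
move=> mA mB mC ABC; rewrite -lee_fin EFinD -!prE//.
apply: (@le_trans _ _ (P (B `|` C))).
  by apply: le_measure; rewrite ?inE//; exact: measurableU.
exact: measureU2.
Qed.

Lemma indic_bigcup_le (I : eqType) (s : seq I) (A : I -> set X) (B : set X) x :
  (forall x, B x -> exists2 i, i \in s & A i x) ->
  \1_B x <= \sum_(i <- s) \1_(A i) x :> R.
Proof.
move=> H; rewrite indicE; case: (boolP (x \in B)) => [|_]; last first.
  by apply: sumr_ge0 => i _; rewrite indicE.
rewrite inE => /H [i si Aix]; rewrite (big_rem i)//= indicE mem_set//.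
by rewrite lerDl; apply: sumr_ge0 => j _; rewrite indicE.
Qed.

Lemma pr_le_sum (I : eqType) (s : seq I) (A : I -> set X) B :
  (forall i, i \in s -> measurable (A i)) -> measurable B ->
  (forall x, B x -> exists2 i, i \in s & A i x) ->
  pr B <= \sum_(i <- s) pr (A i).
Proof.
move=> mA mB H.
have := @pr_linear_ge0 _ (None :: map Some s)
  (fun o => if o is Some _ then 1 else -1)
  (fun o => if o is Some i then A i else B).
rewrite big_cons big_map/=.
under [X in _ -> _ -> _ <= _ + X]eq_bigr do rewrite mul1r.
rewrite mulN1r addrC subr_ge0; apply.
  move=> [i|] //; rewrite inE/= => /mapP [j sj [->]]; exact: mA.
move=> x; rewrite big_cons big_map mulN1r addrC subr_ge0.
under [leRHS]eq_bigr do rewrite mul1r.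
exact: indic_bigcup_le.
Qed.

Lemma pr_disjoint_sum (s : seq nat) (A : nat -> set X) B : uniq s ->
  (forall i, measurable (A i)) -> measurable B ->
  trivIset setT A -> (forall i, A i `<=` B) ->
  \sum_(i <- s) pr (A i) <= pr B.
Proof.
move=> us mA mB tA AB.
have := @pr_linear_ge0 _ (None :: map Some s)
  (fun o => if o is Some _ then -1 else 1)
  (fun o => if o is Some i then A i else B).
rewrite big_cons big_map/=.
under [X in _ -> _ -> _ <= _ + X]eq_bigr do rewrite mulN1r.
rewrite mul1r sumrN subr_ge0; apply.
  by move=> [i|] // _; exact: mA.
move=> x; rewrite big_cons big_map mul1r.
under eq_bigr do rewrite mulN1r.
rewrite sumrN subr_ge0.
case: (pselect (exists2 i, i \in s & A i x)) => [[i si Aix]|H]; last first.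
  rewrite big_seq big1; [by rewrite indicE|move=> i si]; rewrite indicE memNset// => Aix.
  by apply: H; exists i.
rewrite (big_rem i)//= big_seq big1 ?addr0.
  by rewrite !indicE !mem_set//; exact: AB Aix.
move=> j; rewrite mem_rem_uniq// inE => /andP[ji _].
rewrite indicE memNset// => Ajx; move/eqP: ji; apply.
by apply: tA => //; exists x.
Qed.

(** Every random variable below is a finite sum of indicators, so that its
    first two moments are finite sums of probabilities, and each moment
    inequality amounts to a pointwise one between an indicator and a
    quadratic polynomial. *)
Lemma pr_quadratic_ge0 (I : eqType) (s : seq I) (A : I -> set X) (B : set X)
  (al be ga de : R) :
  (forall i, i \in s -> measurable (A i)) -> measurable B ->
  (forall x, 0 <= al + be * (\sum_(i <- s) \1_(A i) x)
               + ga * (\sum_(i <- s) \1_(A i) x) ^+ 2 + de * \1_B x) ->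
  0 <= al + be * (\sum_(i <- s) pr (A i))
     + ga * (\sum_(i <- s) \sum_(j <- s) pr (A i `&` A j)) + de * pr B.
Proof.
move=> mA mB H.
pose J : eqType := (unit + bool + I + I * I)%type.
pose c (o : J) := match o with
  | inl (inl (inl tt)) => al | inl (inl (inr _)) => de
  | inl (inr _) => be | inr _ => ga end.
pose D (o : J) := match o with
  | inl (inl (inl tt)) => setT | inl (inl (inr _)) => B
  | inl (inr i) => A i | inr ij => A ij.1 `&` A ij.2 end.
pose l : seq J := inl (inl (inl tt)) :: inl (inl (inr true)) ::
  (map (fun i => inl (inr i)) s ++ map inr [seq (i, j) | i <- s, j <- s]).
have E (f : set X -> R) : \sum_(o <- l) c o * f (D o) =
   al * f setT + be * (\sum_(i <- s) f (A i)) +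
   ga * (\sum_(i <- s) \sum_(j <- s) f (A i `&` A j)) + de * f B.
  rewrite /l !big_cons big_cat/= !big_map big_allpairs_dep/=.
  under [X in _ + (_ + (_ + X))]eq_bigr do rewrite -mulr_sumr.
  by rewrite -!mulr_sumr; ring.
have := @pr_linear_ge0 _ l c D; rewrite (E pr) prT mulr1; apply.
  move=> [[[[]|b]|i]|[i j]] //=.
  - by rewrite /l !inE/= mem_cat => /orP[/mapP[i' ? [->]]|/mapP[? ? //]]; exact: mA.
  - rewrite /l !inE/= mem_cat => /orP[/mapP[? ? //]|].
    move=> /mapP[[i' j'] /allpairsP[[u v]] /= [us vs [-> ->]] [-> ->]].
    by apply: measurableI; exact: mA.
move=> x; rewrite (E (fun C => \1_C x)).
have := H x; rewrite indicT/= mulr1.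
suff -> : (\sum_(i <- s) \1_(A i) x) ^+ 2 =
    \sum_(i <- s) \sum_(j <- s) \1_(A i `&` A j) x :> R by [].
rewrite expr2 mulr_suml; apply: eq_bigr => i _.
by rewrite mulr_sumr; apply: eq_bigr => j _; rewrite indicI.
Qed.

Lemma pr_markov (I : eqType) (s : seq I) (A : I -> set X) (B : set X) (c : R) :
  0 < c -> (forall i, i \in s -> measurable (A i)) -> measurable B ->
  (forall x, B x -> c <= \sum_(i <- s) \1_(A i) x) ->
  pr B <= (\sum_(i <- s) pr (A i)) / c.
Proof.
move=> c0 mA mB H; rewrite ler_pdivlMr// mulrC.
have := @pr_quadratic_ge0 _ s A B 0 1 0 (- c) mA mB.
rewrite add0r mul1r mul0r addr0 mulNr subr_ge0; apply => x.
rewrite add0r mul1r mul0r addr0 mulNr subr_ge0 indicE.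
case: (boolP (x \in B)) => [|_]; first by rewrite inE mulr1 => /H.
by rewrite mulr0 sumr_ge0// => i _; rewrite indicE.
Qed.

Lemma pr_chebyshev (I : eqType) (s : seq I) (A : I -> set X) (B : set X) (mu c : R) :
  0 < c -> (forall i, i \in s -> measurable (A i)) -> measurable B ->
  mu = \sum_(i <- s) pr (A i) ->
  (forall x, B x -> c <= `|\sum_(i <- s) \1_(A i) x - mu|) ->
  pr B <= (\sum_(i <- s) \sum_(j <- s) pr (A i `&` A j) - mu ^+ 2) / c ^+ 2.
Proof.
move=> c0 mA mB muE H; rewrite ler_pdivlMr ?exprn_gt0// mulrC.
have := @pr_quadratic_ge0 _ s A B (mu ^+ 2) (- (2 * mu)) 1 (- (c ^+ 2)) mA mB.
rewrite -muE => K.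
have {}K := K _; suff : 0 <= mu ^+ 2 + - (2 * mu) * mu +
    1 * (\sum_(i <- s) \sum_(j <- s) pr (A i `&` A j)) + - c ^+ 2 * pr B by lra.
apply: K => x; set N := \sum_(i <- s) _.
have -> : mu ^+ 2 + - (2 * mu) * N + 1 * N ^+ 2 = (N - mu) ^+ 2 by ring.
rewrite indicE; case: (boolP (x \in B)) => [|_]; last first.
  by rewrite mulr0 addr0 sqr_ge0.
rewrite inE mulr1 => /H; rewrite -/N => cN.
by rewrite subr_ge0 -[leRHS]real_normK ?num_real// ler_sqr ?nnegrE// ltW.
Qed.

(** Paley-Zygmund in linear form, from the pointwise bound [1_(N > 0) >= 2 l
    N - l^2 N^2]. *)
Lemma pr_second_moment (I : eqType) (s : seq I) (A : I -> set X) (B : set X) (l : R) :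
  (forall i, i \in s -> measurable (A i)) -> measurable B ->
  (forall i, i \in s -> A i `<=` B) ->
  2 * l * (\sum_(i <- s) pr (A i)) -
    l ^+ 2 * (\sum_(i <- s) \sum_(j <- s) pr (A i `&` A j)) <= pr B.
Proof.
move=> mA mB H; rewrite -subr_ge0.
have := @pr_quadratic_ge0 _ s A B 0 (- (2 * l)) (l ^+ 2) 1 mA mB => K.
suff : 0 <= 0 + - (2 * l) * (\sum_(i <- s) pr (A i)) +
    l ^+ 2 * (\sum_(i <- s) \sum_(j <- s) pr (A i `&` A j)) + 1 * pr B by lra.
apply: K => x.
case: (pselect (B x)) => Bx.
  rewrite indicE mem_set// mulr1; set N := \sum_(i <- s) _.
  by have := sqr_ge0 (1 - l * N); rewrite expr2; lra.
rewrite [X in _ + _ * X + _ * X ^+ 2]big_seq big1.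
  by rewrite indicE memNset// expr0n !mulr0 !addr0.
by move=> i si; rewrite indicE memNset// => /(H _ si).
Qed.

End finite_moments.

(** * Mixing processes *)

Section mixing_def.
Context {R : realType} {d : measure_display} {X : measurableType d}.
Variables (P : {measure set X -> \bar R}) (tau : X -> X) (phi : X -> nat).

Definition proc (j : nat) (x : X) : nat := phi (iter j tau x).

(** The coordinates being integers, the events of the first [k] coordinates
    are exactly the sets saturated for agreement of these coordinates. *)
Definition cylinder (k : nat) (A : set X) : Prop :=
  forall x y, (forall j, (j < k)%N -> proc j x = proc j y) -> A x -> A y.

(** The errors in the product rule are relative: [th g] measures the
    dependence across [g] skipped coordinates. Since [th 0] is finite,
    adjacent blocks already satisfy the product rule up to a constant factor;
    the variance of the truncated sums calls for the summability of [th g /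
    g.+1]. *)
Record psi_mixing (th : nat -> R) : Prop := PsiMixing {
  pm_total : P setT = 1%E;
  pm_mtau : measurable_fun setT tau;
  pm_mphi : forall n, measurable [set x | phi x = n];
  pm_inv : forall A, measurable A -> P (tau @^-1` A) = P A;
  pm_pos : P [set x | (0 < phi x)%N] = 1%E;
  pm_th0 : forall g, 0 <= th g;
  pm_th_le : forall g, th g <= th 0%N;
  pm_th_cvg : forall e, 0 < e -> exists g, th g <= e;
  pm_th_sum : bdd_series (fun g => th g / g.+1%:R);
  pm_mix : forall k l g A B, cylinder k A -> cylinder l B ->
    `|rprob P (A `&` iter (k + g) tau @^-1` B) - rprob P A * rprob P B|
      <= th g * (rprob P A * rprob P B) }.

End mixing_def.

Lemma measurable_fun_iter {d : measure_display} {X : measurableType d}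
    (T : X -> X) n : measurable_fun setT T -> measurable_fun setT (iter n T).
Proof.
move=> mT; elim: n => [|n IH]; first exact: measurable_id.
exact: (measurableT_comp mT).
Qed.

(** The finite sequence of the first coordinates takes countably many values. *)
Lemma measurable_cylinder {d : measure_display} {X : measurableType d}
    (tau : X -> X) (phi : X -> nat) k A : measurable_fun setT tau ->
  (forall n, measurable [set x | phi x = n]) ->
  cylinder tau phi k A -> measurable A.
Proof.
move=> mtau mphi cA; pose it x := [seq proc tau phi j x | j <- iota 0 k].
have itP x y : it x = it y <-> forall j, (j < k)%N -> proc tau phi j x = proc tau phi j y.
  split=> [e j jk|e]; last first.
    by apply/eq_in_map => j; rewrite mem_iota add0n => /andP[_]; exact: e.
  have := congr1 (fun s => nth 0%N s j) e.
  by rewrite !(nth_map 0%N) ?size_iota// nth_iota.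
have -> : A = \bigcup_n [set x | A x /\ pickle (it x) = n].
  apply/seteqP; split=> [x Ax|x [n _ []]//].
  by exists (pickle (it x)).
apply: bigcup_measurable => n _.
case: (pselect (exists y, A y /\ pickle (it y) = n)) => [[y [Ay yn]]|no]; last first.
  rewrite (_ : [set x | _] = set0)//; apply/seteqP; split=> // x Hx.
  by apply: no; exists x.
rewrite (_ : [set x | _] = \bigcap_(j in `I_k) [set x | proc tau phi j x = proc tau phi j y]).
  by apply: bigcap_measurableType => j _; rewrite -[X in measurable X]setTI;
    exact: (measurable_fun_iter j mtau measurableT (mphi (proc tau phi j y))).
apply/seteqP; split=> x /=.
  rewrite -yn => -[_ /(pcan_inj pickleK)] /itP e j /= jk; exact: e.
move=> e; split; first by apply: cA Ay => j jk; rewrite e.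
by rewrite -yn; congr pickle; apply/itP.
Qed.

(** The bookkeeping of a variance: off the diagonal, an entry at distance
    [g.+1] exceeds the product [M] by a relative error [th g]. *)
Lemma double_sum_le {R : realType} (c : nat -> nat -> R) (th : nat -> R) D M k :
  0 <= M -> (forall g, 0 <= th g) -> (forall j, c j j <= D) ->
  (forall j i, (j < i)%N -> c j i <= (1 + th (i - j.+1)%N) * M) ->
  (forall j i, (j < i)%N -> c i j <= (1 + th (i - j.+1)%N) * M) ->
  \sum_(0 <= j < k) \sum_(0 <= i < k) c j i <=
    k%:R * D + k%:R ^+ 2 * M + 2 * k%:R * M * \sum_(0 <= g < k) th g.
Proof.
move=> M0 th0 cD c1 c2; elim: k => [|k IH].
  by rewrite !big_geq// expr0n/= !(mul0r, mulr0, addr0).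
rewrite big_nat_recr//= big_nat_recr//=.
under eq_bigr do rewrite big_nat_recr//=.
rewrite big_split/=.
have H (F : nat -> R) : (forall j, (j < k)%N -> F j <= (1 + th (k - j.+1)%N) * M) ->
    \sum_(0 <= j < k) F j <= k%:R * M + M * \sum_(0 <= g < k) th g.
  move=> HF; apply: (@le_trans _ _ (\sum_(0 <= j < k) (1 + th (k - j.+1)%N) * M)).
    by apply: ler_sum_nat => j /andP[_ jk]; exact: HF.
  rewrite -mulr_suml big_split/= sumr_const_nat subn0 mulrDl; apply: lerD => //.
  rewrite mulrC ler_wpM2l// [leRHS]big_nat_rev/= add0n.
  by apply: ler_sum_nat => i _.
have h1 := H (fun j => c j k) (fun j jk => c1 _ _ jk).
have h2 := H (fun j => c k j) (fun j jk => c2 _ _ jk).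
rewrite [X in _ <= _ + _ + _ * X]big_nat_recr//=.
have h3 := cD k; have t0 := th0 k.
have T0 : 0 <= \sum_(0 <= g < k) th g by apply: sumr_ge0.
rewrite -natr1; set K : R := k%:R in h1 h2 IH *.
have K0 : 0 <= K by rewrite ler0n.
set T := \sum_(0 <= g < k) th g in T0 h1 h2 IH *.
have e1 : 0 <= 2 * (K + 1) * M * th k by rewrite !mulr_ge0// addr_ge0.
nra.
Qed.

Section mixing.
Context {R : realType} {d : measure_display} {X : measurableType d}.
Variables (P : {measure set X -> \bar R}) (tau : X -> X) (phi : X -> nat).
Variable th : nat -> R.
Hypothesis H : psi_mixing P tau phi th.
Local Notation pr := (rprob P).
Local Notation crd := (proc tau phi).
Local Notation cyl := (cylinder tau phi).
Let PT := pm_total H.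
Let th0 := pm_th0 H.

Definition tail s := pr [set x | (s < phi x)%N].
(** The mean of [phi] truncated at [n], as a sum of tails. *)
Definition trmean n := \sum_(0 <= s < n) tail s.

Lemma crdD i j x : crd i (iter j tau x) = crd (i + j) x.
Proof. by rewrite /proc iterD. Qed.

Lemma measurable_preim j A : measurable A -> measurable (iter j tau @^-1` A).
Proof.
move=> mA; rewrite -[X in measurable X]setTI.
exact: (measurable_fun_iter j (pm_mtau H)).
Qed.

Lemma measurable_cyl k A : cyl k A -> measurable A.
Proof. exact: measurable_cylinder (pm_mtau H) (pm_mphi H). Qed.

Lemma pr_preim j A : measurable A -> pr (iter j tau @^-1` A) = pr A.
Proof.
move=> mA; elim: j => [//|j IH].
rewrite -IH /rprob -(pm_inv H (measurable_preim j mA)); congr fine.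
by congr (P _); apply/funext => x; rewrite /preimage/mkset -iterSr.
Qed.

Lemma cyl_le k l A : (k <= l)%N -> cyl k A -> cyl l A.
Proof. by move=> kl cA x y e; apply: cA => j jk; apply: e; exact: leq_trans kl. Qed.

Lemma cylI k A B : cyl k A -> cyl k B -> cyl k (A `&` B).
Proof. by move=> cA cB x y e [Ax Bx]; split; [exact: cA Ax|exact: cB Bx]. Qed.

Lemma cyl_crd j (Q : set nat) : cyl j.+1 [set x | Q (crd j x)].
Proof. by move=> x y /= <-. Qed.

Lemma cyl_sum (f : nat -> nat) (Q : set nat) k :
  cyl k [set x | Q (\sum_(0 <= j < k) f (crd j x))%N].
Proof.
move=> x y e /=; rewrite (_ : \sum_(0 <= j < k) f (crd j x) =
  \sum_(0 <= j < k) f (crd j y))%N//.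
by apply: eq_big_nat => j /andP[_ jk]; rewrite e.
Qed.

Lemma cyl_exists s k : cyl k [set x | exists2 j, (j < k)%N & (s < crd j x)%N].
Proof. by move=> x y e /= [j jk sj]; exists j => //; rewrite -e. Qed.

Lemma mix_le k l g A B : cyl k A -> cyl l B ->
  pr (A `&` iter (k + g) tau @^-1` B) <= (1 + th g) * (pr A * pr B).
Proof.
move=> cA cB; have := pm_mix H g cA cB; rewrite ler_norml => /andP[_]; lra.
Qed.

Lemma mix_ge k l g A B : cyl k A -> cyl l B ->
  (1 - th g) * (pr A * pr B) <= pr (A `&` iter (k + g) tau @^-1` B).
Proof.
move=> cA cB; have := pm_mix H g cA cB; rewrite ler_norml => /andP[]; lra.
Qed.

Lemma tail_ge0 s : 0 <= tail s. Proof. exact: pr_ge0. Qed.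

Lemma measurable_gt j s : measurable [set x | (s < crd j x)%N].
Proof. exact: (measurable_cyl (@cyl_crd j (fun n => (s < n)%N))). Qed.

Lemma tail_nincr s t : (s <= t)%N -> tail t <= tail s.
Proof.
move=> st; apply: (pr_le PT (measurable_gt 0 t) (measurable_gt 0 s)) => x /=.
exact: leq_ltn_trans.
Qed.

Lemma tail0 : tail 0 = 1.
Proof. by rewrite /tail /rprob (pm_pos H). Qed.

Lemma pr_gt j s : pr [set x | (s < crd j x)%N] = tail s.
Proof. exact: (pr_preim j (measurable_gt 0 s)). Qed.

Lemma pr_gt_pair j i s t : (j < i)%N ->
  pr ([set x | (s < crd j x)%N] `&` [set x | (t < crd i x)%N]) <=
    (1 + th (i - j.+1)%N) * (tail s * tail t).
Proof.
move=> ji; have := @mix_le 1 1 (i - j.+1) _ _ (@cyl_crd 0 (fun n => (s < n)%N))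
   (@cyl_crd 0 (fun n => (t < n)%N)).
apply: le_trans; rewrite -[leRHS](pr_preim j); last first.
  apply: measurableI; first exact: (measurable_gt 0).
  apply: measurable_preim; exact: (measurable_gt 0).
rewrite le_eqVlt; apply/orP; left; apply/eqP; congr pr.
have iE : i = (1 + (i - j.+1) + j)%N by lia.
by apply/funext => x; rewrite /setI/preimage/mkset !crdD add0n -iE.
Qed.

Lemma pr_gt_pair_neq j i s t : j != i ->
  pr ([set x | (s < crd j x)%N] `&` [set x | (t < crd i x)%N]) <=
    (1 + th 0%N) * (tail s * tail t).
Proof.
have W (u v : nat) : (1 + th (u - v)%N) * (tail s * tail t) <=
    (1 + th 0%N) * (tail s * tail t).
  by rewrite ler_wpM2r ?mulr_ge0 ?tail_ge0// lerD2l; exact: pm_th_le H _.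
case: ltngtP => // ji _.
  exact: le_trans (pr_gt_pair s t ji) (W _ _).
by rewrite setIC [tail s * _]mulrC; apply: le_trans (pr_gt_pair t s ji) _;
  rewrite [tail t * _]mulrC W.
Qed.

Lemma pr_gt_pair_eq j s t :
  pr ([set x | (s < crd j x)%N] `&` [set x | (t < crd j x)%N]) <= tail s.
Proof.
rewrite -(pr_gt j s).
exact: (pr_le PT (measurableI _ _ (measurable_gt j s) (measurable_gt j t))
  (measurable_gt j s) (@subIsetl _ _ _)).
Qed.

(** The part of [n] lying in the slab between [u] and [v], as a sum of
    indicators to which the moment lemmas apply. *)
Definition trunc u v n : nat := \sum_(u <= s < v) (s < n)%N.

Lemma truncE u v n : (u <= v)%N -> trunc u v n = (minn n v - minn n u)%N.
Proof.
move=> uv; rewrite /trunc -(subnK uv).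
elim: (v - u)%N => [|w IH]; first by rewrite add0n big_geq// subnn.
rewrite addSn big_nat_recr ?leq_addl//= IH; lia.
Qed.

Lemma trunc_indic u v k x :
  (\sum_(0 <= j < k) trunc u v (crd j x))%:R =
  \sum_(js <- [seq (j, s) | j <- index_iota 0 k, s <- index_iota u v])
     \1_[set y | (js.2 < crd js.1 y)%N] x :> R.
Proof.
rewrite big_allpairs_dep/= natr_sum; apply: eq_bigr => j _.
rewrite /trunc natr_sum; apply: eq_bigr => s _.
by rewrite indicE; congr (nat_of_bool _)%:R; apply/idP/idP; rewrite ?inE.
Qed.

Lemma sum_tail u v : (u <= v)%N ->
  \sum_(u <= s < v) tail s = trmean v - trmean u.
Proof.
by move=> uv; rewrite /trmean (@big_cat_nat _ _ _ u 0%N v)//= addrAC subrr add0r.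
Qed.

Lemma trunc_mean u v k : (u <= v)%N ->
  \sum_(js <- [seq (j, s) | j <- index_iota 0 k, s <- index_iota u v])
     pr [set y | (js.2 < crd js.1 y)%N] = k%:R * (trmean v - trmean u).
Proof.
move=> uv; rewrite big_allpairs_dep/=.
under eq_bigr do under eq_bigr do rewrite pr_gt.
by rewrite sum_tail// sumr_const_nat subn0 mulr_natl.
Qed.

Lemma pr_trunc_markov u v k (c : R) : (u <= v)%N -> 0 < c ->
  pr [set x | c <= (\sum_(0 <= j < k) trunc u v (crd j x))%:R] <=
    k%:R * (trmean v - trmean u) / c.
Proof.
move=> uv c0; rewrite -trunc_mean//; apply: pr_markov => //.
- by move=> [j s] _; exact: measurable_gt.
- exact: (measurable_cyl (@cyl_sum _ (fun n => c <= n%:R) k)).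
- by move=> x /=; rewrite trunc_indic.
Qed.

(** The diagonal of the second moment contributes [w * trmean w] for each
    coordinate; what remains beyond the squared mean is the mixing error. *)
Lemma pr_trunc_chebyshev w k (c : R) : 0 < c ->
  pr [set x | c <= `|(\sum_(0 <= j < k) trunc 0 w (crd j x))%:R - k%:R * trmean w| ] <=
    (k%:R * w%:R * trmean w +
     2 * k%:R * trmean w ^+ 2 * \sum_(0 <= g < k) th g) / c ^+ 2.
Proof.
move=> c0; have L0 : trmean 0 = 0 by rewrite /trmean big_geq.
have := @pr_chebyshev _ _ _ P PT _ [seq (j, s) | j <- index_iota 0 k, s <- index_iota 0 w]
  (fun js => [set y | (js.2 < crd js.1 y)%N])
  [set x | c <= `|(\sum_(0 <= j < k) trunc 0 w (crd j x))%:R - k%:R * trmean w| ]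
  (k%:R * trmean w) c c0.
rewrite trunc_mean// L0 subr0 => K.
apply: le_trans (K _ _ erefl _) _.
- by move=> [j s] _; exact: measurable_gt.
- exact: (measurable_cyl (@cyl_sum _ (fun n => c <= `|n%:R - k%:R * trmean w|) k)).
- by move=> x /=; rewrite trunc_indic.
rewrite ler_wpM2r ?invr_ge0 ?sqr_ge0//.
rewrite big_allpairs_dep/=.
under eq_bigr do under eq_bigr do rewrite big_allpairs_dep/=.
under eq_bigr do rewrite exchange_big/=.
have sq : trmean w ^+ 2 =
    \sum_(0 <= s < w) \sum_(0 <= t < w) tail s * tail t.
  rewrite expr2 /trmean mulr_suml; apply: eq_bigr => s _; by rewrite mulr_sumr.
have := @double_sum_le _ (fun j i => \sum_(0 <= s < w) \sum_(0 <= t < w)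
   pr ([set y | (s < crd j y)%N] `&` [set y | (t < crd i y)%N]))
   th (w%:R * trmean w) (trmean w ^+ 2) k (sqr_ge0 _) th0.
move=> K2; rewrite lerBlDr; apply: le_trans (K2 _ _ _) _.
- move=> j; rewrite /trmean mulr_sumr; apply: ler_sum => s _.
  apply: (@le_trans _ _ (\sum_(0 <= t < w) tail s)).
    by apply: ler_sum => t _; exact: pr_gt_pair_eq.
  by rewrite sumr_const_nat subn0 mulr_natl.
- move=> j i ji; rewrite sq mulr_sumr; apply: ler_sum => s _.
  by rewrite mulr_sumr; apply: ler_sum => t _; exact: pr_gt_pair.
- move=> j i ji; rewrite sq mulr_sumr; apply: ler_sum => s _.
  rewrite mulr_sumr; apply: ler_sum => t _; rewrite setIC [tail s * _]mulrC.
  exact: pr_gt_pair.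
by rewrite exprMn; lra.
Qed.

(** When a sum of terms at most [b] exceeds [2 y + b], the partial sums first
    pass [y] without passing [y + b], and what remains passes [y] again. *)
Lemma pr_sum_doubling (f : nat -> nat) b y k : (forall n, (f n <= b)%N) ->
  pr [set x | (y + y + b < \sum_(0 <= j < k) f (crd j x))%N] <=
    (1 + th 0%N) * pr [set x | (y < \sum_(0 <= j < k) f (crd j x))%N] ^+ 2.
Proof.
move=> fb; set G := [set x | (y < _)%N].
pose S n x := (\sum_(0 <= j < n) f (crd j x))%N.
have SS n x : S n.+1 x = (S n x + f (crd n x))%N by rewrite /S big_nat_recr.
have Smono m n x : (m <= n)%N -> (S m x <= S n x)%N.
  by move=> mn; rewrite /S (@big_cat_nat _ _ _ m 0%N n)//= leq_addr.
(* [E n]: the sum first passes [y] with its term of index [n]; [B n]: the sum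
   of the later terms passes [y] as well *)
pose E n := [set x | (n < k)%N /\ (S n x <= y < S n.+1 x)%N].
have cE n : cyl n.+1 (E n).
  move=> x z e [nk Sn]; split=> //.
  have eS i : (i <= n.+1)%N -> S i z = S i x.
    move=> ik; apply: eq_big_nat => j /andP[_ ji]; rewrite e//.
    exact: leq_trans ik.
  by rewrite !eS.
pose B n := [set x | (y < S (k - n.+1) x)%N].
have cB n : cyl (k - n.+1) (B n) by exact: (@cyl_sum f (fun m => (y < m)%N)).
have mE n := measurable_cyl (cE n).
have mB n := measurable_cyl (cB n).
have mG : measurable G by exact: (measurable_cyl (@cyl_sum f (fun m => (y < m)%N) k)).
apply: (@le_trans _ _ (\sum_(0 <= n < k) pr (E n `&` iter (n.+1 + 0) tau @^-1` B n))).
  apply: pr_le_sum => //.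
  - by move=> n _; apply: measurableI => //; exact: measurable_preim.
  - exact: (measurable_cyl (@cyl_sum f (fun m => (y + y + b < m)%N) k)).
  move=> x /=; rewrite -/(S k x) => big.
  have ex : exists n, (y < S n x)%N by exists k; lia.
  case: (ex_minnP ex) => -[|n] yn nmin.
    by move: yn; rewrite /S big_geq.
  have Sn : (S n x <= y)%N.
    by rewrite leqNgt; apply/negP => /nmin; rewrite ltnn.
  have nk : (n < k)%N by apply: nmin; lia.
  exists n; first by rewrite mem_index_iota.
  split; first by split=> //; rewrite Sn.
  rewrite /B /preimage/= addn0.
  have -> : S (k - n.+1)%N (iter n.+1 tau x) = (S k x - S n.+1 x)%N.
    rewrite /S [X in _ = (X - _)%N](@big_cat_nat _ _ _ n.+1)//= addKn.
    rewrite -{2}[n.+1]add0n big_addn; apply: eq_bigr => j _.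
    by rewrite -crdD.
  have := SS n x; have := fb (crd n x); lia.
apply: (@le_trans _ _ (\sum_(0 <= n < k) (1 + th 0%N) * (pr (E n) * pr G))).
  apply: ler_sum => n _; apply: le_trans (mix_le 0 (cE n) (cB n)) _.
  rewrite ler_wpM2l ?addr_ge0// ler_wpM2l ?pr_ge0//.
  apply: pr_le => // x /=; rewrite /B /G /= => /leq_trans; apply.
  by apply: Smono; rewrite leq_subr.
rewrite -mulr_sumr ler_wpM2l ?addr_ge0// -mulr_suml expr2 ler_wpM2r ?pr_ge0//.
apply: pr_disjoint_sum => //.
- exact: iota_uniq.
- apply/trivIsetP => i j _ _; wlog ij : i j / (i < j)%N.
    move=> W; case: (ltngtP i j) => // ij _; first by apply: W; rewrite ?lt_eqF.
    by rewrite setIC; apply: W; rewrite ?lt_eqF.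
  move=> _; apply/seteqP; split=> // x [[_ /andP[_ h1]] [_ /andP[h2 _]]].
  have := Smono _ _ x ij; lia.
- move=> n x [nk /andP[_ h]]; rewrite /G /=; apply: leq_trans h _.
  exact: Smono.
Qed.

Lemma pr_exists_le s k :
  pr [set x | exists2 j, (j < k)%N & (s < crd j x)%N] <= k%:R * tail s.
Proof.
rewrite (_ : k%:R * tail s = \sum_(0 <= j < k) pr [set x | (s < crd j x)%N]).
  apply: pr_le_sum => //; first by move=> *; exact: measurable_gt.
  - exact: (measurable_cyl (@cyl_exists s k)).
  - by move=> x [j jk sj]; exists j => //; rewrite mem_index_iota.
under eq_bigr do rewrite pr_gt.
by rewrite sumr_const_nat subn0 mulr_natl.
Qed.

End mixing.

(** * Dyadic scales and hazards *)

Section scales.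
Context {R : realType} {d : measure_display} {X : measurableType d}.
Variables (P : {measure set X -> \bar R}) (tau : X -> X) (phi : X -> nat).
Variable th : nat -> R.
Hypothesis H : psi_mixing P tau phi th.
Local Notation pr := (rprob P).
Local Notation crd := (proc tau phi).
Local Notation cyl := (cylinder tau phi).
Local Notation tail := (tail P phi).
Local Notation L := (trmean P phi).
Let PT := pm_total H.
Let th0 := pm_th0 H.

(** The number of terms whose sum is of order [2 ^ i]. *)
Definition scale (i : nat) : R := 2 ^+ i / L (2 ^ i)%N.
(** Up to constants, the probability that one of [scale i] terms is as large
    as their whole sum should be; see [pr_hit_win_le] and [pr_hit_win_ge]. *)
Definition hazard (i : nat) : R := 2 ^+ i * tail (2 ^ i).-1 / L (2 ^ i)%N.

Lemma pow2_gt0 i : 0 < 2 ^+ i :> R. Proof. exact: exprn_gt0. Qed.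

Lemma trmean_le m n : (m <= n)%N -> L m <= L n.
Proof.
by move=> mn; rewrite -subr_ge0 -sum_tail// sumr_ge0// => s _; exact: tail_ge0.
Qed.

Lemma trmeanD_le m k : L (m + k)%N - L m <= k%:R * tail m.
Proof.
rewrite -sum_tail ?leq_addr// addnC sum_nat_shift.
rewrite mulr_natl -[X in _ *+ X]subn0 -sumr_const_nat.
by apply: ler_sum => s _; apply: (tail_nincr H); rewrite leq_addl.
Qed.

Lemma trmean0 : L 0 = 0. Proof. by rewrite /trmean big_geq. Qed.

Lemma trmean1 : L 1 = 1. Proof. by rewrite /trmean big_nat1 (tail0 H). Qed.

Lemma trmean_ge1 n : (0 < n)%N -> 1 <= L n.
Proof. by move=> n0; rewrite -trmean1; exact: trmean_le. Qed.

Lemma trmean_le_nat n : L n <= n%:R.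
Proof.
have := trmeanD_le 0 n; rewrite trmean0 subr0 add0n => /le_trans; apply.
by rewrite (tail0 H) mulr1.
Qed.

Lemma trmean_ge_tail n : n%:R * tail n.-1 <= L n.
Proof.
rewrite mulr_natl -[X in _ *+ X]subn0 -sumr_const_nat.
by apply: ler_sum_nat => s /andP[_ sn]; apply: (tail_nincr H); case: n sn.
Qed.

Lemma L2_ge1 i : 1 <= L (2 ^ i)%N.
Proof. by apply: trmean_ge1; rewrite expn_gt0. Qed.

Lemma L2_gt0 i : 0 < L (2 ^ i)%N.
Proof. exact: lt_le_trans ltr01 (L2_ge1 i). Qed.

Lemma scale_gt0 i : 0 < scale i.
Proof. by rewrite divr_gt0 ?pow2_gt0 ?L2_gt0. Qed.

Lemma scale_mean i : scale i * L (2 ^ i)%N = 2 ^+ i.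
Proof. by rewrite divfK// gt_eqF ?L2_gt0. Qed.

Lemma hazard_mean i : hazard i * L (2 ^ i)%N = 2 ^+ i * tail (2 ^ i).-1.
Proof. by rewrite divfK// gt_eqF ?L2_gt0. Qed.

Lemma hazard_ge0 i : 0 <= hazard i.
Proof.
by rewrite divr_ge0 ?mulr_ge0 ?tail_ge0 ?(ltW (L2_gt0 _)) ?(ltW (pow2_gt0 _)).
Qed.

Lemma hazard_le1 i : hazard i <= 1.
Proof.
by rewrite ler_pdivrMr ?L2_gt0// mul1r -natrX; exact: trmean_ge_tail.
Qed.

Lemma L2S_le i : L (2 ^ i.+1)%N <= (1 + hazard i) * L (2 ^ i)%N.
Proof.
have := trmeanD_le (2 ^ i) (2 ^ i); rewrite addnn -mul2n -expnS.
rewrite mulrDl mul1r hazard_mean lerBlDl => /le_trans; apply.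
by rewrite lerD2l natrX ler_wpM2l ?(ltW (pow2_gt0 _))// (tail_nincr H)// leq_pred.
Qed.

Lemma L2_le i j : (i <= j)%N -> L (2 ^ i)%N <= L (2 ^ j)%N.
Proof. by move=> ij; apply: trmean_le; rewrite leq_exp2l. Qed.

Lemma tail2_le i : 2 ^+ i * tail (2 ^ i) <= hazard i * L (2 ^ i)%N.
Proof.
by rewrite hazard_mean ler_wpM2l ?(ltW (pow2_gt0 _))// (tail_nincr H)// leq_pred.
Qed.

Lemma scaleS_ge i : 2 * scale i <= (1 + hazard i) * scale i.+1.
Proof.
rewrite /scale exprS !mulrA ler_pdivrMr ?L2_gt0// mulrAC ler_pdivlMr ?L2_gt0//.
have := L2S_le i; have := pow2_gt0 i; nra.
Qed.

Lemma scale_le_S i : scale i <= scale i.+1.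
Proof.
have := scaleS_ge i; have := hazard_le1 i; have := scale_gt0 i.+1; nra.
Qed.

Lemma scale_le i j : (i <= j)%N -> scale i <= scale j.
Proof.
move=> /subnK <-; elim: (j - i)%N => [//|k IH].
by rewrite addSn; exact: le_trans IH (scale_le_S _).
Qed.

Lemma scale_growth i : hazard i <= 1 / 2 -> scale i <= 3 / 4 * scale i.+1.
Proof. have := scaleS_ge i; have := scale_gt0 i.+1; nra. Qed.

Lemma tail_small e : 0 < e -> exists N, tail N <= e.
Proof.
move=> e0.
have := @nonincreasing_cvg_mu _ _ R P (fun s => [set x | (s < phi x)%N]).
have -> : \bigcap_s [set x | (s < phi x)%N] = set0.
  by apply/seteqP; split=> // x /(_ (phi x) I) /=; rewrite ltnn.
rewrite measure0 => C.
have : P [set x | (s < phi x)%N] @[s --> \oo] --> 0%E.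
  apply: C => //.
  - by rewrite (prE PT (measurable_gt H 0 0)) ltry.
  - move=> s; exact: (measurable_gt H 0 s).
  - by move=> m n mn; apply/subsetPset => x /=; exact: leq_ltn_trans.
move=> /fine_cvgP [_] /cvgrPdist_le /(_ _ e0) [N _ HN].
exists N; have := HN N (leqnn N); rewrite /= sub0r normrN ger0_norm//.
Qed.

(** The mean of [phi] truncated at [n] is [o(n)], because [phi] is finite. *)
Lemma trmean_small e : 0 < e -> exists N, forall n, (N <= n)%N -> L n <= e * n%:R.
Proof.
move=> e0; have [s hs] : exists s, tail s <= e / 2 by apply: tail_small; lra.
exists (Num.truncn (s%:R / (e / 2))).+1 => n Nn.
have h1 : s%:R / (e / 2) <= n%:R.
  apply: le_trans (ltW (truncnS_gt _)) _; by rewrite ler_nat.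
have h2 : s%:R <= e / 2 * n%:R by rewrite mulrC -ler_pdivrMr//; lra.
have n0 : 0 <= n%:R :> R by [].
case: (leqP s n) => sn; last first.
  have := trmean_le_nat n; have : n%:R <= s%:R :> R by rewrite ler_nat ltnW.
  nra.
have := trmeanD_le s (n - s); rewrite subnKC// natrB//.
have := trmean_le_nat s; have := tail_ge0 P phi s; have : s%:R <= n%:R :> R by rewrite ler_nat.
have : 0 <= s%:R :> R by [].
nra.
Qed.

Lemma scale_large C : exists N, forall i, (N <= i)%N -> C <= scale i.
Proof.
have e0 : 0 < (`|C| + 1)^-1 by rewrite invr_gt0; have := normr_ge0 C; lra.
have [N HN] := trmean_small e0; exists N => i Ni.
have i2 : (i <= 2 ^ i)%N by rewrite ltnW// ltn_expl.
have := HN _ (leq_trans Ni i2).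
rewrite mulrC ler_pdivlMr ?natrX; last by have := normr_ge0 C; lra.
rewrite /scale ler_pdivlMr ?L2_gt0// => h.
have := ler_norm C; have := L2_gt0 i; nra.
Qed.

(** ** Truncation levels *)

(** A majorant of the hazards that inherits their square summability and
    decays no faster than [(6 / 7) ^+ i]. The slow decay makes truncation
    levels proportional to [rho i ^+ 2] possible, and bounds [rho] at earlier
    scales by [rho i] times a power of [7 / 6]. *)
Fixpoint rho (i : nat) : R :=
  if i is j.+1 then 6 / 7 * rho j + hazard j else 1.

Lemma rho_gt0 i : 0 < rho i.
Proof. by elim: i => [|i IH] //=; have := hazard_ge0 i; lra. Qed.

Lemma rho_ge i : (6 / 7) ^+ i <= rho i.
Proof.
elim: i => [|i IH] /=; first by rewrite expr0.
by rewrite exprS; have := hazard_ge0 i; lra.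
Qed.

Lemma rho_half i : (1 / 2) ^+ i <= rho i ^+ 2.
Proof.
have := rho_ge i; have h : 0 <= (6 / 7) ^+ i :> R by apply: exprn_ge0; lra.
move=> h1; apply: (@le_trans _ _ (((6 / 7) ^+ i) ^+ 2)); last first.
  by rewrite ler_sqr ?nnegrE// (le_trans h).
by rewrite -exprM mulnC exprM; apply: lerXn2r; rewrite ?nnegrE ?expr2; lra.
Qed.

Definition summable_hazard := bdd_series (fun i => hazard i ^+ 2).

Lemma bdd_rho2 : summable_hazard -> bdd_series (fun i => rho i ^+ 2).
Proof.
move=> S; apply: (@bdd_series_recursion _ _ (fun i => 7 * hazard i ^+ 2) (6 / 7)).
- lra.
- by move=> i; exact: sqr_ge0.
- move=> i /=; have := sqr_ge0 (rho i - 7 * hazard i); rewrite !expr2; nra.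
- by apply: bdd_seriesZ.
Qed.

Lemma rho_mono_back i : rho i <= 7 / 6 * rho i.+1.
Proof. by rewrite /=; have := hazard_ge0 i; lra. Qed.

(** Going back one dyadic step costs the hazard of that step, which is at
    most [rho]; as [rho] grows by a factor [7 / 6] at most on the way, the
    costs of [h] steps form a geometric sum. *)
Lemma trmean_loss h i : (h <= i)%N ->
  L (2 ^ i)%N - L (2 ^ (i - h))%N <=
    6 * ((7 / 6) ^+ h - 1) * rho i * L (2 ^ i)%N.
Proof.
elim: h i => [|h IH] [|i] // hi; rewrite ?subn0 ?expr0 ?subrr ?mulr0 ?mul0r//.
rewrite subSS; have := IH i hi; have := L2S_le i.
have := rho_mono_back i; have := L2_le (leqnSn i); have := hazard_ge0 i.
have hr : hazard i <= rho i.+1 by rewrite /=; have := rho_gt0 i; lra.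
have := rho_gt0 i; have := L2_gt0 i; have := rho_gt0 i.+1.
have q1 : 1 <= (7 / 6) ^+ h :> R by apply: exprn_ege1; lra.
rewrite exprS; set q := (7 / 6) ^+ h in q1 *.
set l := L (2 ^ i.+1)%N; set l'' := L (2 ^ i)%N; set l' := L (2 ^ (i - h))%N.
move: hr; set r := hazard i; set p := rho i.+1; set p' := rho i => hr.
move=> p0 l0 p'0 r0 ll' pp Hl' Hl''.
have e1 : 6 * (q - 1) * p' * l'' <= 6 * (q - 1) * (7 / 6 * p) * l.
  apply: ler_pM => //; [|exact: ltW|].
  - by rewrite mulr_ge0 ?(ltW p'0)//; lra.
  - by rewrite ler_wpM2l//; lra.
have e2 : r * l'' <= p * l by apply: ler_pM => //; exact: ltW.
nra.
Qed.

(** The level [w i] is low enough for Chebyshev's inequality to give a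
    summable bound, and high enough for the truncated fraction [mu i] of the
    mean to have summable fourth powers. Take [w i = 2 ^ (i - h)] with [h]
    minimal such that [(1 / 2) ^+ h <= rho i ^+ 2]: the loss is then of order
    [(7 / 6) ^+ h * rho i], and [(7 / 6) ^+ 4 <= 2] makes its fourth power at
    most of order [rho i ^+ 2]. *)
Lemma truncation_levels : summable_hazard ->
  exists (w : nat -> nat) (mu : nat -> R),
  [/\ forall i, (w i <= 2 ^ i)%N, forall i, 0 <= mu i,
     forall i, L (2 ^ i)%N - L (w i) <= mu i * L (2 ^ i)%N,
     bdd_series (fun i => (w i)%:R / 2 ^+ i : R) &
     bdd_series (fun i => mu i ^+ 4)].
Proof.
move=> S.
have ex i : exists h, (1 / 2) ^+ h <= rho i ^+ 2 by exists i; exact: rho_half.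
pose h i := ex_minn (ex i).
have hi i : (h i <= i)%N by rewrite /h; case: ex_minnP => n _; apply; exact: rho_half.
pose mu i := 6 * ((7 / 6) ^+ h i - 1) * rho i.
exists (fun i => 2 ^ (i - h i))%N, mu; split.
- by move=> i; rewrite leq_exp2l// leq_subr.
- move=> i; rewrite /mu mulr_ge0 ?(ltW (rho_gt0 i))// mulr_ge0// subr_ge0.
  by apply: exprn_ege1; lra.
- by move=> i; exact: trmean_loss.
- apply: bdd_series_le (bdd_rho2 S) => i; rewrite natrX.
  have -> : 2 ^+ (i - h i) / 2 ^+ i = (1 / 2) ^+ h i :> R.
    have -> : 2 ^+ i = 2 ^+ (i - h i) * 2 ^+ h i :> R by rewrite -exprD subnK.
    rewrite invfM mulrA divff ?gt_eqF ?pow2_gt0//.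
    by rewrite !mul1r exprVn.
  by rewrite /h; case: ex_minnP.
- have C0 : 0 <= 6 ^+ 4 * 2 :> R by rewrite mulr_ge0// exprn_ge0.
  apply: (bdd_series_le_from (i0 := 0) C0 _ _ (bdd_rho2 S)).
    by move=> i; exact: sqr_ge0.
  move=> i _; rewrite /mu /h; case: ex_minnP => -[|n] _ hmin.
    by rewrite expr0 subrr mulr0 mul0r expr0n/= mulr_ge0// sqr_ge0.
  have {}hmin : rho i ^+ 2 < (1 / 2) ^+ n.
    by rewrite ltNge; apply/negP => /hmin; rewrite ltnn.
  have q1 : 1 <= (7 / 6) ^+ n.+1 :> R by apply: exprn_ege1; lra.
  have q4 : ((7 / 6) ^+ n.+1) ^+ 4 <= 2 ^+ n.+1 :> R.
    rewrite -exprM mulnC exprM; apply: lerXn2r; rewrite ?nnegrE ?exprn_ge0//; lra.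
  set q := (7 / 6) ^+ n.+1 in q1 q4 *.
  have e : (6 * (q - 1)) ^+ 4 <= 6 ^+ 4 * 2 ^+ n.+1.
    apply: (@le_trans _ _ (6 ^+ 4 * q ^+ 4)); last by rewrite ler_wpM2l// exprn_ge0.
    by rewrite -exprMn; apply: lerXn2r; rewrite ?nnegrE; lra.
  rewrite exprMn.
  have e2 : 2 ^+ n * rho i ^+ 2 <= 1.
    rewrite -ler_pdivlMl ?pow2_gt0// mulr1; apply: (le_trans (ltW hmin)).
    by rewrite mul1r exprVn.
  have e3 := sqr_ge0 (rho i).
  apply: (@le_trans _ _ (6 ^+ 4 * 2 ^+ n.+1 * rho i ^+ 4)).
    by rewrite ler_wpM2r ?exprn_ge0 ?(ltW (rho_gt0 i)).
  have -> : 6 ^+ 4 * 2 ^+ n.+1 * rho i ^+ 4 =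
    6 ^+ 4 * 2 * rho i ^+ 2 * (2 ^+ n * rho i ^+ 2).
    by rewrite (_ : 4%N = (2 + 2)%N)// [rho i ^+ _]exprD exprS; move: (6 ^+ _) => c; ring.
  by rewrite -[leRHS]mulr1 ler_wpM2l// mulr_ge0.
Qed.

(** The length of a window of terms whose sum should be about [kap * 2 ^+ i]. *)
Definition win (kap : R) i := Num.truncn (kap * scale i).

Lemma win_le kap i : 0 <= kap -> (win kap i)%:R <= kap * scale i.
Proof. by move=> k0; rewrite truncn_le mulr_ge0// ltW// scale_gt0. Qed.

Lemma win_gt kap i : kap * scale i - 1 < (win kap i)%:R.
Proof. by have := truncnS_gt (kap * scale i); rewrite -natr1 /win; lra. Qed.

Definition hazard_small := exists i0, forall i, (i0 <= i)%N -> hazard i <= 1 / 2.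

Lemma summable_hazard_small : summable_hazard -> hazard_small.
Proof.
move=> S.
have [N HN] : exists N, forall i, (N <= i)%N -> hazard i ^+ 2 <= 1 / 4.
  by apply: (bdd_series_small _ S) => [i|]; [exact: sqr_ge0|lra].
exists N => i /HN; rewrite expr2; have := hazard_ge0 i; nra.
Qed.

(** The scales eventually grow by a factor [4 / 3] at least, so that the
    mixing errors of the windows satisfy a contracting recursion; its
    increments come from disjoint blocks of the summable series of [th g /
    g.+1]. *)
Lemma bdd_mixing_window kap : 0 < kap -> hazard_small ->
  bdd_series (fun i => (\sum_(0 <= g < win kap i) th g) / (kap * scale i)).
Proof.
move=> k0 [i0 Hi0]; apply: (@bdd_series_shift _ _ i0).
have as0 i : 0 < kap * scale i by rewrite mulr_gt0// scale_gt0.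
have mono i j : (i <= j)%N -> (win kap i <= win kap j)%N.
  by move=> ij; apply: le_truncn; rewrite ler_wpM2l ?(ltW k0)// scale_le.
pose v i := \sum_(win kap i <= g < win kap i.+1) th g / g.+1%:R.
have v0 i : 0 <= v i by rewrite sumr_ge0// => g _; rewrite divr_ge0.
apply: (@bdd_series_recursion _ _ (fun i => v (i + i0)%N) (3 / 4)).
- lra.
- by move=> i; rewrite divr_ge0 ?(ltW (as0 _))// sumr_ge0.
- move=> i; rewrite addSn; set j := (i + i0)%N.
  have gr : kap * scale j <= 3 / 4 * (kap * scale j.+1).
    by have := scale_growth (Hi0 j (leq_addl _ _)); nra.
  rewrite ler_pdivrMr// (@big_cat_nat _ _ _ (win kap j) 0%N)//= ?mono//.
  rewrite mulrDl; apply: lerD.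
    set T := \sum_(0 <= g < _) th g.
    have T0 : 0 <= T / (kap * scale j).
      by rewrite divr_ge0 ?(ltW (as0 _))// sumr_ge0.
    have : T = T / (kap * scale j) * (kap * scale j) by rewrite divfK// gt_eqF.
    by move: gr T0; set t := T / _; move=> gr T0 ->; nra.
  rewrite /v mulr_suml; apply: ler_sum_nat => g /andP[_ gk].
  rewrite mulrAC ler_pdivlMr// ler_wpM2l//.
  by apply: le_trans (win_le _ (ltW k0)); rewrite ler_nat.
have [C HC] := pm_th_sum H; exists C => n.
rewrite -(sum_nat_shift v n i0).
apply: (@le_trans _ _ (\sum_(win kap i0 <= g < win kap (n + i0)) th g / g.+1%:R)).
  elim: n => [|n IH]; first by rewrite add0n !big_geq.
  rewrite addSn big_nat_recr ?leq_addl//=.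
  rewrite [leRHS](@big_cat_nat _ _ _ (win kap (n + i0)))/= ?mono ?leq_addl//.
  by rewrite lerD.
apply: le_trans (HC (win kap (n + i0))).
rewrite [leRHS](@big_cat_nat _ _ _ (win kap i0))/= ?mono ?leq_addl//.
by rewrite lerDr sumr_ge0// => g _; rewrite divr_ge0.
Qed.

End scales.

(** * Laws of the arrival times *)

Section trimmed_law.
Context {R : realType} {d : measure_display} {X : measurableType d}.
Variables (P : {measure set X -> \bar R}) (tau : X -> X) (phi : X -> nat).
Variable th : nat -> R.
Hypothesis H : psi_mixing P tau phi th.
Local Notation pr := (rprob P).
Local Notation crd := (proc tau phi).
Local Notation cyl := (cylinder tau phi).
Local Notation tail := (tail P phi).
Local Notation L := (trmean P phi).
Local Notation scale := (scale P phi).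
Local Notation hazard := (hazard P phi).
Local Notation win := (win P phi).
Let PT := pm_total H.
Let th0 := pm_th0 H.
Let p2 i := @pow2_gt0 R i.

(** For a return time [phi] and its induced map [tau], the time of the [k]-th
    return. *)
Definition arrival (k : nat) (x : X) : nat := \sum_(0 <= j < k) crd j x.

Lemma measurable_arrival (Q : set nat) k : measurable [set x | Q (arrival k x)].
Proof. exact: (measurable_cyl H (@cyl_sum _ _ tau phi id Q k)). Qed.

Section truncated.
Variables (kap eps : R) (w : nat -> nat) (mu : nat -> R).
Hypotheses (kap0 : 0 < kap) (eps0 : 0 < eps).
Hypothesis hs : hazard_small P phi.
Hypothesis wP : forall i, (w i <= 2 ^ i)%N.
Hypothesis mu0 : forall i, 0 <= mu i.
Hypothesis muP : forall i, L (2 ^ i)%N - L (w i) <= mu i * L (2 ^ i)%N.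
Hypothesis wS : bdd_series (fun i => (w i)%:R / 2 ^+ i : R).
Hypothesis muS : bdd_series (fun i => mu i ^+ 4).

Let dev i := [set x | eps * 2 ^+ i <=
  `|(\sum_(0 <= j < win kap i) trunc 0 (w i) (crd j x))%:R
      - (win kap i)%:R * L (w i)| ].

Lemma measurable_dev i : measurable (dev i).
Proof.
exact: (measurable_cyl H (@cyl_sum _ _ tau phi (trunc 0 (w i))
  (fun n => eps * 2 ^+ i <= `|n%:R - (win kap i)%:R * L (w i)|) (win kap i))).
Qed.

(** In Chebyshev's bound the diagonal becomes the summable [w i / 2 ^+ i],
    and the mixing error the series of [bdd_mixing_window]. *)
Lemma bdd_dev : bdd_series (fun i => pr (dev i)).
Proof.
pose T i : R := \sum_(0 <= g < win kap i) th g.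
apply: (@bdd_series_le _ _ (fun i => kap / eps ^+ 2 * ((w i)%:R / 2 ^+ i) +
   2 * kap ^+ 2 / eps ^+ 2 * (T i / (kap * scale i)))); last first.
  apply: bdd_seriesD; apply: bdd_seriesZ => //.
  - by rewrite divr_ge0 ?sqr_ge0// ltW.
  - by rewrite divr_ge0 ?sqr_ge0// mulr_ge0// sqr_ge0.
  - exact: (bdd_mixing_window H).
move=> i.
have ep : 0 < eps * 2 ^+ i by rewrite mulr_gt0.
apply: le_trans (pr_trunc_chebyshev H (w i) (win kap i) ep) _.
rewrite ler_pdivrMr ?exprn_gt0//.
have T0 : 0 <= T i by rewrite sumr_ge0.
have kl := win_le H i (ltW kap0); set k := (win kap i)%:R in kl *.
have k0 : 0 <= k by [].
have Lw : L (w i) <= L (2 ^ i)%N := trmean_le P phi (wP i).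
have Lw0 : 0 <= L (w i) by rewrite sumr_ge0// => s _; exact: tail_ge0.
have Ll := scale_mean H i.
set l := L (2 ^ i)%N in Ll Lw *.
have s0 := scale_gt0 H i; set a := scale i in s0 Ll kl *.
have -> : (kap / eps ^+ 2 * ((w i)%:R / 2 ^+ i) +
    2 * kap ^+ 2 / eps ^+ 2 * (T i / (kap * a))) * (eps * 2 ^+ i) ^+ 2 =
    kap * a * (w i)%:R * l + 2 * (kap * a) * l ^+ 2 * T i.
  rewrite -!Ll; have l0 : 0 < l := L2_gt0 H i.
  by field; rewrite !gt_eqF.
have e1 : k * (w i)%:R * L (w i) <= kap * a * (w i)%:R * l.
  by apply: ler_pM => //; [rewrite mulr_ge0|rewrite ler_wpM2r].
have e2 : k * L (w i) ^+ 2 <= kap * a * l ^+ 2.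
  apply: ler_pM => //; first exact: sqr_ge0.
  by apply: lerXn2r; rewrite ?nnegrE// (le_trans Lw0).
by rewrite -/(T i); nra.
Qed.

(** Rounding the length of the window costs one term out of [scale i],
    truncation the fraction [mu i] of the mean. *)
Lemma truncated_center : exists N, forall i, (N <= i)%N ->
  `|(win kap i)%:R * L (w i) - kap * 2 ^+ i| <= eps * 2 ^+ i.
Proof.
have [N1 HN1] := scale_large H (2 / eps).
have e0 : 0 < (eps / (2 * kap)) ^+ 4 by rewrite exprn_gt0// divr_gt0// mulr_gt0.
have [N2 HN2] : exists N, forall i, (N <= i)%N -> mu i ^+ 4 <= (eps / (2 * kap)) ^+ 4.
  by apply: (bdd_series_small _ muS) => // i; rewrite exprn_ge0.
exists (maxn N1 N2) => i; rewrite geq_max => /andP[/HN1 h1 /HN2].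
rewrite ler_pXn2r ?nnegrE ?divr_ge0 ?mulr_ge0 ?(ltW eps0) ?(ltW kap0)// => h2.
have {}h1 : 2 <= eps * scale i by rewrite mulrC -ler_pdivrMr.
have {}h2 : kap * mu i <= eps / 2.
  by move: h2; rewrite ler_pdivlMr ?mulr_gt0//; lra.
have kl := win_le H i (ltW kap0); have kg := win_gt P phi kap i.
set k := (win kap i)%:R in kl kg *.
have k0 : 0 <= k by [].
have Lw : L (w i) <= L (2 ^ i)%N := trmean_le P phi (wP i).
have Lw0 : 0 <= L (w i) by rewrite sumr_ge0// => s _; exact: tail_ge0.
have Lm := muP i; have m0 := mu0 i; have l0 := L2_gt0 H i.
have Ll := scale_mean H i.
set l := L (2 ^ i)%N in Ll Lw Lm l0 *.
have s0 := scale_gt0 H i; set a := scale i in s0 Ll kl kg h1 *.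
rewrite -Ll ler_norml.
have up : k * L (w i) <= kap * a * l by apply: ler_pM.
have ka : k * (mu i * l) <= kap * a * (mu i * l) by rewrite ler_wpM2r// mulr_ge0// ltW.
have dn : k * l - k * (mu i * l) <= k * L (w i).
  by rewrite -mulrBr ler_wpM2l//; lra.
have kl1 : (kap * a - 1) * l <= k * l by rewrite ler_wpM2r// ltW.
have m1 : kap * mu i * (a * l) <= eps / 2 * (a * l).
  by rewrite ler_wpM2r// ltW// mulr_gt0.
have m2 : 2 * l <= eps * a * l by rewrite ler_wpM2r// ltW.
have m3 : 0 <= eps * (a * l) by apply/ltW/mulr_gt0 => //; exact: mulr_gt0.
by apply/andP; split; nra.
Qed.

Let mid D i := [set x | (7 * 2 ^ (i - D) <
  \sum_(0 <= j < win kap i) trunc (w i) (2 ^ (i - D)) (crd j x))%N].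

Lemma measurable_mid D i : measurable (mid D i).
Proof.
exact: (measurable_cyl H (@cyl_sum _ _ tau phi (trunc (w i) (2 ^ (i - D)))
  (fun n => (7 * 2 ^ (i - D) < n)%N) (win kap i))).
Qed.

(** Markov's inequality bounds the probability of passing [b] by a multiple
    of [mu i]; two rounds of [pr_sum_doubling], from [b] to [3 * b] to [7 *
    b], raise this bound to its fourth power. *)
Lemma bdd_mid D : bdd_series (fun i => pr (mid D i)).
Proof.
set C := 1 + th 0%N; have C0 : 0 <= C by rewrite addr_ge0.
have K0 : 0 <= C ^+ 3 * (kap * 2 ^+ D) ^+ 4.
  by rewrite mulr_ge0 ?exprn_ge0// mulr_ge0 ?exprn_ge0// ltW.
apply: (bdd_series_le_from (i0 := D) K0 _ _ muS).
  by move=> i; rewrite exprn_ge0.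
move=> i Di; set b := (2 ^ (i - D))%N; set k := win kap i.
case: (leqP (w i) b) => wb; last first.
  have -> : mid D i = set0.
    apply/seteqP; split=> // x; rewrite /mid/=.
    by rewrite big1// => j _; rewrite /trunc big_geq// ltnW.
  by rewrite pr0 mulr_ge0 ?exprn_ge0.
have fb n : (trunc (w i) b n <= b)%N.
  by rewrite truncE//; lia.
pose q y := pr [set x | (y < \sum_(0 <= j < k) trunc (w i) b (crd j x))%N].
have q0 y : 0 <= q y by exact: pr_ge0.
have s1 : q b <= kap * 2 ^+ D * mu i.
  apply: (@le_trans _ _ (pr [set x | b%:R <=
       (\sum_(0 <= j < k) trunc (w i) b (crd j x))%:R :> R])).
    apply: (pr_le PT).
    - exact: (measurable_cyl H (@cyl_sum _ _ tau phi (trunc (w i) b) (fun n => (b < n)%N) k)).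
    - exact: (measurable_cyl H (@cyl_sum _ _ tau phi (trunc (w i) b)
        (fun n => b%:R <= n%:R :> R) k)).
    - by move=> x /= h; rewrite ler_nat ltnW.
  have b0 : 0 < b%:R :> R by rewrite ltr0n expn_gt0.
  apply: le_trans (pr_trunc_markov H k wb b0) _.
  rewrite ler_pdivrMr//.
  have kl := win_le H i (ltW kap0).
  have Ll := scale_mean H i.
  have bE : 2 ^+ D * b%:R = 2 ^+ i :> R.
    by rewrite /b natrX -exprD subnKC.
  have Lb : L b <= L (2 ^ i)%N by apply: trmean_le; rewrite leq_exp2l// leq_subr.
  have := muP i; have := mu0 i.
  rewrite (_ : kap * 2 ^+ D * mu i * b%:R = kap * mu i * 2 ^+ i); last by rewrite -bE; ring.
  rewrite -Ll -/k in kl *.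
  set l := L (2 ^ i)%N in Lb *; set a := scale i in kl * => m0 Lm.
  rewrite (_ : kap * mu i * (a * l) = kap * a * (mu i * l)); last by ring.
  by apply: ler_pM => //; [rewrite subr_ge0 trmean_le|lra].
have s3 : q (b + b + b)%N <= C * q b ^+ 2 by exact: (pr_sum_doubling H b k fb).
have s7 : q ((b + b + b) + (b + b + b) + b)%N <= C * q (b + b + b)%N ^+ 2.
  exact: (pr_sum_doubling H (b + b + b) k fb).
have -> : pr (mid D i) = q ((b + b + b) + (b + b + b) + b)%N.
  by rewrite /q /mid -/b; congr pr; apply/funext => x; congr (is_true (_ < _)%N); lia.
apply: (le_trans s7).
rewrite -mulrA -exprMn.
set m := kap * 2 ^+ D * mu i in s1 *.
apply: (@le_trans _ _ (C * (C * m ^+ 2) ^+ 2)); last first.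
  by rewrite exprMn -!exprM mulrA -exprS lexx.
rewrite ler_wpM2l//; apply: lerXn2r; rewrite ?nnegrE//.
  by rewrite mulr_ge0// sqr_ge0.
apply: (le_trans s3); rewrite ler_wpM2l//; apply: lerXn2r; rewrite ?nnegrE//.
exact: le_trans s1.
Qed.

End truncated.

Hypothesis S : summable_hazard P phi.
Let hs := summable_hazard_small H S.

Section bounds.
Variables (kap eps : R).
Hypotheses (kap0 : 0 < kap) (eps0 : 0 < eps).
Let k := win kap.

Definition early i := [set x | (arrival (k i) x)%:R < (kap - eps) * 2 ^+ i].

(** Truncation only lowers a sum, so that an early arrival forces the
    truncated sum to deviate from its mean. *)
Theorem bdd_early : bdd_series (fun i => pr (early i)).
Proof.
have [w [mu [wP mu0 muP wS muS]]] := truncation_levels H S.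
have e2 : 0 < eps / 2 by rewrite divr_gt0.
have [N HN] := truncated_center kap0 e2 wP mu0 muP muS.
have B := bdd_dev kap0 e2 hs wP wS.
apply: (bdd_series_le_from (i0 := N) ler01 _ _ B) => [i|i Ni]; first exact: pr_ge0.
rewrite mul1r; apply: (pr_le PT) => [||x].
- exact: (measurable_arrival (fun n => n%:R < (kap - eps) * 2 ^+ i)).
- exact: measurable_dev.
rewrite /early/= -/(k i) => h.
have le : (\sum_(0 <= j < k i) trunc 0 (w i) (crd j x))%:R <= (arrival (k i) x)%:R :> R.
  rewrite ler_nat; apply: leq_sum => j _; rewrite truncE//; lia.
have := HN i Ni; rewrite -/(k i) ler_norml => /andP[h1 h2].
by rewrite ler_normr; apply/orP; right; lra.
Qed.

Definition late i := [set x | (kap + eps) * 2 ^+ i < (arrival (k i) x)%:R].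

Lemma cyl_late i : cyl (k i) (late i).
Proof. exact: (@cyl_sum _ _ tau phi id (fun n => (kap + eps) * 2 ^+ i < n%:R) (k i)). Qed.

(** The truncated sum and the middle slab exceed their shares with summable
    probabilities only; otherwise, a late sum has a term above the slab. *)
Lemma late_decomposition : exists D (U : nat -> set X),
  [/\ forall i, measurable (U i), bdd_series (fun i => pr (U i)) &
    exists N, forall i, (N <= i)%N -> late i `<=`
      U i `|` [set x | exists2 j, (j < k i)%N & (2 ^ (i - D) < crd j x)%N] ].
Proof.
have [w [mu [wP mu0 muP wS muS]]] := truncation_levels H S.
have e2 : 0 < eps / 4 by rewrite divr_gt0.
have [N HN] := truncated_center kap0 e2 wP mu0 muP muS.
have B := bdd_dev kap0 e2 hs wP wS.
(* the middle slab, at most [7 * 2 ^+ (i - D)], uses up half of the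
   deviation; the other half is shared by [dev] and the centering *)
have [D HD] : exists D, 14 / eps <= 2 ^+ D :> R.
  exists (Num.truncn (14 / eps)).+1; apply: le_trans (ltW (truncnS_gt _)) _.
  by rewrite -natrX ler_nat ltnW// ltn_expl.
have B' := bdd_mid kap0 e2 mu0 muP muS D.
eexists D, (fun i => _ `|` _); split; first 1 last.
- apply: bdd_series_le (bdd_seriesD B B') => i.
  apply: (pr_leU PT); [|exact: measurable_dev|exact: measurable_mid|exact: subset_refl].
  by apply: measurableU; [exact: measurable_dev|exact: measurable_mid].
- exists (maxn N D) => i; rewrite geq_max => /andP[Ni Di] x lt.
  have {}lt : (kap + eps) * 2 ^+ i < (arrival (k i) x)%:R := lt.
  rewrite /=.
  case: (pselect (exists2 j, (j < k i)%N & (2 ^ (i - D) < crd j x)%N)) => [|no].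
    by right.
  left; apply: contrapT => /not_orP[]; rewrite /= -/(k i) => /negP + /negP.
  rewrite -ltNge -leqNgt => h1 h2.
  have := HN i Ni; rewrite -/(k i) => h3.
  have le : (arrival (k i) x <= \sum_(0 <= j < k i) trunc 0 (w i) (crd j x) +
      \sum_(0 <= j < k i) trunc (w i) (2 ^ (i - D)) (crd j x))%N.
    rewrite -big_split/= /arrival big_seq [leqRHS]big_seq.
    apply: leq_sum => j; rewrite mem_index_iota => /andP[_ jk].
    have nj : (crd j x <= 2 ^ (i - D))%N.
      by rewrite leqNgt; apply/negP => h; apply: no; exists j.
    case: (leqP (w i) (2 ^ (i - D))) => wd; first by rewrite !truncE//; lia.
    by rewrite truncE// (leq_trans _ (leq_addr _ _))//; lia.
  move: le; rewrite -(ler_nat R) natrD => le.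
  have h2' : (\sum_(0 <= j < k i) trunc (w i) (2 ^ (i - D)) (crd j x))%:R <=
      7 * 2 ^+ (i - D) :> R.
    by rewrite -natrX -natrM ler_nat.
  have pE : 2 ^+ D * 2 ^+ (i - D) = 2 ^+ i :> R by rewrite -exprD subnKC.
  have h4 : 14 * 2 ^+ (i - D) <= eps * 2 ^+ i.
    rewrite -pE mulrA ler_wpM2r ?(ltW (p2 _))//.
    by rewrite mulrC -ler_pdivrMr.
  move: h1 h3; rewrite ltr_norml ler_norml => /andP[_ h1] /andP[_ h3].
  lra.
- by move=> i; apply: measurableU; [exact: measurable_dev|exact: measurable_mid].
Qed.

Lemma pr_exists_scale D i : (D <= i)%N ->
  pr [set x | exists2 j, (j < k i)%N & (2 ^ (i - D) < crd j x)%N] <=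
    kap * 2 ^+ D * hazard (i - D)%N.
Proof.
move=> Di; apply: le_trans (pr_exists_le H _ _) _.
have kl := win_le H i (ltW kap0); rewrite -/(k i) in kl.
have t0 := tail_ge0 P phi (2 ^ (i - D)).
have pE : 2 ^+ D * 2 ^+ (i - D) = 2 ^+ i :> R by rewrite -exprD subnKC.
apply: (@le_trans _ _ (kap * scale i * tail (2 ^ (i - D)))).
  by rewrite ler_wpM2r.
rewrite -[leLHS]mulrA -[leRHS]mulrA ler_wpM2l ?(ltW kap0)//.
rewrite -(ler_pM2r (L2_gt0 H i)) [leLHS]mulrAC (scale_mean H) -pE -[leLHS]mulrA -[leRHS]mulrA.
rewrite ler_wpM2l ?(ltW (p2 _))//; apply: le_trans (tail2_le H _) _.
by rewrite ler_wpM2l ?(hazard_ge0 H)// L2_le// leq_subr.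
Qed.

(** A late window contains an exceptional term, and the hazards tend to zero. *)
Theorem late_vanish e : 0 < e ->
  exists N, forall i, (N <= i)%N -> pr (late i) <= e.
Proof.
move=> e0; have [D [U [mU SU [N HN]]]] := late_decomposition.
have e1 : 0 < e / 2 by lra.
have [N1 HN1] := bdd_series_small (fun i => pr_ge0 P (U i)) SU e1.
have K0 : 0 < kap * 2 ^+ D by rewrite mulr_gt0.
have e3 : 0 < (e / 2 / (kap * 2 ^+ D)) ^+ 2 by rewrite exprn_gt0// divr_gt0.
have [N2 HN2] := bdd_series_small (fun i => sqr_ge0 (hazard i)) S e3.
exists (maxn (maxn N D) (maxn N1 (N2 + D))) => i.
rewrite !geq_max => /andP[/andP[Ni Di] /andP[N1i N2i]].
apply: le_trans (pr_leU PT _ (mU i) _ (HN i Ni)) _.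
- exact: (measurable_cyl H (@cyl_late i)).
- exact: (measurable_cyl H (@cyl_exists _ _ tau phi _ _)).
have h1 := HN1 i N1i; have := HN2 (i - D)%N.
rewrite leq_subRL// addnC => /(_ N2i).
rewrite ler_pXn2r ?nnegrE ?(hazard_ge0 H)//; last by rewrite divr_ge0 ?ltW.
rewrite ler_pdivlMr// mulrC => h2.
have := pr_exists_scale Di; lra.
Qed.

(** Two sums over adjacent windows are seldom both late, since that takes two
    exceptional terms. *)
Theorem bdd_late_twice :
  bdd_series (fun i => pr (late i `&` iter (k i) tau @^-1` late i)).
Proof.
have [D [U [mU SU [N HN]]]] := late_decomposition.
pose C := (1 + th 0%N) * (kap * 2 ^+ D) ^+ 2.
have C0 : 0 <= C by rewrite mulr_ge0 ?sqr_ge0// addr_ge0.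
apply: (@bdd_series_shift _ _ (maxn N D)).
pose v i := hazard i ^+ 2.
have SU' := bdd_series_tail (maxn N D) (fun i => pr_ge0 P (U i)) SU.
have Sv := bdd_series_tail (maxn N D - D) (fun i => sqr_ge0 (hazard i)) S.
have two : (0 : R) <= 2 by [].
apply: bdd_series_le (bdd_seriesD (bdd_seriesZ two SU') (bdd_seriesZ C0 Sv)) => i0.
rewrite addnBA ?leq_maxr//; set i := (i0 + maxn N D)%N.
have Ni : (N <= i)%N by rewrite (leq_trans (leq_maxl N D))// leq_addl.
have Di : (D <= i)%N by rewrite (leq_trans (leq_maxr N D))// leq_addl.
set M := [set x | exists2 j, (j < k i)%N & (2 ^ (i - D) < crd j x)%N].
have cM : cyl (k i) M := @cyl_exists _ _ tau phi _ _.
have mM := measurable_cyl H cM; have mL := measurable_cyl H (@cyl_late i).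
have mp A : measurable A -> measurable (iter (k i) tau @^-1` A).
  exact: (measurable_preim H).
have sub := HN i Ni.
apply: (@le_trans _ _ (pr (U i `|` iter (k i) tau @^-1` U i) +
    pr (M `&` iter (k i) tau @^-1` M))).
  apply: (pr_leU PT).
  - by apply: measurableI => //; exact: mp.
  - by apply: measurableU => //; exact: mp.
  - by apply: measurableI => //; exact: mp.
  - move=> x [/sub[Ux|Mx] /sub[Ux'|Mx']]; [by left; left|by left; left|by left; right|by right].
apply: lerD.
  rewrite mulr_natl mulr2n -{2}(pr_preim H (k i) (mU i)).
  by apply: (pr_leU PT) => //; [apply: measurableU => //; exact: mp|exact: mp].
have := mix_le H 0 cM cM; rewrite addn0 => /le_trans; apply.
rewrite -expr2 /C /v -mulrA -exprMn ler_wpM2l ?addr_ge0//.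
have K0 := mulr_ge0 (mulr_ge0 (ltW kap0) (ltW (p2 D))) (hazard_ge0 H (i - D)).
by apply: lerXn2r; rewrite ?nnegrE ?pr_ge0//; exact: pr_exists_scale.
Qed.

End bounds.
End trimmed_law.

(** * Bursts of long returns *)

Lemma geometric_sum_le {R : realType} (q : R) m l : 0 <= q < 1 ->
  \sum_(m <= i < l.+1) q ^+ (l - i) <= (1 - q)^-1.
Proof.
move=> /andP[q0 q1].
suff h n : (1 - q) * \sum_(m <= i < n) q ^+ (n.-1 - i) <= 1.
  by rewrite -[leRHS]mul1r ler_pdivlMr ?subr_gt0// mulrC; exact: h.
elim: n => [|n IH]; first by rewrite big_geq// mulr0.
case: (leqP m n) => mn; last by rewrite big_geq// mulr0.
rewrite big_nat_recr//= subnn expr0.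
have E : \sum_(m <= i < n) q ^+ (n - i) = q * \sum_(m <= i < n) q ^+ (n.-1 - i).
  rewrite mulr_sumr; apply: eq_big_nat => i /andP[_ ik].
  by rewrite -exprS; congr (_ ^+ _); lia.
rewrite E; set S := \sum_(m <= i < n) _ in IH *.
have : 0 <= S by rewrite sumr_ge0// => i _; rewrite exprn_ge0.
nra.
Qed.

Section kochen_stone.
Context {R : realType} {d : measure_display} {X : measurableType d}.
Variable P : {measure set X -> \bar R}.
Hypothesis PT : P setT = 1%E.
Local Notation pr := (rprob P).

(** The second moment method on a block of indices where [e] adds up to more
    than one: the correlations [q ^+ (l - i) * e l] then add up to a multiple
    of the squared sum at most. *)
Lemma kochen_stone (E : nat -> set X) (e : nat -> R) (c C q : R) i0 :
  0 < c -> 0 < C -> 0 <= q < 1 -> (forall i, measurable (E i)) ->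
  (forall i, 0 <= e i) ->
  (forall i, (i0 <= i)%N -> c * e i <= pr (E i)) ->
  (forall i, (i0 <= i)%N -> pr (E i) <= C * e i) ->
  (forall i l, (i0 <= i < l)%N ->
    pr (E i `&` E l) <= C * (e i * e l + q ^+ (l - i) * e l)) ->
  ~ bdd_series e ->
  exists2 del, 0 < del &
    forall m, del <= pr (\bigcup_(i in [set i | (m <= i)%N]) E i).
Proof.
move=> c0 C0 q01 mE e0 lo up pair nS; have /andP[q0 q1] := q01.
have q2 : 0 < (1 - q)^-1 by rewrite invr_gt0 subr_gt0.
pose C2 := C * (1 + 2 * (1 - q)^-1).
have C20 : 0 < C2 by rewrite mulr_gt0//; lra.
exists (c ^+ 2 / C2); first by rewrite divr_gt0// exprn_gt0.
move=> m; pose m' := maxn m i0.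
have [n mn] := bdd_series_tail_unbounded m' 1 nS.
set s := \sum_(m' <= i < n) e i => s1.
have mU : measurable (\bigcup_(i in [set i | (m <= i)%N]) E i).
  by apply: bigcup_measurable.
have := @pr_second_moment _ _ _ P PT _ (index_iota m' n) E _ (c / (C2 * s))
  (fun i _ => mE i) mU.
move=> PZ; apply: le_trans (PZ _); last first.
  move=> i; rewrite mem_index_iota => /andP[mi _] x Ex; exists i => //=.
  by apply: leq_trans mi; exact: leq_maxl.
have ge0 i l : (m' <= i)%N -> (m' <= l)%N -> pr (E i `&` E l) <=
   C * (e i * e l + ((i <= l)%N%:R * q ^+ (l - i) * e l +
                     (l <= i)%N%:R * q ^+ (i - l) * e i)).
  have h0 u v : 0 <= (u <= v)%N%:R * q ^+ (v - u) * e v.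
    by rewrite mulr_ge0// mulr_ge0// exprn_ge0.
  rewrite !geq_max => /andP[_ ii] /andP[_ il].
  case: (ltngtP i l) => [lt|lt|<-].
  - rewrite mul1r !mul0r addr0; apply: pair; by rewrite ii.
  - rewrite mul1r !mul0r add0r setIC [e i * _]mulrC; apply: pair; by rewrite il.
  - rewrite setIid subnn expr0 !mul1r; apply: le_trans (up i ii) _.
    by rewrite ler_wpM2l ?(ltW C0)//; have := e0 i; nra.
have B : \sum_(m' <= i < n) \sum_(m' <= l < n) pr (E i `&` E l) <= C2 * s ^+ 2.
  apply: (@le_trans _ _ (\sum_(m' <= i < n) \sum_(m' <= l < n)
     C * (e i * e l + ((i <= l)%N%:R * q ^+ (l - i) * e l +
                     (l <= i)%N%:R * q ^+ (i - l) * e i)))).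
    apply: ler_sum_nat => i /andP[mi _]; apply: ler_sum_nat => l /andP[ml _].
    exact: ge0.
  have G : \sum_(m' <= i < n) \sum_(m' <= l < n) (l <= i)%N%:R * q ^+ (i - l) * e i
      <= (1 - q)^-1 * s.
    rewrite /s mulr_sumr; apply: ler_sum_nat => i /andP[mi iN].
    rewrite -mulr_suml ler_wpM2r//.
    apply: le_trans (geometric_sum_le m' i q01).
    rewrite (@big_cat_nat _ _ _ i.+1)//= ?(leq_trans mi)//.
    rewrite [X in _ + X]big_nat_cond [X in _ + X]big1 ?addr0; last first.
      by move=> l /andP[/andP[il _] _]; rewrite leqNgt il mul0r.
    by apply: ler_sum_nat => l /andP[_ li]; rewrite -ltnS li mul1r.
  have G' : \sum_(m' <= i < n) \sum_(m' <= l < n) (i <= l)%N%:R * q ^+ (l - i) * e l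
      <= (1 - q)^-1 * s by rewrite exchange_big.
  under eq_bigr do rewrite -mulr_sumr big_split/= big_split/=.
  rewrite -mulr_sumr !big_split/=.
  have -> : \sum_(m' <= i < n) \sum_(m' <= l < n) e i * e l = s ^+ 2.
    by rewrite expr2 /s mulr_suml; apply: eq_bigr => i _; rewrite mulr_sumr.
  rewrite /C2 -mulrA ler_wpM2l ?(ltW C0)//.
  have s2 : (1 - q)^-1 * s <= (1 - q)^-1 * s ^+ 2.
    by rewrite ler_wpM2l ?(ltW q2)// expr2 ler_peMl; lra.
  lra.
have A : c * s <= \sum_(m' <= i < n) pr (E i).
  rewrite mulr_sumr; apply: ler_sum_nat => i /andP[mi _]; apply: lo.
  by apply: leq_trans mi; exact: leq_maxr.
have s0 : 0 < s by lra.
set l := c / (C2 * s).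
have l0 : 0 < l by rewrite divr_gt0// mulr_gt0.
have lE : l * (C2 * s) = c by rewrite divfK// gt_eqF// mulr_gt0.
have -> : c ^+ 2 / C2 = l * (c * s).
  by rewrite /l; field; rewrite !gt_eqF.
have h1 : l * (c * s) <= l * \sum_(m' <= i < n) pr (E i) by rewrite ler_wpM2l ?(ltW l0).
have h2 : l ^+ 2 * \sum_(m' <= i < n) \sum_(m' <= j < n) pr (E i `&` E j) <= l * (c * s).
  rewrite expr2 -mulrA ler_wpM2l ?(ltW l0)//.
  apply: (@le_trans _ _ (l * (C2 * s ^+ 2))); first by rewrite ler_wpM2l ?(ltW l0).
  have -> : l * (C2 * s ^+ 2) = l * (C2 * s) * s by ring.
  by rewrite lE.
lra.
Qed.

End kochen_stone.

Section bursts.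
Context {R : realType} {d : measure_display} {X : measurableType d}.
Variables (P : {measure set X -> \bar R}) (tau : X -> X) (phi : X -> nat).
Variable th : nat -> R.
Hypothesis H : psi_mixing P tau phi th.
Local Notation pr := (rprob P).
Local Notation crd := (proc tau phi).
Local Notation cyl := (cylinder tau phi).
Local Notation tail := (tail P phi).
Local Notation scale := (scale P phi).
Local Notation hazard := (hazard P phi).
Local Notation win := (win P phi).
Let PT := pm_total H.
Let th0 := pm_th0 H.
Let C1 := 1 + th 0%N.
Let C1_ge1 : 1 <= C1. Proof. by rewrite lerDl. Qed.

Definition hit s a k :=
  [set x | exists2 j, (a <= j < a + k)%N & (s < crd j x)%N].

Lemma cyl_hit s a k : cyl (a + k) (hit s a k).
Proof. by move=> x y e /= [j jk sj]; exists j => //; rewrite -e//; case/andP: jk. Qed.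

Let measurable_hit s a k : measurable (hit s a k).
Proof. exact: (measurable_cyl H (@cyl_hit s a k)). Qed.

Lemma hit_preim s a k n x : hit s a k (iter n tau x) <-> hit s (a + n) k x.
Proof.
split=> -[j jk sj].
  by exists (j + n)%N; [lia|rewrite -crdD].
by exists (j - n)%N; [lia|rewrite crdD subnK//; lia].
Qed.

(** A union bound over pairs of positions; at a common position the second
    event alone is counted. *)
Lemma pr_hit_pair s t a b k l :
  pr (hit s a k `&` hit t b l) <=
    k%:R * l%:R * (C1 * (tail s * tail t)) + k%:R * tail t.
Proof.
apply: (@le_trans _ _ (\sum_(ji <- [seq (j, i) | j <- index_iota a (a + k),
     i <- index_iota b (b + l)]) pr ([set x | (s < crd ji.1 x)%N] `&`
                                   [set x | (t < crd ji.2 x)%N]))).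
  apply: (pr_le_sum PT).
  - by move=> [j i] _; apply: measurableI; exact: (measurable_gt H).
  - exact: measurableI.
  - move=> x [[j jk sj] [i il ti]]; exists (j, i) => //.
    by apply: allpairs_f; rewrite mem_index_iota.
rewrite big_allpairs_dep/=.
have t0 u : 0 <= tail u by exact: tail_ge0.
apply: (@le_trans _ _ (\sum_(a <= j < a + k) \sum_(b <= i < b + l)
   (C1 * (tail s * tail t) + (j == i)%:R * tail t))).
  apply: ler_sum => j _; apply: ler_sum => i _.
  have [<-|ji] := eqVneq j i; last by rewrite mul0r addr0 (pr_gt_pair_neq H).
  rewrite mul1r setIC; apply: le_trans (pr_gt_pair_eq H j t s) _.
  by rewrite lerDr mulr_ge0// ?mulr_ge0//; exact: le_trans C1_ge1.
under eq_bigr do rewrite big_split/= sumr_const_nat addKn.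
rewrite big_split/= sumr_const_nat addKn.
apply: lerD; first by rewrite -mulrnA mulnC -natrM mulr_natl.
apply: (@le_trans _ _ (\sum_(a <= j < a + k) tail t)); last first.
  by rewrite sumr_const_nat addKn mulr_natl.
apply: ler_sum => j _; rewrite -mulr_suml ler_piMl//.
case: (boolP (j \in index_iota b (b + l))) => jb.
  rewrite (bigD1_seq j) ?iota_uniq//= eqxx big1 ?addr0// => i /negbTE.
  by rewrite eq_sym => ->.
rewrite big_seq big1// => i ib; case: eqP => // ji.
by move: jb; rewrite ji ib.
Qed.

Lemma pr_hit_le s a k : pr (hit s a k) <= k%:R * tail s.
Proof.
have -> : hit s a k = iter a tau @^-1` hit s 0 k.
  have e x := hit_preim s 0 k a x; rewrite add0n in e.
  by apply/seteqP; split=> x /e.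
rewrite (pr_preim H)//; have := pr_exists_le H s k; rewrite /hit.
by under eq_set do rewrite /=.
Qed.

(** The second moment method, with the weight that balances the two moments. *)
Lemma pr_hit_ge s k : k%:R * tail s <= (1 + C1 * (k%:R * tail s)) * pr (hit s 0 k).
Proof.
set x := k%:R * tail s.
have x0 : 0 <= x by rewrite mulr_ge0// tail_ge0.
have D0 : 0 < 1 + C1 * x by rewrite ltr_pwDl// mulr_ge0// (le_trans _ C1_ge1).
have := @pr_second_moment _ _ _ P PT _ (index_iota 0 k)
  (fun j => [set y | (s < crd j y)%N]) (hit s 0 k) (1 + C1 * x)^-1
  (fun j _ => measurable_gt H j s) (measurable_hit _ _ _).
move=> K.
have sumE : \sum_(i <- index_iota 0 k) pr [set y | (s < crd i y)%N] = x.
  by under eq_bigr do rewrite (pr_gt H); rewrite sumr_const_nat subn0 -mulr_natl.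
have sqE : \sum_(i <- index_iota 0 k) \sum_(j <- index_iota 0 k)
    pr ([set y | (s < crd i y)%N] `&` [set y | (s < crd j y)%N]) <= x * (1 + C1 * x).
  have := @double_sum_le _ (fun j i => pr ([set y | (s < crd j y)%N] `&` [set y | (s < crd i y)%N]))
    (fun _ => 0) (tail s) (C1 * (tail s * tail s)) k.
  move=> DS; apply: (le_trans (DS _ _ _ _ _)).
  - by rewrite !mulr_ge0// ?tail_ge0// (le_trans _ C1_ge1).
  - by [].
  - by move=> j; exact: (pr_gt_pair_eq H).
  - by move=> j i ji; rewrite addr0 mul1r (pr_gt_pair_neq H)// neq_ltn ji.
  - by move=> j i ji; rewrite addr0 mul1r (pr_gt_pair_neq H)// neq_ltn ji orbT.
  by rewrite big1// mulr0 addr0 /x expr2; clear DS K; lra.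
rewrite sumE in K; rewrite -ler_pdivrMl//.
apply: le_trans (K _); last first.
  by move=> j; rewrite mem_index_iota => jk y /= sj; exists j.
set l := (1 + C1 * x)^-1 in K *.
have l0 : 0 < l by rewrite invr_gt0.
have lx : l ^+ 2 * (x * (1 + C1 * x)) = l * x.
  by rewrite expr2 [x * _]mulrC mulrA -(mulrA l) mulVf ?mulr1// gt_eqF.
have := ler_wpM2l (sqr_ge0 l) sqE; rewrite lx; lra.
Qed.

Let s_ i := (2 ^ i).-1.

Let scale_tail i : scale i * tail (s_ i) = hazard i.
Proof. by rewrite /hazard /scale /s_ mulrAC. Qed.

Lemma win_tail_le c i : 0 <= c -> (win c i)%:R * tail (s_ i) <= c * hazard i.
Proof.
move=> c0; rewrite -scale_tail mulrA ler_wpM2r ?tail_ge0//.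
exact: (win_le H).
Qed.

Lemma win_tail_ge c : 0 < c ->
  exists N, forall i, (N <= i)%N ->
    c / 2 * hazard i <= (win c i)%:R * tail (s_ i).
Proof.
move=> c0; have [N HN] := scale_large H (2 / c).
exists N => i /HN; rewrite ler_pdivrMr// => h.
rewrite -scale_tail mulrA ler_wpM2r ?tail_ge0//.
by have := win_gt P phi c i; move: h; set a := scale i; set k := (_)%:R; lra.
Qed.

Lemma scale_ratio i0 i l : (forall i, (i0 <= i)%N -> hazard i <= 1 / 2) ->
  (i0 <= i <= l)%N -> scale i <= (3 / 4) ^+ (l - i) * scale l.
Proof.
move=> hs /andP[i0i il]; rewrite -(subnK il) addnK; elim: (l - i)%N => [|n IH].
  by rewrite expr0 mul1r.
apply: (le_trans IH); rewrite exprSr -mulrA addSn ler_wpM2l ?exprn_ge0 ?divr_ge0//.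
by apply: (scale_growth H); apply: hs; rewrite (leq_trans i0i)// leq_addl.
Qed.

Lemma pr_hit_win_le c i a : 0 <= c ->
  pr (hit (s_ i) a (win c i)) <= c * hazard i.
Proof. by move=> c0; apply: le_trans (pr_hit_le _ _ _) (win_tail_le i c0). Qed.

Lemma pr_hit_win_ge c : 0 < c -> exists2 c', 0 < c' &
  exists N, forall i, (N <= i)%N -> c' * hazard i <= pr (hit (s_ i) 0 (win c i)).
Proof.
move=> c0; have [N HN] := win_tail_ge c0.
have C10 : 0 < C1 by exact: lt_le_trans C1_ge1.
have D0 : 0 < 1 + C1 * c by rewrite ltr_pwDl// mulr_ge0// ltW.
exists (c / 2 / (1 + C1 * c)); first by rewrite !divr_gt0.
exists N => i /HN h; have := pr_hit_ge (s_ i) (win c i).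
have := win_tail_le i (ltW c0); set x := (_)%:R * _ in h *; set p := pr _.
have p0 : 0 <= p by exact: pr_ge0.
move=> xc xp; have h1 := hazard_le1 H i.
rewrite mulrAC ler_pdivrMr//; apply: (le_trans h); apply: (le_trans xp).
rewrite mulrC ler_wpM2l// lerD2l ler_wpM2l ?(ltW C10)//.
by apply: (le_trans xc); rewrite ler_piMr// ltW.
Qed.

Lemma pr_hit_win_pair c i0 i l a b : 0 <= c ->
  (forall i, (i0 <= i)%N -> hazard i <= 1 / 2) -> (i0 <= i <= l)%N ->
  pr (hit (s_ i) a (win c i) `&` hit (s_ l) b (win c l)) <=
    C1 * c ^+ 2 * (hazard i * hazard l) + c * ((3 / 4) ^+ (l - i) * hazard l).
Proof.
move=> c0 hs il; apply: le_trans (pr_hit_pair _ _ _ _ _ _) _.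
have C10 : 0 <= C1 by exact: le_trans C1_ge1.
have t0 u : 0 <= tail u by exact: tail_ge0.
apply: lerD.
  have := win_tail_le i c0; have := win_tail_le l c0.
  set k := (win c i)%:R; set k' := (win c l)%:R => e1 e2.
  have -> : k * k' * (C1 * (tail (s_ i) * tail (s_ l))) =
    C1 * ((k * tail (s_ i)) * (k' * tail (s_ l))) by ring.
  have -> : C1 * c ^+ 2 * (hazard i * hazard l) =
    C1 * ((c * hazard i) * (c * hazard l)) by ring.
  by rewrite ler_wpM2l//; apply: ler_pM; rewrite ?mulr_ge0.
rewrite -(scale_tail l).
have -> : c * ((3 / 4) ^+ (l - i) * (scale l * tail (s_ l))) =
  c * ((3 / 4) ^+ (l - i) * scale l) * tail (s_ l) by ring.
rewrite ler_wpM2r//; apply: (le_trans (win_le H i c0)).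
by rewrite ler_wpM2l//; exact: scale_ratio il.
Qed.

(** The hazards are the orders of magnitude of the probabilities of these
    events, and the correlation of two scales decays with their ratio. *)
Theorem forward_bursts c : 0 < c -> hazard_small P phi -> ~ bdd_series hazard ->
  exists2 del, 0 < del & forall m,
    del <= pr (\bigcup_(i in [set i | (m <= i)%N]) hit (s_ i) 0 (win c i)).
Proof.
move=> c0 [i0 hs] nS; have [c' c'0 [N HN]] := pr_hit_win_ge c0.
have C10 : 0 < C1 by exact: lt_le_trans C1_ge1.
have C0 : 0 < C1 * c ^+ 2 + c by rewrite ltr_wpDl// mulr_ge0 ?sqr_ge0// ltW.
apply: (@kochen_stone _ _ _ P PT _ hazard c' _ (3 / 4) (maxn N i0) c'0 C0) => //.
- by apply/andP; split; lra.
- by move=> i; exact: (hazard_ge0 H).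
- by move=> i; rewrite geq_max => /andP[/HN].
- move=> i _; apply: le_trans (pr_hit_win_le _ _ (ltW c0)) _.
  rewrite ler_wpM2r ?(hazard_ge0 H)// lerDr mulr_ge0 ?sqr_ge0// ltW//.
move=> i l /andP[]; rewrite geq_max => /andP[_ ii] il.
apply: le_trans (pr_hit_win_pair _ _ (ltW c0) hs _) _; first by rewrite ii ltnW.
have h1 : 0 <= hazard i * hazard l by rewrite mulr_ge0 ?(hazard_ge0 H).
have h2 : 0 <= (3 / 4) ^+ (l - i) * hazard l.
  by rewrite mulr_ge0 ?(hazard_ge0 H)// exprn_ge0// divr_ge0.
have h3 : 0 <= C1 * c ^+ 2 by rewrite mulr_ge0 ?sqr_ge0// ltW.
rewrite mulrDr; apply: lerD; rewrite ler_wpM2r//; lra.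
Qed.

Section two_sided.
(** [bk] is the process read backwards in time: after a shift by [K], its
    first [K] coordinates are the first [K] forward ones in reverse order, on
    a set [G] of full probability. *)
Variables (bk : nat -> X -> nat) (G : set X).
Hypothesis mbk : forall j (Q : set nat), measurable [set x | Q (bk j x)].
Hypotheses (mG : measurable G) (PG : P G = 1%E).
Hypothesis bkP : forall x j K, G x -> (j < K)%N ->
  bk j (iter K tau x) = crd (K - j.+1) x.

Lemma pr_eq_ae A B : measurable A -> measurable B ->
  (forall x, G x -> A x <-> B x) -> pr A = pr B.
Proof.
have prG : pr (~` G) = 0.
  have Pf : (P setT < +oo)%E by rewrite PT ltry.
  have e : P (~` G) = (P setT - P G)%E by rewrite -setTD measureD// setTI.
  by rewrite /rprob e PT PG subee.
have W A' B' : measurable A' -> measurable B' -> (forall x, G x -> A' x -> B' x) ->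
    pr A' <= pr B'.
  move=> mA mB AB; rewrite -[leRHS]addr0 -prG; apply: (pr_leU PT) => //.
    exact: measurableC.
  move=> x Ax; case: (pselect (G x)) => Gx; [by left; exact: AB|by right].
move=> mA mB AB; apply/eqP; rewrite eq_le.
by apply/andP; split; apply: W => // x Gx; have [] := AB x Gx.
Qed.

Definition past_hit s k := [set x | exists2 j, (j < k)%N & (s < bk j x)%N].

Lemma measurable_past_hit s k : measurable (past_hit s k).
Proof.
rewrite (_ : past_hit s k = \bigcup_(j in `I_k) [set x | (s < bk j x)%N]).
  apply: bigcup_measurable => j _; exact: (mbk j (fun n => (s < n)%N)).
by apply/seteqP; split=> x [j ? ?]; exists j.
Qed.

Lemma past_hitP s k K x : G x -> (k <= K)%N ->
  past_hit s k (iter K tau x) <-> hit s (K - k) k x.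
Proof.
move=> Gx kK; split=> -[j jk sj].
  rewrite bkP// in sj; last by lia.
  exists (K - j.+1)%N => //; lia.
exists (K - j.+1)%N; first lia.
by rewrite bkP//; [rewrite (_ : K - (K - j.+1).+1 = j)%N//; lia|lia].
Qed.

Definition burst c g i :=
  past_hit (s_ i) (win c i) `&` hit (s_ i) g (win c i).

Lemma measurable_burst c g i : measurable (burst c g i).
Proof. by apply: measurableI => //; exact: measurable_past_hit. Qed.

Lemma burstP c g i K x : G x -> (win c i <= K)%N ->
  burst c g i (iter K tau x) <->
  hit (s_ i) (K - win c i) (win c i) x /\
  hit (s_ i) 0 (win c i) (iter (K + g) tau x).
Proof.
move=> Gx kK; split=> -[h1 h2]; split.
- by apply/past_hitP.
- by apply/hit_preim; rewrite add0n addnC; apply/hit_preim.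
- by apply/past_hitP.
- by apply/hit_preim; rewrite addnC -[(K + g)%N]add0n; apply/hit_preim.
Qed.

Lemma pr_burst c g i : pr (burst c g i) =
  pr (hit (s_ i) 0 (win c i) `&`
      iter (win c i + g) tau @^-1` hit (s_ i) 0 (win c i)).
Proof.
have mb := measurable_burst c g i.
rewrite -(pr_preim H (win c i) mb); apply: pr_eq_ae.
- exact: (measurable_preim H).
- by apply: measurableI => //; exact: (measurable_preim H).
- move=> x Gx; have b := @burstP c g i _ x Gx (leqnn _).
  by rewrite subnn in b.
Qed.

Lemma pr_burst_le c g i : 0 <= c ->
  pr (burst c g i) <= C1 * (c * hazard i) ^+ 2.
Proof.
move=> c0; have C10 : 0 <= C1 by exact: le_trans C1_ge1.
have ch := @cyl_hit (s_ i) 0 (win c i).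
rewrite pr_burst; apply: le_trans (mix_le H g ch ch) _.
rewrite -expr2; apply: ler_pM; rewrite ?sqr_ge0 ?addr_ge0//.
  by rewrite lerD2l (pm_th_le H).
apply: lerXn2r; rewrite ?nnegrE ?pr_ge0 ?pr_hit_win_le//.
by rewrite mulr_ge0// (hazard_ge0 H).
Qed.

Lemma pr_burst_ge c g i : th g <= 1 / 2 ->
  1 / 2 * pr (hit (s_ i) 0 (win c i)) ^+ 2 <= pr (burst c g i).
Proof.
move=> tg; have ch := @cyl_hit (s_ i) 0 (win c i).
rewrite pr_burst; apply: le_trans (mix_ge H g ch ch).
by rewrite -expr2 ler_wpM2r ?sqr_ge0//; lra.
Qed.

Lemma win_mono c i l : 0 <= c -> (i <= l)%N -> (win c i <= win c l)%N.
Proof.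
by move=> c0 il; apply: le_truncn; rewrite ler_wpM2l// (scale_le H).
Qed.

(** After a shift by the longer backward window, all past events become
    events of the first [K] coordinates, and the future ones are mixed with
    them across the gap [g]. *)
Lemma pr_burst_pair c g i0 i l : 0 <= c ->
  (forall i, (i0 <= i)%N -> hazard i <= 1 / 2) -> (i0 <= i <= l)%N ->
  pr (burst c g i `&` burst c g l) <= C1 *
   (C1 * c ^+ 2 * (hazard i * hazard l) + c * ((3 / 4) ^+ (l - i) * hazard l)) ^+ 2.
Proof.
move=> c0 hs il; set Q := (X in X ^+ 2).
have C10 : 0 <= C1 by exact: le_trans C1_ge1.
have kil : (win c i <= win c l)%N by apply: win_mono => //; case/andP: il.
set K := win c l.
pose A := hit (s_ i) (K - win c i) (win c i) `&` hit (s_ l) (K - win c l) (win c l).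
pose B := hit (s_ i) 0 (win c i) `&` hit (s_ l) 0 (win c l).
have cA : cyl K A.
  apply: cylI.
  - by apply: cyl_le (@cyl_hit _ _ _); rewrite subnK.
  - by apply: cyl_le (@cyl_hit _ _ _); rewrite subnK.
have cB : cyl K B.
  by apply: cylI; apply: cyl_le (@cyl_hit _ _ _).
have -> : pr (burst c g i `&` burst c g l) = pr (A `&` iter (K + g) tau @^-1` B).
  rewrite -(pr_preim H K); last by apply: measurableI; exact: measurable_burst.
  apply: pr_eq_ae.
  - by apply: (measurable_preim H); apply: measurableI; exact: measurable_burst.
  - apply: measurableI; first exact: (measurable_cyl H cA).
    by apply: (measurable_preim H); exact: (measurable_cyl H cB).
  move=> x Gx; split.
    by move=> [/burstP -/(_ Gx kil) [? ?] /burstP -/(_ Gx (leqnn _)) [? ?]].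
  move=> [[a1 a2] [b1 b2]]; split.
    by apply/(@burstP c g i K x Gx kil).
  by apply/(@burstP c g l K x Gx (leqnn K)).
apply: le_trans (mix_le H g cA cB) _.
have pA : pr A <= Q by exact: (pr_hit_win_pair _ _ c0 hs il).
have pB : pr B <= Q by exact: (pr_hit_win_pair _ _ c0 hs il).
rewrite expr2; apply: ler_pM; rewrite ?mulr_ge0 ?pr_ge0 ?addr_ge0//.
  by rewrite lerD2l (pm_th_le H).
by apply: ler_pM; rewrite ?pr_ge0.
Qed.

(** The squares of the hazards are the orders of magnitude of the
    probabilities of simultaneous bursts on both sides; the gap [g] makes
    past and future nearly independent from below. *)
Theorem two_sided_bursts c : 0 < c -> ~ summable_hazard P phi ->
  exists g, exists2 del, 0 < del & forall m,
    del <= pr (\bigcup_(i in [set i | (m <= i)%N]) burst c g i).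
Proof.
move=> c0 nS.
have [g tg] : exists g, th g <= 1 / 2 by apply: (pm_th_cvg H); lra.
exists g; have [c' c'0 [N HN]] := pr_hit_win_ge c0.
have c'2 : 0 < c' ^+ 2 by rewrite exprn_gt0.
have lo i : (N <= i)%N -> c' ^+ 2 / 2 * hazard i ^+ 2 <= pr (burst c g i).
  move=> /HN h; apply: le_trans (pr_burst_ge c i tg).
  have : (c' * hazard i) ^+ 2 <= pr (hit (s_ i) 0 (win c i)) ^+ 2.
    by apply: lerXn2r; rewrite ?nnegrE ?pr_ge0// mulr_ge0 ?(hazard_ge0 H)// ltW.
  rewrite exprMn; lra.
(* hazards above [1 / 2] at infinitely many scales make single bursts likely *)
case: (pselect (hazard_small P phi)) => [[i0 hs]|nhs]; last first.
  exists (c' ^+ 2 / 8); first by rewrite divr_gt0.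
  move=> m.
  have [i Mi hi] : exists2 i, (maxn m N <= i)%N & 1 / 2 < hazard i.
    apply: contrapT => no; apply: nhs; exists (maxn m N) => i Mi.
    by rewrite leNgt; apply/negP => hi; apply: no; exists i.
  move: Mi; rewrite geq_max => /andP[mi Ni].
  apply: (@le_trans _ _ (pr (burst c g i))).
    apply: le_trans (lo i Ni).
    have : (1 / 2) ^+ 2 <= hazard i ^+ 2.
      by apply: lerXn2r; rewrite ?nnegrE ?(hazard_ge0 H) ?ltW// divr_ge0.
    rewrite [(1 / 2) ^+ 2]expr2 => hh.
    have : c' ^+ 2 / 2 * (1 / 2 * (1 / 2)) <= c' ^+ 2 / 2 * hazard i ^+ 2.
      by rewrite ler_wpM2l// divr_ge0// ltW.
    lra.
  apply: (pr_le PT) => [||x bx]; [exact: measurable_burst| |by exists i].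
  by apply: bigcup_measurable => *; exact: measurable_burst.
have C10 : 0 < C1 by exact: lt_le_trans C1_ge1.
pose M := C1 ^+ 2 * c ^+ 4 + c ^+ 2.
have M0 : 0 < M by rewrite ltr_wpDl ?exprn_gt0// mulr_ge0 ?exprn_ge0// ltW.
have C0 : 0 < 2 * C1 * M by rewrite !mulr_gt0.
have c''0 : 0 < c' ^+ 2 / 2 by rewrite divr_gt0.
apply: (@kochen_stone _ _ _ P PT _ (fun i => hazard i ^+ 2) _ _ (9 / 16)
  (maxn N i0) c''0 C0) => //.
- by apply/andP; split; lra.
- by move=> *; exact: measurable_burst.
- by move=> i; exact: sqr_ge0.
- by move=> i; rewrite geq_max => /andP[/lo].
- move=> i _; apply: le_trans (pr_burst_le g i (ltW c0)) _.
  rewrite exprMn mulrA ler_wpM2r ?sqr_ge0//.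
  rewrite [2 * C1]mulrC -mulrA ler_wpM2l ?(ltW C10)// /M.
  have := sqr_ge0 c; have : 0 <= C1 ^+ 2 * c ^+ 4.
    by rewrite mulr_ge0 ?exprn_ge0// ltW.
  lra.
move=> i l /andP[]; rewrite geq_max => /andP[_ ii] il.
apply: le_trans (pr_burst_pair g (ltW c0) hs _) _; first by rewrite ii ltnW.
rewrite [leRHS](_ : _ = C1 * (2 * (M * (hazard i ^+ 2 * hazard l ^+ 2 +
  (9 / 16) ^+ (l - i) * hazard l ^+ 2)))); last by ring.
rewrite ler_wpM2l ?(ltW C10)//.
have -> : (9 / 16) ^+ (l - i) = ((3 / 4) ^+ (l - i)) ^+ 2 :> R.
  by rewrite -exprM mulnC exprM; congr (_ ^+ _); rewrite expr2; lra.
rewrite -exprMn -exprMn.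
move: (hazard i * hazard l) ((3 / 4) ^+ (l - i) * hazard l) => u v.
apply: (@le_trans _ _ (2 * ((C1 * c ^+ 2 * u) ^+ 2 + (c * v) ^+ 2))).
  have := sqr_ge0 (C1 * c ^+ 2 * u - c * v).
  move: (C1 * c ^+ 2 * u) (c * v) => p q; rewrite !expr2; nra.
rewrite ler_wpM2l//.
have h1 : 0 <= C1 ^+ 2 * c ^+ 4 * v ^+ 2.
  by rewrite mulr_ge0 ?sqr_ge0// mulr_ge0 ?exprn_ge0// ltW.
have h2 : 0 <= c ^+ 2 * u ^+ 2 by rewrite mulr_ge0 ?sqr_ge0.
have -> : M * (u ^+ 2 + v ^+ 2) = (C1 * c ^+ 2 * u) ^+ 2 + (c * v) ^+ 2 +
    (C1 ^+ 2 * c ^+ 4 * v ^+ 2 + c ^+ 2 * u ^+ 2) by rewrite /M; ring.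
by rewrite lerDl addr_ge0.
Qed.

End two_sided.
End bursts.

(** * Recurrence and Hopf's theorem *)

Section level_sets.
Context {R : realType} {d : measure_display} {X : measurableType d} (f : X -> R).
Hypothesis mf : measurable_fun setT f.

Lemma measurable_sublevel c : measurable [set x | f x < c].
Proof.
rewrite (_ : [set x | _] = setT `&` f @^-1` `]-oo, c[); first exact: mf.
by rewrite setTI; apply/seteqP; split=> x /=; rewrite in_itv.
Qed.

Lemma measurable_sublevel_le c : measurable [set x | f x <= c].
Proof.
rewrite (_ : [set x | _] = setT `&` f @^-1` `]-oo, c]); first exact: mf.
by rewrite setTI; apply/seteqP; split=> x /=; rewrite in_itv.
Qed.

End level_sets.

Section orbits.
Context {R : realType} {d : measure_display} {X : measurableType d}.

Definition birk (T : X -> X) (f : X -> R) (n : nat) (x : X) : R :=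
  \sum_(0 <= k < n) f (iter k T x).

Lemma birk0 T f x : birk T f 0 x = 0.
Proof. by rewrite /birk big_geq. Qed.

Lemma birkD T f m n x : birk T f (m + n) x = birk T f m x + birk T f n (iter m T x).
Proof.
rewrite /birk (@big_cat_nat _ _ _ m 0%N (m + n)) ?leq_addr//=; congr (_ + _).
rewrite -{1}[m]add0n big_addn addKn.
by apply: eq_bigr => i _; rewrite -iterD.
Qed.

Lemma birk1 T f x : birk T f 1 x = f x.
Proof. by rewrite /birk big_nat1. Qed.

Lemma birkS T f n x : birk T f n.+1 x = f x + birk T f n (T x).
Proof. by rewrite -addn1 addnC birkD birk1. Qed.

Lemma birkSr T f n x : birk T f n.+1 x = birk T f n x + f (iter n T x).
Proof. by rewrite -addn1 birkD birk1. Qed.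

Lemma birk_ge0 T f n x : (forall y, 0 <= f y) -> 0 <= birk T f n x.
Proof. by move=> f0; exact: sumr_ge0. Qed.

Lemma birk_le T f m n x : (forall y, 0 <= f y) -> (m <= n)%N ->
  birk T f m x <= birk T f n x.
Proof.
by move=> f0 /subnKC <-; rewrite birkD lerDl birk_ge0.
Qed.

Lemma measurable_birk T f n : measurable_fun setT T -> measurable_fun setT f ->
  measurable_fun setT (birk T f n).
Proof.
move=> mT mf; apply: measurable_sum => k.
exact: (measurableT_comp mf (measurable_fun_iter k mT)).
Qed.

End orbits.

Section symmetry.
Context {R : realType} {d : measure_display} {X : measurableType d}.
Variables (m : {measure set X -> \bar R}) (T Tinv : X -> X).
Hypothesis hT : invertible_mpt m T Tinv.

Lemma iterK n : cancel (iter n T) (iter n Tinv).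
Proof.
elim: n => [//|n IH] x; rewrite [iter n.+1 Tinv _]iterSr iterS.
by rewrite (mpt_cancel hT) IH.
Qed.

Lemma iter_back n k x : (k <= n)%N -> iter k Tinv (iter n T x) = iter (n - k) T x.
Proof. by move=> kn; rewrite -{1}(subnKC kn) iterD iterK. Qed.

Lemma invertible_sym : invertible_mpt m Tinv T.
Proof.
have [c1 c2 m1 m2 p] := hT; split=> // A mA.
rewrite -(p (Tinv @^-1` A)); last first.
  by rewrite -[X in measurable X]setTI; exact: m2.
by congr (m _); apply/funext => x; rewrite /preimage/mkset c1.
Qed.

Lemma iter_preim_measurable n A : measurable A -> measurable (iter n T @^-1` A).
Proof.
move=> mA; rewrite -[X in measurable X]setTI.
exact: (measurable_fun_iter n (mpt_measurable hT)).
Qed.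

Lemma iter_preserve n A : measurable A -> m (iter n T @^-1` A) = m A.
Proof.
move=> mA; elim: n => [//|n IH].
rewrite -IH -(mpt_preserve hT (iter_preim_measurable n mA)).
by congr (m _); apply/funext => x; rewrite /preimage/mkset -iterSr.
Qed.

Lemma ergodic_sym : ergodic m T -> ergodic m Tinv.
Proof.
move=> e A mA TA; apply: e => //.
by rewrite -{1}TA; apply/funext => x; rewrite /preimage/mkset (mpt_cancel hT).
Qed.

Lemma ae_iter n (Q : X -> Prop) :
  {ae m, forall x, Q x} -> {ae m, forall x, Q (iter n T x)}.
Proof.
move=> [N [mN N0 QN]]; exists (iter n T @^-1` N); split.
- exact: iter_preim_measurable.
- by rewrite iter_preserve.
- by move=> x /= Qx; apply: QN.
Qed.

End symmetry.

(** A shift by [i + j] turns a coincidence of backward preimages into one of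
    forward preimages. *)
Lemma conservative_sym {R : realType} {d : measure_display} {X : measurableType d}
  (m : {measure set X -> \bar R}) (T Tinv : X -> X) :
  invertible_mpt m T Tinv -> conservative m T -> conservative m Tinv.
Proof.
move=> hT c W [mW tW]; apply: c; split=> // i j _ _ [x [/= Wi Wj]].
apply: (tW i j I I); exists (iter (i + j) T x); split=> /=.
  by rewrite (iter_back hT) ?leq_addr// addKn.
by rewrite (iter_back hT) ?leq_addl// addnK.
Qed.

Section recurrent.
Context {d : measure_display} {X : measurableType d}.
Variables (T : X -> X) (Om : set X).

Definition recurrent (x : X) : Prop :=
  forall N, exists2 n, (N <= n)%N & Om (iter n T x).

Lemma recurrent_iter k x : recurrent x <-> recurrent (iter k T x).
Proof.
split=> r N.
  have [n Nn On] := r (N + k)%N; exists (n - k)%N; first lia.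
  by rewrite -iterD subnK//; lia.
by have [n Nn On] := r N; exists (n + k)%N; [lia|rewrite iterD].
Qed.

End recurrent.

Section recurrence.
Context {R : realType} {d : measure_display} {X : measurableType d}.
Variables (m : {measure set X -> \bar R}) (T Tinv : X -> X).
Hypotheses (hT : invertible_mpt m T Tinv) (hc : conservative m T)
  (he : ergodic m T).
Variable Om : set X.
Hypotheses (mOm : measurable Om) (Om0 : (0 < m Om)%E).

Let visit n := iter n T @^-1` Om.
Let mvisit n : measurable (visit n).
Proof. exact: (iter_preim_measurable hT). Qed.

(** The points of [Om] that never come back form a wandering set, and the
    last of finitely many visits leads to such a point. Hence [Om] is covered
    by null sets and by the invariant set of recurrent points, which
    therefore is conull by ergodicity. *)
Lemma ae_recurrent : {ae m, forall x, recurrent T Om x}.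
Proof.
pose I := \bigcap_N \bigcup_(n in [set n | (N <= n)%N]) visit n.
have IE : I = [set x | recurrent T Om x].
  apply/seteqP; split=> x.
    by move=> Ix N; have [n Nn ?] := Ix N Logic.I; exists n.
  by move=> rx N _; have [n Nn ?] := rx N; exists n.
have mI : measurable I.
  by apply: bigcap_measurableType => N _; apply: bigcup_measurable.
have TI : T @^-1` I = I.
  rewrite IE; apply/seteqP; split=> x /=; first by move/(recurrent_iter T Om 1 x).2.
  by move/(recurrent_iter T Om 1 x).1.
pose W := Om `\` \bigcup_(n in [set n | (1 <= n)%N]) visit n.
have mW : measurable W by apply: measurableD => //; exact: bigcup_measurable.
have W0 : m W = 0%E.
  apply: hc; split=> //; apply/trivIsetP => i j _ _.
  wlog ij : i j / (i < j)%N.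
    move=> h; case: (ltngtP i j) => // ij _; first by apply: h; rewrite ?lt_eqF.
    by rewrite setIC; apply: h; rewrite ?lt_eqF.
  move=> _; apply/seteqP; split=> // x [[_ Wi] [Wj _]]; apply: Wi.
  exists (j - i)%N => /=; first by rewrite subn_gt0.
  by rewrite /visit /preimage/= -iterD subnK// ltnW.
have [I0|I0] := he mI TI; last first.
  by exists (~` I); split=> //; [exact: measurableC|rewrite IE].
exfalso; move: Om0; apply/negP; rewrite -leNgt.
have sub : Om `<=` I `|` \bigcup_n (iter n T @^-1` W).
  move=> x Ox; case: (pselect (I x)) => Ix; [by left|right].
  have [N HN] : exists N, forall n, Om (iter n T x) -> (n < N)%N.
    apply: contrapT => no; apply: Ix; rewrite IE => N.
    apply: contrapT => no'; apply: no; exists N => n On.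
    by rewrite ltnNge; apply/negP => Nn; apply: no'; exists n.
  have ex : exists n, `[< Om (iter n T x) >] by exists 0%N; apply/asboolP.
  have ub n : `[< Om (iter n T x) >] -> (n <= N)%N by move/asboolP/HN/ltnW.
  case: (ex_maxnP ex ub) => n /asboolP On nmax; exists n => //; split=> //.
  move=> [k /= k1]; rewrite /visit /preimage/= -iterD => /asboolP/nmax.
  by move=> h; move: k1; lia.
apply: (@le_trans _ _ (m (I `|` \bigcup_n (iter n T @^-1` W)))).
  apply: le_measure; rewrite ?inE//.
  apply: measurableU => //; apply: bigcup_measurable => n _.
  exact: (iter_preim_measurable hT).
have N1 : m.-negligible (I `|` \bigcup_n (iter n T @^-1` W)).
  apply: negligibleU; first by apply/negligibleP.
  apply: negligible_bigcup => n; exists (iter n T @^-1` W); split=> //.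
    exact: (iter_preim_measurable hT).
  by have := iter_preserve hT n mW; rewrite W0.
rewrite (measure_negligible _ N1)//.
apply: measurableU => //; apply: bigcup_measurable => n _.
exact: (iter_preim_measurable hT).
Qed.

(** The set where the domination holds is invariant, because a step along an
    orbit changes the functions by a bounded amount. *)
Lemma tame_dichotomy (u : nat -> X -> R) (b : nat -> R) (C : R) :
  (forall i, measurable_fun setT (u i)) ->
  (forall i x, `|u i (T x) - u i x| <= C) ->
  let V := [set x | exists D, forall i, b i <= u i x + D] in
  measurable V /\ (m V = 0%E \/ m (~` V) = 0%E).
Proof.
move=> mu uC V.
have mV : measurable V.
  have -> : V = \bigcup_(D : nat) \bigcap_i [set x | b i <= u i x + D%:R].
    apply/seteqP; split=> x.
      move=> [D HD]; exists (Num.truncn D).+1 => // i _ /=.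
      by apply: (le_trans (HD i)); rewrite lerD2l ltW// truncnS_gt.
    by move=> [D _ HD]; exists D%:R => i; exact: HD.
  apply: bigcup_measurable => D _; apply: bigcap_measurableType => i _.
  rewrite (_ : [set x | _] = [set x | b i - u i x <= D%:R]).
    by apply: measurable_sublevel_le; apply: measurable_funB.
  by apply/seteqP; split=> x /=; lra.
split=> //; apply: he => //; apply/seteqP; split=> x [D HD].
- exists (D + C) => i; have := HD i; have := uC i x.
  by rewrite ler_norml => /andP[]; lra.
- exists (D + C) => i; have := HD i; have := uC i x.
  by rewrite ler_norml => /andP[]; lra.
Qed.

End recurrence.

Section hopf.
Context {R : realType} {d : measure_display} {X : measurableType d}.
Variables (m : {measure set X -> \bar R}) (T Tinv : X -> X).
Hypotheses (hT : invertible_mpt m T Tinv) (he : ergodic m T).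

Lemma integrable_comp_mpt (f : X -> \bar R) :
  m.-integrable setT f -> m.-integrable setT (f \o T).
Proof.
have mT := mpt_measurable hT.
move=> /integrableP[mf If]; apply/integrableP; split.
  exact: (measurableT_comp mf).
have mabs : measurable_fun setT (fun x => `|f x|%E) by exact: measurableT_comp.
have e := @ge0_integral_pushforward _ _ X X R T mT m setT (fun x => `|f x|%E)
  measurableT mabs (fun x _ => abse_ge0 _).
rewrite preimage_setT in e; rewrite -[X in (X < _)%E]e.
rewrite (@eq_measure_integral _ _ _ _ m)// => A mA _.
exact: (mpt_preserve hT).
Qed.

Lemma integral_comp_mpt (f : X -> \bar R) :
  m.-integrable setT f -> (\int[m]_x f (T x) = \int[m]_x f x)%E.
Proof.
move=> If; have mT := mpt_measurable hT.
have [mf _] := integrableP _ _ _ If.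
have IfT := integrable_comp_mpt If.
have := @integral_pushforward _ _ X X R T mT m setT f mf.
rewrite preimage_setT => /(_ IfT measurableT) <-.
by apply: eq_measure_integral => A mA _; exact: (mpt_preserve hT).
Qed.

Variable h : X -> R.
Hypothesis Ih : m.-integrable setT (EFin \o h).

(** The maximum of the sums of [h] over at most [n] terms. *)
Fixpoint garsia (n : nat) (x : X) : R :=
  if n is k.+1 then Num.max 0 (h x + garsia k (T x)) else 0.

Lemma garsia_ge0 n x : 0 <= garsia n x.
Proof. by case: n => [|n] //=; rewrite le_max lexx. Qed.

Lemma garsia_le n x : garsia n x <= garsia n.+1 x.
Proof.
elim: n x => [|n IH] x; first exact: garsia_ge0.
by rewrite /= ge_max !le_max lexx/= lerD2l IH orbT.
Qed.

Lemma birk_le_garsia n x : birk T h n x <= garsia n x.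
Proof.
elim: n x => [|n IH] x; first by rewrite birk0.
by rewrite birkS /= le_max lerD2l IH orbT.
Qed.

Lemma garsia_mono k n x : (k <= n)%N -> garsia k x <= garsia n x.
Proof.
move=> /subnK <-; elim: (n - k)%N => [//|j IH].
by rewrite addSn; exact: le_trans IH (garsia_le _ _).
Qed.

Let mh : measurable_fun setT h.
Proof. by have /integrableP[/measurable_EFinP] := Ih. Qed.

Lemma measurable_garsia n : measurable_fun setT (garsia n).
Proof.
elim: n => [|n IH]; first exact: measurable_cst.
apply: measurable_maxr; first exact: measurable_cst.
apply: measurable_funD => //; exact: (measurableT_comp IH (mpt_measurable hT)).
Qed.

Lemma measurable_garsia_gt0 n : measurable [set x | (0 < garsia n x)].
Proof.
rewrite (_ : [set x | _] = [set x | - garsia n x < 0]).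
  by apply: measurable_sublevel; apply: measurableT_comp => //; exact: measurable_garsia.
by apply/seteqP; split=> x /=; rewrite oppr_lt0.
Qed.

Lemma integrable_garsia n : m.-integrable setT (EFin \o garsia n).
Proof.
elim: n => [|n IH]; first exact: integrable0.
have I2 := integrable_comp_mpt IH.
have I3 : m.-integrable setT (fun x => (`|h x| + `|garsia n (T x)|)%:E).
  under eq_fun do rewrite EFinD.
  apply: integrableD => //; first exact: (integrable_norm Ih).
  exact: (@integrable_norm _ _ _ _ _ (garsia n \o T) I2).
apply: le_integrable I3 => //.
  by apply/measurable_EFinP; exact: (measurable_garsia n.+1).
move=> x _ /=; rewrite lee_fin ger0_norm ?(garsia_ge0 n.+1)//.
rewrite [leRHS]ger0_norm ?addr_ge0// ge_max addr_ge0//=.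
by rewrite lerD// ler_norm.
Qed.

(** Garsia's argument: where the maximum is positive, it equals [h] plus the
    previous maximum composed with [T], and elsewhere it vanishes; the
    integral of [garsia n.+1] is at least that of [garsia n], hence of
    [garsia n \o T]. *)
Lemma hopf_maximal n :
  (0 <= \int[m]_x ((\1_[set x | (0 < garsia n.+1 x)%R] x * h x)%R)%:E)%E.
Proof.
have I1 := integrable_garsia n.+1.
have I2 := integrable_comp_mpt (integrable_garsia n).
have I0 := integrable_garsia n.
set B := [set x | _].
have mB : measurable B.
  exact: (measurable_garsia_gt0 n.+1).
have IB : m.-integrable setT (fun x => ((\1_B x * h x)%R)%:E).
  apply: le_integrable Ih => //.
    apply/measurable_EFinP; apply: measurable_funM => //.
  move=> x _ /=; rewrite lee_fin normrM indicE.
  by rewrite ler_piMl//; case: (x \in B); rewrite /= ?normr1 ?normr0.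
have D0 : (\int[m]_x ((garsia n.+1 x)%:E - (garsia n (T x))%:E) =
   \int[m]_x (garsia n.+1 x)%:E - \int[m]_x (garsia n x)%:E)%E.
  rewrite integralB//; congr (_ - _)%E.
  exact: (integral_comp_mpt I0).
apply: (@le_trans _ _ (\int[m]_x ((garsia n.+1 x)%:E - (garsia n (T x))%:E))%E).
  rewrite D0 sube_ge0; last first.
    by rewrite integrable_fin_num ?orbT.
  by apply: le_integral => // x _; rewrite lee_fin garsia_le.
apply: le_integral => //; first exact: integrableB.
move=> x _; rewrite -EFinB lee_fin indicE.
case: (pselect (B x)) => Bx; last first.
  rewrite memNset// mul0r subr_le0; apply: le_trans (garsia_ge0 n (T x)).
  by rewrite leNgt; apply/negP.
rewrite mem_set// mul1r.
move: Bx; rewrite /B/= lt_max ltxx/= => h0.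
by rewrite (max_idPr (ltW h0)) addrK.
Qed.

(** Hopf's ratio theorem in additive form: the sums of a function of negative
    integral are bounded above almost everywhere. Otherwise, by ergodicity,
    some sum is positive almost everywhere, and the maximal inequality makes
    the integral nonnegative. *)
Theorem birk_bounded : (\int[m]_x (h x)%:E < 0)%E ->
  {ae m, forall x, exists D, forall n, birk T h n x <= D}.
Proof.
move=> neg.
pose V := [set x | exists D, forall n, birk T h n x <= D].
have mV : measurable V.
  have -> : V = \bigcup_(D : nat) \bigcap_i [set x | birk T h i x <= D%:R].
    apply/seteqP; split=> x.
      move=> [D HD]; exists (Num.truncn D).+1 => // i _ /=.
      by apply: (le_trans (HD i)); rewrite ltW// truncnS_gt.
    by move=> [D _ HD]; exists D%:R => i; exact: HD.
  apply: bigcup_measurable => D _; apply: bigcap_measurableType => i _.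
  apply: measurable_sublevel_le.
  exact: (measurable_birk i (mpt_measurable hT) mh).
have TV : T @^-1` V = V.
  apply/seteqP; split=> x [D HD].
    exists (Num.max 0 (h x + D)) => -[|n]; first by rewrite birk0 le_max lexx.
    by rewrite birkS le_max lerD2l HD orbT.
  by exists (D - h x) => n; have := HD n.+1; rewrite birkS; lra.
have [V0|V0] := he mV TV; last first.
  by exists (~` V); split=> //; exact: measurableC.
exfalso; move: neg; apply/negP; rewrite -leNgt.
pose B n := [set x | (0 < garsia n x)].
have mB n : measurable (B n).
  exact: measurable_garsia_gt0.
have [] := @dominated_convergence _ X R m setT measurableT
  (fun n x => ((\1_(B n.+1) x * h x)%R)%:E) (EFin \o h) (fun x => `|(h x)%:E|%E).
- by move=> n; apply/measurable_EFinP; apply: measurable_funM.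
- by apply/measurable_EFinP.
- exists V; split=> // x /= no; apply: contrapT => Vx; apply: no => _.
  have [N HN] : exists N, 0 < birk T h N x.
    apply: contrapT => no; apply: Vx; exists 0 => n; rewrite leNgt.
    by apply/negP => ?; apply: no; exists n.
  apply: cvg_near_cst; exists N => // n /= Nn.
  rewrite indicE mem_set ?mul1r// /B/=; apply: (lt_le_trans HN).
  apply: (le_trans (birk_le_garsia _ _)).
  exact: (garsia_mono x (leqW Nn)).
- exact: integrable_abse.
- apply: aeW => x n _ /=; rewrite lee_fin normrM indicE.
  by rewrite ler_piMl//; case: (x \in B n.+1); rewrite /= ?normr1 ?normr0.
move=> _ _ cv; have <- := cvg_lim (@ereal_hausdorff R) cv; apply: lime_ge.
  by apply/cvg_ex; eexists; exact: cv.
by apply: nearW => n; exact: hopf_maximal.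
Qed.

End hopf.

(** * The induced transformation *)

Section return_time.
Context {d : measure_display} {X : measurableType d}.
Variables (T : X -> X) (Om : set X).
Local Notation phi := (return_time T Om).

Definition first_return (x : X) (n : nat) : Prop :=
  [/\ (1 <= n)%N, Om (iter n T x) &
    forall k, (1 <= k < n)%N -> ~ Om (iter k T x)].

Lemma first_return_uniq x n k : first_return x n -> first_return x k -> n = k.
Proof.
move=> [n1 On nn] [k1 Ok kk]; case: (ltngtP n k) => // h.
  by case: (kk n); rewrite ?n1.
by case: (nn k); rewrite ?k1.
Qed.

Lemma return_timeE x n : first_return x n -> phi x = n.
Proof.
by move=> r; apply: xget_unique => // k rk; exact: first_return_uniq rk r.
Qed.

Lemma return_timeP x n : (1 <= n)%N -> Om (iter n T x) -> first_return x (phi x).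
Proof.
move=> n1 On.
have ex : exists k, (1 <= k)%N && `[< Om (iter k T x) >].
  by exists n; rewrite n1; apply/asboolP.
have [k r] : exists k, first_return x k.
  case: (ex_minnP ex) => k /andP[k1 /asboolP Ok] kmin; exists k; split=> //.
  move=> j /andP[j1 jk] Oj; have := kmin j; rewrite j1 => /(_ (asboolT Oj)).
  by rewrite leqNgt jk.
by rewrite (return_timeE r).
Qed.

Lemma return_time_cases x :
  first_return x (phi x) \/ phi x = 0%N /\ forall n, (1 <= n)%N -> ~ Om (iter n T x).
Proof.
case: (pselect (exists2 n, (1 <= n)%N & Om (iter n T x))) => [[n n1 On]|no].
  by left; exact: return_timeP On.
have no' n : (1 <= n)%N -> ~ Om (iter n T x) by move=> n1 On; apply: no; exists n.
right; split=> //; apply: xgetPN => n [n1 On _]; exact: no' On.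
Qed.

End return_time.

Lemma measure_nat_partition {R : realType} {d : measure_display} {X : measurableType d}
  (m : {measure set X -> \bar R}) (g : X -> nat) (B : set X) :
  measurable B -> (forall n, measurable [set x | g x = n]) ->
  m B = (\sum_(n <oo) m (B `&` [set x | g x = n]))%E.
Proof.
move=> mB mg.
have BE : B = \bigcup_n (B `&` [set x | g x = n]).
  apply/seteqP; split=> [x Bx|x [n _ []//]]; by exists (g x).
rewrite {1}BE measure_semi_bigcup//.
- by move=> n; exact: measurableI.
- by move=> i j _ _ [x [[_ /= <-] [_ /= <-]]].
- by rewrite -BE.
Qed.

Section induced.
Context {R : realType} {d : measure_display} {X : measurableType d}.
Variables (m : {measure set X -> \bar R}) (Om : set X).
Hypotheses (mOm : measurable Om) (Om0 : (0 < m Om)%E).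

Section one_direction.
Variables (T Tinv : X -> X).
Hypotheses (hT : invertible_mpt m T Tinv) (hc : conservative m T)
  (he : ergodic m T).
Local Notation phi := (return_time T Om).
Local Notation tau := (induced_map T Om).

Let mvisit n : measurable (iter n T @^-1` Om).
Proof. exact: (iter_preim_measurable hT). Qed.

Lemma measurable_return_time n : measurable [set x | phi x = n].
Proof.
case: n => [|n].
  rewrite (_ : [set x | _] = ~` \bigcup_(n in [set n | (1 <= n)%N]) iter n T @^-1` Om).
    by apply: measurableC; apply: bigcup_measurable.
  apply/seteqP; split=> x /=.
    move=> p0 [n n1 On]; have [+ _ _] := return_timeP n1 On.
    by rewrite p0.
  move=> no; have [[p1 Op _]|[]//] := return_time_cases T Om x.
  by case: no; exists (phi x).
rewrite (_ : [set x | _] = iter n.+1 T @^-1` Om `\`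
    \bigcup_(k in [set k | (1 <= k < n.+1)%N]) iter k T @^-1` Om).
  by apply: measurableD => //; apply: bigcup_measurable.
apply/seteqP; split=> x /=.
  move=> pn; have [[_ Op pmin]|[p0 _]] := return_time_cases T Om x.
    by rewrite pn in Op pmin; split=> // -[k /= kn Ok]; exact: pmin Ok.
  by rewrite p0 in pn.
move=> [On no]; apply: return_timeE; split=> // k kn Ok; apply: no; exists k => //.
Qed.

Lemma measurable_return_time_set (Q : set nat) : measurable [set x | Q (phi x)].
Proof.
rewrite (_ : [set x | _] = \bigcup_(n in Q) [set x | phi x = n]).
  by apply: bigcup_measurable => n _; exact: measurable_return_time.
by apply/seteqP; split=> [x Qx|x [n Qn /= ->]//]; exists (phi x).
Qed.

Lemma measurable_induced_map : measurable_fun setT tau.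
Proof.
move=> _ A mA; rewrite setTI.
rewrite (_ : _ @^-1` _ = \bigcup_n ([set x | phi x = n] `&` iter n T @^-1` A)).
  apply: bigcup_measurable => n _; apply: measurableI.
    exact: measurable_return_time.
  exact: (iter_preim_measurable hT).
apply/seteqP; split=> [x Ax|x [n _ [/= <-]]//].
by exists (phi x).
Qed.

Lemma first_return_recurrent x : recurrent T Om x -> first_return T Om x (phi x).
Proof. by move=> r; have [n n1 On] := r 1%N; exact: return_timeP On. Qed.

Lemma null_no_return : m (Om `&` [set x | phi x = 0%N]) = 0%E.
Proof.
have [N [mN N0 HN]] := ae_recurrent hT hc he mOm Om0.
apply: subset_measure0 N0 => //.
  by apply: measurableI => //; exact: measurable_return_time.
move=> x [_ /= p0]; apply: HN => /= r.
by have [] := first_return_recurrent r; rewrite p0.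
Qed.

End one_direction.

Section two_directions.
Variables (T Tinv : X -> X).
Hypotheses (hT : invertible_mpt m T Tinv) (hc : conservative m T)
  (he : ergodic m T).
Local Notation phi := (return_time T Om).
Local Notation psi := (return_time Tinv Om).
Local Notation tau := (induced_map T Om).
Local Notation sigma := (induced_map Tinv Om).
Let hT' := invertible_sym hT.
Let hc' := conservative_sym hT hc.
Let he' := ergodic_sym hT he.

(** The points of [Om] with infinitely many visits in both directions of
    time; on them the induced map is a bijection. *)
Definition core := [set x | [/\ Om x, recurrent T Om x & recurrent Tinv Om x] ].

Lemma first_return_reverse n x : Om x -> first_return T Om x n ->
  first_return Tinv Om (iter n T x) n.
Proof.
clear mOm Om0 hc he hc' he'.
move=> Ox [n1 On nmin]; split=> //; first by rewrite (iterK hT).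
move=> k /andP[k1 kn]; rewrite (iter_back hT) ?(ltnW kn)//.
by apply: nmin; lia.
Qed.

Lemma core_step x : core x ->
  [/\ core (tau x), psi (tau x) = phi x & sigma (tau x) = x].
Proof.
move=> [Ox r r']; have fr := first_return_recurrent r.
have pe : psi (tau x) = phi x.
  by apply: return_timeE; exact: first_return_reverse fr.
split=> //.
  split; first by have [] := fr.
    exact: (recurrent_iter T Om (phi x) x).1 r.
  by apply: (recurrent_iter Tinv Om (phi x) _).2; rewrite /induced_map (iterK hT).
by rewrite {1}/induced_map pe (iterK hT).
Qed.

Lemma core_iter n x : core x -> core (iter n tau x).
Proof. by move=> cx; elim: n => [//|n IH]; have [] := core_step IH. Qed.

Lemma core_back n k x : core x -> (k <= n)%N ->
  iter k sigma (iter n tau x) = iter (n - k) tau x.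
Proof.
clear mOm Om0 hc he hc' he'.
move=> cx; elim: k => [|k IH] kn; first by rewrite subn0.
rewrite iterS IH ?(ltnW kn)//.
have -> : (n - k = (n - k.+1).+1)%N by lia.
by have [] := core_step (core_iter (n - k.+1) cx).
Qed.

Lemma core_reversal x j K : core x -> (j < K)%N ->
  proc sigma psi j (iter K tau x) = proc tau phi (K - j.+1) x.
Proof.
clear mOm Om0 hc he hc' he'.
move=> cx jK; rewrite /proc core_back ?(ltnW jK)//.
have -> : (K - j = (K - j.+1).+1)%N by lia.
by have [] := core_step (core_iter (K - j.+1) cx).
Qed.

Lemma measurable_core : measurable core.
Proof.
have mr S S' : invertible_mpt m S S' -> measurable [set x | recurrent S Om x].
  move=> hS.
  rewrite (_ : [set x | _] = \bigcap_N \bigcup_(n in [set n | (N <= n)%N]) iter n S @^-1` Om).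
    apply: bigcap_measurableType => N _; apply: bigcup_measurable => n _.
    exact: (iter_preim_measurable hS).
  apply/seteqP; split=> x r N; first by have [n] := r N; exists n.
  by have [n] := r N Logic.I; exists n.
rewrite (_ : core = Om `&` [set x | recurrent T Om x] `&` [set x | recurrent Tinv Om x]).
  by apply: measurableI; [apply: measurableI => //; exact: mr hT|exact: mr hT'].
by apply/seteqP; split=> x; [move=> [? ? ?]; split|move=> [[? ?] ?]; split].
Qed.

Lemma ae_core : {ae m, forall x, Om x -> core x}.
Proof.
have r := ae_recurrent hT hc he mOm Om0.
have r' := ae_recurrent hT' hc' he' mOm Om0.
by apply: filterS2 r r' => x rx rx' Ox; split.
Qed.

(** [iter n.+1 T] maps the points that return at time [n.+1] onto those that
    were in [Om] exactly [n.+1] steps before for the last time. *)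
Lemma induced_preserve A : measurable A ->
  m (tau @^-1` A `&` Om) = m (A `&` Om).
Proof.
move=> mA.
have mt : measurable (tau @^-1` A).
  rewrite -[X in measurable X]setTI; exact: (measurable_induced_map hT).
have mp := measurable_return_time hT; have mp' := measurable_return_time hT'.
rewrite (measure_nat_partition m (measurableI _ _ mt mOm) mp).
rewrite (measure_nat_partition m (measurableI _ _ mA mOm) mp').
apply: eq_eseriesr => n _; case: n => [|n].
  rewrite (subset_measure0 _ _ _ (null_no_return hT hc he)).
  - rewrite (subset_measure0 _ _ _ (null_no_return hT' hc' he'))//.
    + by apply: measurableI => //; exact: measurableI.
    + by apply: measurableI.
    + by move=> x [[]].
  - by apply: measurableI => //; exact: measurableI.
  - by apply: measurableI.
  - by move=> x [[]].
rewrite -[RHS](iter_preserve hT n.+1); last first.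
  by apply: measurableI => //; exact: measurableI.
congr (m _); apply/seteqP; split=> x.
  move=> [[Ax Ox] /= pn].
  have fr : first_return T Om x n.+1.
    have [|[]] := return_time_cases T Om x; by rewrite pn.
  have [_ On _] := fr.
  split; [split=> //|]; first by move: Ax; rewrite /preimage/= /induced_map pn.
  by apply: return_timeE; exact: first_return_reverse.
move=> [[Ax Ox] pn].
have fr : first_return Tinv Om (iter n.+1 T x) n.+1.
  by have [|[]] := return_time_cases Tinv Om (iter n.+1 T x); rewrite pn.
have [_ On nmin] := fr; rewrite (iterK hT) in On.
have pe : phi x = n.+1.
  apply: return_timeE; split=> // k /andP[k1 kn] Ok.
  apply: (nmin (n.+1 - k)%N); first lia.
  by rewrite (iter_back hT) ?leq_subr// subKn// ltnW.
by split=> //; split=> //; rewrite /preimage/= /induced_map pe.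
Qed.

(** One half of Kac's formula: the columns over [Om], cut at the return time,
    cover almost all of the space. *)
Lemma kac_le : (m setT <= \sum_(s <oo) m (Om `&` [set x | (s < phi x)%N]))%E.
Proof.
have mp s : measurable (Om `&` [set x | (s < phi x)%N]).
  by apply: measurableI => //; exact: (measurable_return_time_set hT (fun n => (s < n)%N)).
have [N [mN N0 HN]] := ae_recurrent hT' hc' he' mOm Om0.
have [N' [mN' N'0 HN']] := ae_recurrent hT hc he mOm Om0.
pose F s := iter s Tinv @^-1` (Om `&` [set x | (s < phi x)%N]).
have mF s : measurable (F s) by exact: (iter_preim_measurable hT').
have cover : setT `<=` (N `|` N') `|` \bigcup_s F s.
  move=> x _; case: (pselect (recurrent Tinv Om x)) => [r'|nr]; last first.
    by left; left; apply: HN.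
  case: (pselect (recurrent T Om x)) => [r|nr]; last first.
    by left; right; apply: HN'.
  right; have ex : exists n, `[< Om (iter n Tinv x) >].
    by have [n _ On] := r' 0%N; exists n; apply/asboolP.
  case: (ex_minnP ex) => n /asboolP On nmin; exists n => //; split=> //=.
  set y := iter n Tinv x.
  have back k : (k <= n)%N -> iter k T y = iter (n - k) Tinv x.
    by move=> kn; rewrite /y (iter_back hT').
  have ry : recurrent T Om y.
    by apply: (recurrent_iter T Om n _).2; rewrite back// subnn.
  have [p1 Op _] := first_return_recurrent ry.
  rewrite ltnNge; apply/negP => pn.
  have := nmin (n - phi y)%N; rewrite -back// => /(_ (asboolT Op)).
  by lia.
have mU : measurable (\bigcup_s F s) by exact: bigcup_measurable.
have le1 : (m setT <= m ((N `|` N') `|` \bigcup_s F s))%E.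
  by apply: le_measure; rewrite ?inE//; apply: measurableU => //; exact: measurableU.
apply: (le_trans le1).
rewrite setUC measureU0//; [|exact: measurableU|]; last by rewrite measureU0.
apply: (@le_trans _ _ (\sum_(s <oo) m (F s))%E).
  apply: measure_sigma_subadditive => //.
by rewrite le_eqVlt; apply/orP; left; apply/eqP; apply: eq_eseriesr => s _;
  exact: (iter_preserve hT').
Qed.

End two_directions.

End induced.

(** * Cauchy condensation *)

Section hazard_series.
Context {R : realType} {d : measure_display} {X : measurableType d}.
Variables (P : {measure set X -> \bar R}) (tau : X -> X) (phi : X -> nat).
Variable th : nat -> R.
Hypothesis H : psi_mixing P tau phi th.
Local Notation tail := (tail P phi).
Local Notation L := (trmean P phi).
Local Notation hazard := (hazard P phi).

Let b (n : nat) : R := n%:R * (tail n.-1 / L n) ^+ 2.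
Let b0 n : 0 <= b n. Proof. by rewrite mulr_ge0// sqr_ge0. Qed.

Let sum_block (u : nat -> R) i :
  \sum_(0 <= n < 2 ^ i.+1) u n =
  \sum_(0 <= n < 2 ^ i) u n + \sum_(2 ^ i <= n < 2 ^ i.+1) u n.
Proof. by rewrite (@big_cat_nat _ _ _ (2 ^ i))//= leq_exp2l. Qed.

Let ratio_sqr i : (tail (2 ^ i).-1 / L (2 ^ i)%N) ^+ 2 = hazard i ^+ 2 / 4 ^+ i.
Proof.
have -> : 4 ^+ i = (2 ^+ i) ^+ 2 :> R by rewrite expr2 -exprMn -natrM.
rewrite /hazard /hazard -expr_div_n; congr (_ ^+ 2).
by field; rewrite (gt_eqF (L2_gt0 H i)) (gt_eqF (@pow2_gt0 R i)).
Qed.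

Let ratio_le m n : (0 < m)%N -> (m <= n)%N ->
  (tail n.-1 / L n) ^+ 2 <= (tail m.-1 / L m) ^+ 2.
Proof.
move=> m0 mn; have Lm : 0 < L m by apply: lt_le_trans ltr01 (trmean_ge1 H m0).
have Lmn : L m <= L n := trmean_le P phi mn.
have Ln : 0 < L n := lt_le_trans Lm Lmn.
apply: lerXn2r; rewrite ?nnegrE ?divr_ge0 ?tail_ge0 ?(ltW Lm) ?(ltW Ln)//.
apply: ler_pM; rewrite ?tail_ge0 ?invr_ge0 ?(ltW Ln)//.
  by apply: (tail_nincr H); lia.
by rewrite lef_pV2.
Qed.

Let block_card i : (2 ^ i.+1 - 2 ^ i = 2 ^ i)%N.
Proof. by rewrite expnS; lia. Qed.

Let pow4 i : 4 ^+ i = 2 ^+ i * 2 ^+ i :> R.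
Proof. by rewrite -exprMn -natrM. Qed.

Lemma block_le i : \sum_(2 ^ i <= n < 2 ^ i.+1) b n <= 2 * hazard i ^+ 2.
Proof.
have p0 := @pow2_gt0 R i.
apply: (@le_trans _ _ (\sum_(2 ^ i <= n < 2 ^ i.+1)
    (2 * 2 ^+ i) * (hazard i ^+ 2 / 4 ^+ i))).
  apply: ler_sum_nat => n /andP[ni nS]; rewrite -ratio_sqr.
  apply: ler_pM; rewrite ?sqr_ge0//.
    by rewrite -exprS -natrX ler_nat ltnW.
  by apply: ratio_le => //; rewrite expn_gt0.
rewrite sumr_const_nat block_card -[_ *+ (2 ^ i)%N]mulr_natl natrX pow4.
rewrite le_eqVlt; apply/orP; left; apply/eqP.
by move: (hazard i) => h; field; rewrite gt_eqF.
Qed.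

Lemma block_ge i : hazard i.+1 ^+ 2 / 4 <= \sum_(2 ^ i <= n < 2 ^ i.+1) b n.
Proof.
have p0 := @pow2_gt0 R i.
apply: (@le_trans _ _ (\sum_(2 ^ i <= n < 2 ^ i.+1)
    2 ^+ i * (hazard i.+1 ^+ 2 / 4 ^+ i.+1))); last first.
  apply: ler_sum_nat => n /andP[ni nS]; rewrite -ratio_sqr.
  apply: ler_pM; rewrite ?sqr_ge0 ?(ltW p0)//.
    by rewrite -natrX ler_nat.
  by apply: ratio_le; [rewrite (leq_trans _ ni)// expn_gt0|exact: ltnW].
rewrite sumr_const_nat block_card -[_ *+ (2 ^ i)%N]mulr_natl natrX [4 ^+ i.+1]exprS pow4.
rewrite le_eqVlt; apply/orP; left; apply/eqP.
by move: (hazard i.+1) => h; field; rewrite gt_eqF.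
Qed.

(** Cauchy condensation: the ratio of the tail to the truncated mean is
    nonincreasing, and the factor [n] is constant up to two on a dyadic
    block. *)
Lemma summable_hazardP : bdd_series b <-> summable_hazard P phi.
Proof.
split=> [[C HC]|[C HC]].
  apply: (@bdd_series_shift _ _ 1); exists (4 * C) => N.
  suff h : \sum_(0 <= i < N) hazard i.+1 ^+ 2 / 4 <= \sum_(0 <= n < 2 ^ N) b n.
    have := le_trans h (HC _); rewrite -mulr_suml ler_pdivrMr// mulrC.
    by under [X in _ -> X <= _]eq_bigr do rewrite addn1.
  elim: N => [|N IH]; first by rewrite big_geq// sumr_ge0.
  by rewrite big_nat_recr//= sum_block lerD// block_ge.
exists (2 * C) => N.
have h : \sum_(0 <= n < 2 ^ N) b n <= 2 * \sum_(0 <= i < N) hazard i ^+ 2.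
  elim: N => [|N IH]; first by rewrite big_nat1 [X in _ <= _ * X]big_geq// /b mul0r mulr0.
  by rewrite sum_block big_nat_recr//= mulrDr lerD// block_le.
apply: (@le_trans _ _ (\sum_(0 <= n < 2 ^ N) b n)).
  rewrite [leRHS](@big_cat_nat _ _ _ N)//= ?lerDl ?sumr_ge0//.
  by rewrite ltnW// ltn_expl.
by apply: (le_trans h); rewrite ler_wpM2l.
Qed.

Lemma trmean_le_expR i : L (2 ^ i)%N <= expR (\sum_(0 <= j < i) hazard j).
Proof.
elim: i => [|i IH]; first by rewrite big_geq// expR0 (trmean1 H).
rewrite big_nat_recr//= expRD mulrC; apply: le_trans (L2S_le H i) _.
apply: ler_pM => //; first by rewrite addr_ge0// (hazard_ge0 H).
  exact: ltW (L2_gt0 H i).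
exact: expR_ge1Dx.
Qed.

(** A dyadic step multiplies the truncated mean by at most [1 + hazard], so
    that a bounded sum of hazards keeps it bounded. *)
Lemma hazard_diverges : (forall C, exists n, C < L n) -> ~ bdd_series hazard.
Proof.
move=> unb [C HC]; have [n] := unb (expR C); apply/negP; rewrite -leNgt.
have n2 : (n <= 2 ^ n)%N by rewrite ltnW// ltn_expl.
apply: le_trans (trmean_le P phi n2) _; apply: (le_trans (trmean_le_expR n)).
by rewrite ler_expR.
Qed.

End hazard_series.

(** * The interarrival process *)

Section process_sigma.
Context {X : Type} (D : set X) (Y : nat -> X -> nat) (J : set nat).
Local Notation S := (process_sigma D Y J).

Let sS : sigma_algebra D S := smallest_sigma_algebra _ _.

Lemma process_sigma0 : S set0. Proof. by have [] := sS. Qed.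

Lemma process_sigmaC A : S A -> S (D `\` A).
Proof. by have [_ + _] := sS; apply. Qed.

Lemma process_sigma_bigcup (A : nat -> set X) :
  (forall n, S (A n)) -> S (\bigcup_n A n).
Proof. by have [_ _ +] := sS; apply. Qed.

Lemma process_sigmaI A B : A `<=` D -> S A -> S B -> S (A `&` B).
Proof.
move=> AD sA sB.
have -> : A `&` B = D `\` \bigcup_n (if n is 0%N then D `\` A else D `\` B).
  apply/seteqP; split=> x.
    move=> [Ax Bx]; split; first exact: AD.
    by move=> [[|n] _ []].
  move=> [Dx no]; split; apply: contrapT => h; apply: no.
    by exists 0%N.
  by exists 1%N.
by apply: process_sigmaC; apply: process_sigma_bigcup => -[|n]; exact: process_sigmaC.
Qed.

Lemma process_sigma_eq j v : J j -> S (D `&` [set x | Y j x = v]).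
Proof.
move=> Jj; apply: sub_sigma_algebra; exists j => //; exists [set v] => //.
Qed.

(** Finitely many integer coordinates take countably many values, so that the
    event is a countable union of elementary ones. *)
Lemma process_sigma_determined (s : seq nat) (A : set X) :
  (forall j, j \in s -> J j) -> A `<=` D ->
  (forall x y, D x -> D y -> (forall j, j \in s -> Y j x = Y j y) -> A x -> A y) ->
  S A.
Proof.
move=> sJ AD det; pose it x := [seq Y j x | j <- s].
have -> : A = \bigcup_n [set x | A x /\ pickle (it x) = n].
  apply/seteqP; split=> [x Ax|x [n _ []]//]; by exists (pickle (it x)).
apply: process_sigma_bigcup => n.
case: (pselect (exists y, A y /\ pickle (it y) = n)) => [[y [Ay yn]]|no]; last first.
  rewrite (_ : [set x | _] = set0); first exact: process_sigma0.
  by apply/seteqP; split=> // x hx; apply: no; exists x.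
rewrite (_ : [set x | _] = [set x | D x /\ forall j, j \in s -> Y j x = Y j y]).
  elim: s sJ {det it yn} => [|j s IH] sJ.
    rewrite (_ : [set x | _] = D `\` set0).
      by apply: process_sigmaC; exact: process_sigma0.
    by rewrite setD0; apply/seteqP; split=> [x []//|x Dx]; split.
  rewrite (_ : [set x | _] = (D `&` [set x | Y j x = Y j y]) `&`
      [set x | D x /\ forall j, j \in s -> Y j x = Y j y]).
    apply: process_sigmaI; first by move=> x [].
      by apply: process_sigma_eq; apply: sJ; rewrite mem_head.
    by apply: IH => i si; apply: sJ; rewrite inE si orbT.
  apply/seteqP; split=> x.
    move=> [Dx e]; split; split=> //; first by apply: e; rewrite mem_head.
    by move=> i si; apply: e; rewrite inE si orbT.
  by move=> [[Dx ej] [_ e]]; split=> // i; rewrite inE => /orP[/eqP->//|/e].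
apply/seteqP; split=> x.
  move=> [Ax]; rewrite -yn => /(pcan_inj pickleK)/eq_in_map e.
  by split; [exact: AD|].
move=> [Dx e]; split; first by apply: (det y x (AD _ Ay) Dx _ Ay) => j /e.
by rewrite -yn; congr pickle; apply/eq_in_map.
Qed.

End process_sigma.

Section instance.
Context {R : realType} {d : measure_display} {X : measurableType d}.
Variables (m : {measure set X -> \bar R}) (T Tinv : X -> X) (Om : set X).
Hypotheses (mOm : measurable Om) (hT : invertible_mpt m T Tinv)
  (hc : conservative m T) (he : ergodic m T).
Hypotheses (Om0 : (0 < m Om)%E) (Omf : (m Om < +oo)%E).
Local Notation P := (cond_measure m mOm).
Local Notation phi := (return_time T Om).
Local Notation tau := (induced_map T Om).
Local Notation pr := (rprob P).
Let c := fine (m Om).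

Lemma mass_gt0 : 0 < c.
Proof. by rewrite /c fine_gt0// Om0 Omf. Qed.

Lemma massE : m Om = c%:E.
Proof. by rewrite /c fineK// ge0_fin_numE. Qed.

Lemma cond_measureE A : P A = (c^-1%:E * m (A `&` Om))%E.
Proof. by []. Qed.

Lemma cond_measureT : P setT = 1%E.
Proof.
by rewrite cond_measureE setTI massE -EFinM mulVf// gt_eqF// mass_gt0.
Qed.

Lemma cond_measure_setI A : P (A `&` Om) = P A.
Proof. by rewrite !cond_measureE -setIA setIid. Qed.

Lemma cond_measure_preserve A : measurable A -> P (tau @^-1` A) = P A.
Proof.
by move=> mA; rewrite !cond_measureE (induced_preserve mOm Om0 hT hc he).
Qed.

Lemma cond_measure_full A : measurable A -> {ae m, forall x, Om x -> A x} -> P A = 1%E.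
Proof.
move=> mA [N [mN N0 HN]].
rewrite cond_measureE (_ : m (A `&` Om) = m Om).
  by have := cond_measureT; rewrite cond_measureE setTI.
apply/eqP; rewrite eq_le measureIr//=.
apply: (@le_trans _ _ (m ((A `&` Om) `|` N))).
  apply: le_measure; rewrite ?inE//.
    by apply: measurableU => //; exact: measurableI.
  move=> x Ox; case: (pselect (A x)) => Ax; [by left|right].
  by apply: HN => /= h; exact: Ax (h Ox).
by rewrite measureU0//; exact: measurableI.
Qed.

Lemma cond_measure_core : P (core Om T Tinv) = 1%E.
Proof.
apply: cond_measure_full; first exact: (measurable_core mOm hT).
exact: (ae_core mOm Om0 hT hc he).
Qed.

Local Notation coef := (mixing_coef Om P (interarrival T Om)).

Lemma mixing_coef_ge0 n : (0 <= coef n)%E.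
Proof.
apply: ereal_sup_ubound; exists 1%N, Om, Om.
have sO J : process_sigma Om (interarrival T Om) J Om.
  have := process_sigmaC (@process_sigma0 _ Om (interarrival T Om) J).
  by rewrite setD0.
have PO : P Om = 1%E.
  by rewrite -[RHS]cond_measureT !cond_measureE setIid setTI.
split=> //; first by rewrite PO mule1 lte01.
by rewrite setIid PO/= mulr1 divr1 subrr normr0.
Qed.

Hypothesis hmix : continued_fraction_mixing Om P (interarrival T Om).

Lemma mixing_coef_fin n : (1 <= n)%N -> coef n \is a fin_num.
Proof.
move=> n1; have [fin dec _] := hmix.
rewrite ge0_fin_numE ?mixing_coef_ge0//; apply: le_lt_trans fin.
elim: n n1 => [//|[|n] IH] _ //.
exact: le_trans (dec n.+1 isT) (IH isT).
Qed.

(** Events of probability zero do not take part in the supremum; for them the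
    product rule is exact. *)
Lemma mixing_coef_bound k n A B : (1 <= k)%N -> (1 <= n)%N ->
  process_sigma Om (interarrival T Om) [set j | (1 <= j <= k)%N] A ->
  process_sigma Om (interarrival T Om) [set j | (k + n <= j)%N] B ->
  measurable A -> measurable B ->
  `|pr (A `&` B) - pr A * pr B| <= fine (coef n) * (pr A * pr B).
Proof.
move=> k1 n1 sA sB mA mB.
have PT := cond_measureT.
case: (ltP 0 (pr A * pr B)) => [pos|np]; last first.
  have z : pr A * pr B = 0.
    by apply/eqP; rewrite eq_le np mulr_ge0// pr_ge0.
  rewrite z mulr0 subr0 ger0_norm ?pr_ge0//.
  have mAB : measurable (A `&` B) by exact: measurableI.
  move/eqP: z; rewrite mulf_eq0 => /orP[/eqP <-|/eqP <-].
    exact: (pr_le PT mAB mA (@subIsetl _ _ _)).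
  exact: (pr_le PT mAB mB (@subIsetr _ _ _)).
rewrite -ler_pdivrMr//.
have -> : `|pr (A `&` B) - pr A * pr B| / (pr A * pr B) =
    `|pr (A `&` B) / (pr A * pr B) - 1|.
  move: pos; set q := pr A * pr B => pos.
  have {1}-> : pr (A `&` B) - q = (pr (A `&` B) / q - 1) * q.
    by rewrite mulrBl mul1r divfK// gt_eqF.
  by rewrite normrM (gtr0_norm pos) mulfK// gt_eqF.
rewrite -lee_fin fineK ?mixing_coef_fin//.
apply: ereal_sup_ubound; exists k, A, B; split=> //.
by rewrite (prE PT mA) (prE PT mB) -EFinM lte_fin.
Qed.

(** Skipping [g] coordinates means a difference of [g.+1] between the
    indices. *)
Lemma cond_mixing k l g A B : cylinder tau phi k A -> cylinder tau phi l B ->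
  measurable A -> measurable B ->
  `|pr (A `&` iter (k + g) tau @^-1` B) - pr A * pr B| <=
    fine (coef g.+1) * (pr A * pr B).
Proof.
move=> cA cB mA mB; have PT := cond_measureT.
have mt n : measurable (iter n tau @^-1` B).
  rewrite -[X in measurable X]setTI.
  exact: (measurable_fun_iter n (measurable_induced_map mOm hT)).
have prB n : pr (iter n tau @^-1` B) = pr B.
  elim: n => [//|n IH]; rewrite -IH /rprob -(cond_measure_preserve (mt n)).
  by congr (fine (P _)); apply/funext => x; rewrite /preimage/mkset -iterSr.
have co0 : 0 <= fine (coef g.+1) by rewrite fine_ge0// mixing_coef_ge0.
case: k cA => [|k] cA.
  case: (pselect (exists x, A x)) => [[x Ax]|no].
    have -> : A = setT by apply/seteqP; split=> // y _; exact: cA Ax.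
    by rewrite setTI prB (prT PT) mul1r subrr normr0 mulr_ge0// pr_ge0.
  have -> : A = set0 by apply/seteqP; split=> // x Ax; apply: no; exists x.
  by rewrite set0I pr0 mul0r subrr normr0 mulr0.
have prI C : pr (C `&` Om) = pr C by rewrite /rprob cond_measure_setI.
have := @mixing_coef_bound k.+1 g.+1 (A `&` Om)
  (iter (k.+1 + g) tau @^-1` B `&` Om) isT isT.
rewrite -setIACA setIid !prI prB; apply.
- apply: (@process_sigma_determined _ _ _ _ (iota 1 k.+1)).
  + by move=> j; rewrite mem_iota /=; lia.
  + by move=> x [].
  + move=> x y Ox Oy e [Ax _]; split=> //; apply: cA Ax => j jk.
    by apply: (e j.+1); rewrite mem_iota; lia.
- apply: (@process_sigma_determined _ _ _ _ (iota (k.+1 + g.+1) l)).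
  + by move=> j; rewrite mem_iota /=; lia.
  + by move=> x [].
  + move=> x y Ox Oy e [Bx _]; split=> //; apply: cB Bx => j jl.
    rewrite !crdD; have := e (k.+1 + g.+1 + j)%N.
    rewrite mem_iota /interarrival /proc.
    have -> : (k.+1 + g.+1 + j).-1 = (j + (k.+1 + g))%N by lia.
    by apply; lia.
- exact: measurableI.
- exact: measurableI.
Qed.

Hypothesis hsum : (\sum_(1 <= n <oo) coef n * (n%:R^-1)%:E < +oo)%E.

Theorem induced_psi_mixing : psi_mixing P tau phi (fun g => fine (coef g.+1)).
Proof.
have mtau := measurable_induced_map mOm hT.
have mphi := measurable_return_time mOm hT.
have [fin dec cv] := hmix.
have mc k A : cylinder tau phi k A -> measurable A.
  exact: measurable_cylinder.
split.
- exact: cond_measureT.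
- exact: mtau.
- exact: mphi.
- exact: cond_measure_preserve.
- apply: cond_measure_full.
    exact: (measurable_return_time_set mOm hT (fun n => (0 < n)%N)).
  have := ae_recurrent hT hc he mOm Om0; apply: filterS => x r _.
  by have [] := first_return_recurrent r.
- by move=> g; rewrite fine_ge0// mixing_coef_ge0.
- move=> g; apply: fine_le; rewrite ?mixing_coef_fin//.
  by elim: g => [//|g IH]; exact: le_trans (dec g.+1 isT) IH.
- move=> e e0; move/fine_cvgP : cv => [_] /cvgrPdist_le /(_ _ e0) [N _ HN].
  exists N; have := HN N.+1 (leqnSn N).
  by rewrite /= sub0r normrN; exact: le_trans (ler_norm _).
- pose u n : R := if n is 0%N then 0 else fine (coef n) / n%:R.
  have u0 n : 0 <= u n.
    by case: n => [//|n]; rewrite /u divr_ge0// fine_ge0// mixing_coef_ge0.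
  suff [C HC] : bdd_series u.
    exists C => N; apply: le_trans (HC (N + 1)%N).
    rewrite [leRHS](@big_cat_nat _ _ _ 1) ?leq_addl//= big_nat1 add0r.
    by rewrite sum_nat_shift; apply: ler_sum => i _; rewrite addn1.
  apply/(bdd_series_nneseries 1 u0); apply: le_lt_trans hsum.
  rewrite le_eqVlt; apply/orP; left; apply/eqP.
  apply: eq_eseriesr => n.
  case: n => [|n] _; first by rewrite /u invr0 mule0.
  by rewrite /u [LHS]EFinM fineK// mixing_coef_fin.
- move=> k l g A B cA cB; exact: (cond_mixing g cA cB (mc k A cA) (mc l B cB)).
Qed.

End instance.

(** * Visits and arrival times *)

Section visits.
Context {R : realType} {d : measure_display} {X : measurableType d}.
Variables (m : {measure set X -> \bar R}) (T Tinv : X -> X) (Om : set X).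
Hypothesis hT : invertible_mpt m T Tinv.
Local Notation phi := (return_time T Om).
Local Notation tau := (induced_map T Om).
Local Notation S := (birk T (\1_Om : X -> R)).

Let i0 (y : X) : 0 <= \1_Om y :> R. Proof. by rewrite indicE. Qed.

Let i01 y : 0 <= (\1_Om y : R) <= 1.
Proof. by rewrite indicE; case: (_ \in _); rewrite ?lexx ?ler01. Qed.

Lemma birk_indic_le n x : S n x <= n%:R.
Proof.
rewrite /birk; apply: (@le_trans _ _ (\sum_(0 <= k < n) 1)).
  by apply: ler_sum => k _; rewrite indicE; case: (_ \in _).
by rewrite sumr_const_nat subn0.
Qed.

Lemma birk_first_return x n : Om x -> first_return T Om x n -> S n x = 1.
Proof.
move=> Ox [n1 On nmin]; rewrite -(prednK n1) birkS indicE mem_set//.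
rewrite /birk big_nat_cond big1 ?addr0// => k /andP[/andP[_ kn] _].
rewrite indicE memNset// => Ok; apply: (nmin k.+1); last by rewrite iterSr.
by rewrite ltnS/= -(prednK n1) ltnS.
Qed.

Lemma iter_arrival k x : iter (arrival tau phi k x) T x = iter k tau x.
Proof.
elim: k => [|k IH]; first by rewrite /arrival big_geq.
by rewrite /arrival big_nat_recr//= addnC iterD -/(arrival tau phi k x) IH.
Qed.

Lemma birk_arrival k x : core Om T Tinv x -> S (arrival tau phi k x) x = k%:R.
Proof.
move=> cx; elim: k => [|k IH]; first by rewrite /arrival big_geq// birk0.
rewrite /arrival big_nat_recr//= birkD -/(arrival tau phi k x) IH iter_arrival.
have [Ox r _] := core_iter hT k cx.
by rewrite birk_first_return ?natr1//; exact: first_return_recurrent.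
Qed.

Lemma birk_le_arrival k n x : core Om T Tinv x ->
  (n <= arrival tau phi k x)%N -> S n x <= k%:R.
Proof. by move=> cx nk; rewrite -(birk_arrival k cx) birk_le. Qed.

Lemma birk_ge_arrival k n x : core Om T Tinv x ->
  (arrival tau phi k x <= n)%N -> k%:R <= S n x.
Proof. by move=> cx nk; rewrite -(birk_arrival k cx) birk_le. Qed.

(** Counts of visits are invariant up to a constant, so that their growth is
    a property of the whole orbit. *)
Lemma birk_step n x : `|S n (T x) - S n x| <= 1.
Proof.
have e : S n x + \1_Om (iter n T x) = \1_Om x + S n (T x).
  by rewrite -birkS birkSr.
have := i01 x.
have := i01 (iter n T x).
rewrite ler_norml => /andP[a1 a2] /andP[b1 b2].
by move: e; set p := S n x; set q := S n (T x) => e; apply/andP; split; lra.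
Qed.

Lemma birk_step_inv n x : `|birk Tinv (\1_Om : X -> R) n (T x) - birk Tinv \1_Om n x| <= 1.
Proof.
case: n => [|n]; first by rewrite !birk0 subrr normr0.
rewrite birkS (mpt_cancel hT) birkSr.
have := i01 (T x).
have := i01 (iter n Tinv x).
move=> /andP[a1 a2] /andP[b1 b2]; rewrite ler_norml.
by set p := birk _ _ _ _; apply/andP; split; lra.
Qed.

Lemma core_sym x : core Om T Tinv x <-> core Om Tinv T x.
Proof. by split=> -[? ? ?]; split. Qed.

Lemma arrival_reverse k x : core Om T Tinv x ->
  arrival (induced_map Tinv Om) (return_time Tinv Om) k (iter k tau x) =
  arrival tau phi k x.
Proof.
move=> cx; rewrite /arrival [RHS]big_nat_rev/= add0n.
by apply: eq_big_nat => j /andP[_ jk]; exact: (core_reversal hT cx jk).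
Qed.

End visits.

Section asymptotics.
Context {R : realType} {d : measure_display} {X : measurableType d}.
Variables (m : {measure set X -> \bar R}) (T Tinv : X -> X) (Om : set X).
Hypotheses (mOm : measurable Om) (hT : invertible_mpt m T Tinv)
  (hc : conservative m T) (he : ergodic m T).
Hypotheses (Om0 : (0 < m Om)%E) (Omf : (m Om < +oo)%E).
Local Notation P := (cond_measure m mOm).
Local Notation phi := (return_time T Om).
Local Notation psi := (return_time Tinv Om).
Local Notation tau := (induced_map T Om).
Local Notation sigma := (induced_map Tinv Om).
Local Notation pr := (rprob P).
Local Notation core := (core Om T Tinv).
Variable th : nat -> R.
Hypothesis H : psi_mixing P tau phi th.
Local Notation L := (trmean P phi).
Local Notation scale := (scale P phi).
Local Notation hazard := (hazard P phi).
Local Notation win := (win P phi).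
Let PT := pm_total H.

(** The order of magnitude of the number of visits before time [n]. *)
Definition rate (n : nat) : R := n%:R / L n.

Lemma trmean_gt0 n : (0 < n)%N -> 0 < L n.
Proof. by move=> n0; exact: lt_le_trans ltr01 (trmean_ge1 H n0). Qed.

Lemma rate_gt0 n : (0 < n)%N -> 0 < rate n.
Proof. by move=> n0; rewrite divr_gt0 ?ltr0n ?trmean_gt0. Qed.

Lemma rate_ge1 n : (0 < n)%N -> 1 <= rate n.
Proof.
by move=> n0; rewrite ler_pdivlMr ?trmean_gt0// mul1r (trmean_le_nat H).
Qed.

Lemma rate_le_nat n : rate n <= n%:R.
Proof.
case: n => [|n]; first by rewrite /rate mul0r.
by rewrite ler_pdivrMr ?trmean_gt0// ler_peMr// (trmean_ge1 H).
Qed.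

Lemma rate_pow2 i : rate (2 ^ i) = scale i.
Proof. by rewrite /rate natrX. Qed.

Lemma rate_large (C : R) : exists N, forall n, (N <= n)%N -> C <= rate n.
Proof.
have e0 : 0 < (`|C| + 1)^-1 by rewrite invr_gt0 ltr_wpDl.
have [N HN] := trmean_small H e0; exists N.+1 => n Nn.
have Ln : 0 < L n by apply: trmean_gt0; exact: leq_ltn_trans Nn.
have := HN n (ltnW Nn); rewrite mulrC ler_pdivlMr ?ltr_wpDl// => h.
rewrite ler_pdivlMr//; have := ler_norm C; nra.
Qed.

Lemma borel_cantelli (E : nat -> set X) : (forall i, measurable (E i)) ->
  bdd_series (fun i => pr (E i)) ->
  {ae m, forall x, Om x -> exists N, forall i, (N <= i)%N -> ~ E i x}.
Proof.
move=> mE bE.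
have mS : measurable (lim_sup_set E).
  by apply: bigcap_measurableType => n _; exact: bigcup_measurable.
have S0 : P (lim_sup_set E) = 0%E.
  apply: lim_sup_set_cvg0 => //.
  have /(bdd_series_nneseries 0) := bE; move=> /(_ (fun i => pr_ge0 _ _)).
  apply: le_lt_trans; rewrite le_eqVlt; apply/orP; left; apply/eqP.
  by apply: eq_eseriesr => i _; rewrite (prE PT).
exists (lim_sup_set E `&` Om); split; first exact: measurableI.
  move: S0; rewrite cond_measureE => /eqP; rewrite mule_eq0 => /orP[|/eqP//].
  by rewrite eqe invr_eq0 gt_eqF// mass_gt0.
move=> x nx; split; last by apply: contrapT => Ox; apply: nx => /Ox.
move=> N _; apply: contrapT => no; apply: nx => _; exists N => i Ni Ei.
by apply: no; exists i.
Qed.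

Lemma dyadic_bracket n : (0 < n)%N ->
  (2 ^ trunc_log 2 n <= n < 2 ^ (trunc_log 2 n).+1)%N.
Proof. by move=> n0; exact: trunc_log_bounds. Qed.

Lemma trmean_bracket n : (0 < n)%N ->
  L (2 ^ trunc_log 2 n)%N <= L n <=
    (1 + hazard (trunc_log 2 n)) * L (2 ^ trunc_log 2 n)%N.
Proof.
move=> n0; have /andP[ni nS] := dyadic_bracket n0.
rewrite (trmean_le P phi ni)/=; apply: le_trans (L2S_le H _).
by apply: trmean_le; exact: ltnW.
Qed.

(** The two directions of time share the law of the arrival times, which is
    all that the one-sided estimates use. *)
Section one_side.
Variables (S : nat -> X -> R) (F : nat -> X -> nat).
Hypothesis SF : forall k n x, core x -> (n <= F k x)%N -> S n x <= k%:R.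
Hypothesis FS : forall k n x, core x -> (F k x <= n)%N -> k%:R <= S n x.
Hypothesis mF : forall k (Q : set nat), measurable [set x | Q (F k x)].
Hypothesis FE : forall k (Q : set nat),
  pr [set x | Q (F k x)] = pr [set x | Q (arrival tau phi k x)].
Hypothesis mS : forall n, measurable_fun setT (S n).
Hypothesis hz : summable_hazard P phi.

(** If the arrival of index about [l.+1 / q.+1 * scale i] is not early, it
    comes after time [l / q.+1 * 2 ^ i], which bounds the visits up to then.
    The grid leaves countably many almost sure events. *)
Lemma ae_early : {ae m, forall x, Om x -> forall q l : nat, exists N,
  forall i, (N <= i)%N -> forall n, (n * q.+1 <= l * 2 ^ i)%N ->
    S n x * q.+1%:R <= l.+1%:R * scale i}.
Proof.
have A q l : {ae m, forall x, Om x -> exists N,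
    forall i, (N <= i)%N -> forall n, (n * q.+1 <= l * 2 ^ i)%N ->
    S n x * q.+1%:R <= l.+1%:R * scale i}.
  have q0 : 0 < q.+1%:R :> R by [].
  pose kap : R := l.+1%:R / q.+1%:R.
  have kap0 : 0 < kap by rewrite divr_gt0.
  have eps0 : 0 < q.+1%:R^-1 :> R by rewrite invr_gt0.
  have B := bdd_early H hz kap0 eps0.
  have C := @borel_cantelli (fun i => [set x | (F (win kap i) x)%:R <
    (kap - q.+1%:R^-1) * 2 ^+ i]) (fun i => mF _ (fun n => n%:R < _)).
  have {C B} : {ae m, forall x, Om x -> exists N, forall i, (N <= i)%N ->
      ~ ((F (win kap i) x)%:R < (kap - q.+1%:R^-1) * 2 ^+ i)}.
    apply: C; apply: bdd_series_le B => i.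
    by rewrite (FE (win kap i) (fun n => n%:R < (kap - q.+1%:R^-1) * 2 ^+ i)).
  have cr := ae_core mOm Om0 hT hc he.
  apply: filterS2 cr => x cx HN Ox; have [N {}HN] := HN Ox.
  exists N => i Ni n nl; have /negP := HN i Ni; rewrite -leNgt => h.
  have nF : (n <= F (win kap i) x)%N.
    rewrite -(ler_nat R); apply: le_trans h.
    have -> : kap - q.+1%:R^-1 = l%:R / q.+1%:R.
      by rewrite /kap -natr1 mulrDl mul1r addrK.
    by rewrite mulrAC ler_pdivlMr// -natrX -!natrM ler_nat.
  have := SF (cx Ox) nF; have := win_le H i (ltW kap0).
  move=> h1 h2; have := le_trans h2 h1.
  by rewrite /kap mulrAC ler_pdivlMr.
have {}A := ae_foralln (fun q => ae_foralln (fun l => A q l)).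
by apply: filterS A => x Hx Ox q l; exact: Hx.
Qed.

Lemma uniform_bound (Q : nat -> nat -> Prop) M :
  (forall l, exists N, forall i, (N <= i)%N -> Q l i) ->
  exists N, forall i l, (N <= i)%N -> (l <= M)%N -> Q l i.
Proof.
move=> QN; elim: M => [|M [N HN]].
  by have [N HN] := QN 0%N; exists N => i [|l]// /HN.
have [N' HN'] := QN M.+1; exists (maxn N N') => i l.
rewrite geq_max => /andP[Ni N'i]; rewrite leq_eqVlt => /orP[/eqP->|]; first exact: HN'.
exact: HN.
Qed.

(** Time [n] is compared with the dyadic scale below it and the next point of
    the grid; the relative errors are the width of the grid and the hazard. *)
Theorem ae_upper : {ae m, forall x, Om x -> forall e : R, 0 < e ->
  exists N, forall n, (N <= n)%N -> S n x <= (1 + e) * rate n}.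
Proof.
apply: filterS ae_early => x Hx Ox e e0.
(* the width [1 / q.+1] of the grid is at most [e / 8] *)
pose q := Num.truncn (8 / e); have qe : 8 <= e * q.+1%:R.
  by rewrite mulrC -ler_pdivrMr// ltW// truncnS_gt.
have [N1 HN1] := uniform_bound (q.+1 * 2).+1 (Hx Ox q).
have e1 : 0 < Num.min (e / 4) 1 by rewrite lt_min divr_gt0//=.
have e2 : 0 < (Num.min (e / 4) 1) ^+ 2 by rewrite exprn_gt0.
have [N2 HN2] := bdd_series_small (fun i => sqr_ge0 (hazard i)) hz e2.
exists (2 ^ maxn N1 N2)%N => n Nn.
have n0 : (0 < n)%N by apply: leq_trans Nn; rewrite expn_gt0.
set i := trunc_log 2 n; have /andP[ni nS] := dyadic_bracket n0.
rewrite -/i in ni nS.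
have Ni : (maxn N1 N2 <= i)%N.
  by have := leq_ltn_trans Nn nS; rewrite ltn_exp2l.
move: Ni; rewrite geq_max => /andP[N1i N2i].
pose l := ((q.+1 * n) %/ 2 ^ i).+1.
have lb : (l <= (q.+1 * 2).+1)%N.
  by apply: leqW; rewrite /l ltn_divLR ?expn_gt0// -mulnA -expnS ltn_pmul2l.
have nl : (n * q.+1 <= l * 2 ^ i)%N by rewrite mulnC ltnW// ltn_ceil// expn_gt0.
have := HN1 i l N1i lb n nl.
have hi : hazard i <= Num.min (e / 4) 1.
  by have := HN2 i N2i; rewrite ler_pXn2r ?nnegrE ?(hazard_ge0 H) ?(ltW e1).
have {}hi : hazard i <= e / 4 /\ hazard i <= 1.
  by move: hi; rewrite le_min => /andP[].
have ln : l%:R * 2 ^+ i <= q.+1%:R * n%:R + 2 ^+ i :> R.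
  by rewrite -natrX -!natrM -natrD ler_nat /l mulSn addnC leq_add2r leq_divM.
have /andP[L1 L2] := trmean_bracket n0; rewrite -/i in L1 L2.
have Ls := scale_mean H i.
have a0 := scale_gt0 H i.
have Li0 := L2_gt0 H i; have Ln0 := trmean_gt0 n0.
have rn : rate n * L n = n%:R by rewrite divfK// gt_eqF.
have r0 := rate_gt0 n0.
have n2 : 2 ^+ i <= n%:R :> R by rewrite -natrX ler_nat.
have h0 := hazard_ge0 H i.
rewrite -[l.+1%:R]natr1 => main.
have q0 : 0 < q.+1%:R :> R by [].
rewrite -(ler_pM2r q0) -(ler_pM2r Li0).
apply: (@le_trans _ _ ((l%:R + 1) * scale i * L (2 ^ i)%N)).
  by rewrite ler_wpM2r// ltW.
rewrite -mulrA Ls.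
apply: (@le_trans _ _ (q.+1%:R * n%:R + 2 * n%:R)).
  by rewrite mulrDl mul1r; lra.
rewrite -rn.
set Q := q.+1%:R in q0 qe *; set r := rate n in r0 *.
have LL : L n <= (1 + e / 4) * L (2 ^ i)%N.
  apply: (le_trans L2); rewrite ler_wpM2r ?(ltW Li0)//; lra.
apply: (@le_trans _ _ ((Q + 2) * r * ((1 + hazard i) * L (2 ^ i)%N))).
  rewrite -mulrDl -mulrA ler_wpM2l//; first lra.
  by rewrite ler_wpM2l// ltW.
have -> : (1 + e) * r * Q * L (2 ^ i)%N = (1 + e) * Q * (r * L (2 ^ i)%N) by ring.
have -> : (Q + 2) * r * ((1 + hazard i) * L (2 ^ i)%N) =
  (Q + 2) * (1 + hazard i) * (r * L (2 ^ i)%N) by ring.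
rewrite ler_wpM2r//; first by rewrite mulr_ge0// ltW.
case: hi => hi1 hi2.
have : hazard i * Q <= e / 4 * Q by rewrite ler_wpM2r// ltW.
by lra.
Qed.

Lemma late_miss q l i n x : core x ->
  ~ ((l.+1%:R / q.+1%:R + q.+1%:R^-1) * 2 ^+ i <
     (F (win (l.+1%:R / q.+1%:R) i) x)%:R :> R) ->
  (l.+2 * 2 ^ i <= n * q.+1)%N ->
  l.+1%:R * scale i - q.+1%:R <= S n x * q.+1%:R.
Proof.
move=> cx /negP; rewrite -leNgt => h nl.
have q0 : 0 < q.+1%:R :> R by [].
set kap := l.+1%:R / q.+1%:R in h *.
have Fn : (F (win kap i) x <= n)%N.
  rewrite -(ler_nat R); apply: (le_trans h).
  have -> : kap + q.+1%:R^-1 = l.+2%:R / q.+1%:R.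
    by rewrite /kap -[l.+2%:R]natr1 mulrDl mul1r.
  rewrite mulrAC ler_pdivrMr//.
  by rewrite -natrX -!natrM ler_nat.
have := FS cx Fn; have := win_gt P phi kap i.
move=> h1 h2; have := lt_le_trans h1 h2 => h3.
have h4 : (kap * scale i - 1) * q.+1%:R <= S n x * q.+1%:R.
  by rewrite ler_wpM2r// ltW.
apply: le_trans h4; rewrite mulrBl mul1r lerD2r /kap.
by rewrite le_eqVlt; apply/orP; left; apply/eqP; field; rewrite gt_eqF.
Qed.

(** At time [n], take the dyadic scale below [n] and the largest grid point
    that a sum which is not late has reached by then. *)
Lemma late_miss_rate (e : R) : 0 < e -> exists q M : nat, exists N, forall n, (N <= n)%N ->
  exists2 l, (l <= M)%N & let i := trunc_log 2 n in
  (0 < n)%N /\ forall (x : X) (s : R),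
  ((l.+2 * 2 ^ i <= n * q.+1)%N -> l.+1%:R * scale i - q.+1%:R <= s * q.+1%:R) ->
  (1 - e) * rate n <= s.
Proof.
(* the width [1 / q.+1] of the grid is at most [e / 8] *)
move=> e0; pose q := (Num.truncn (8 / e)).+1; have qe : 8 <= e * q.+1%:R.
  rewrite mulrC -ler_pdivrMr//; apply: (le_trans (ltW (truncnS_gt _))).
  by rewrite ler_nat.
have [N HN] := rate_large (2 / e).
exists q, (q.+1 * 2)%N, (maxn N 1) => n; rewrite geq_max => /andP[Nn n0].
have {HN}rn := HN n Nn.
set i := trunc_log 2 n; have /andP[ni nS] := dyadic_bracket n0.
rewrite -/i in ni nS.
pose l := ((q.+1 * n) %/ 2 ^ i).-2.
have p0 : (0 < 2 ^ i)%N by rewrite expn_gt0.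
have l2 : ((q.+1 * n) %/ 2 ^ i = l.+2)%N.
  have : (2 <= (q.+1 * n) %/ 2 ^ i)%N by rewrite leq_divRL// leq_mul.
  by rewrite /l; case: (_ %/ _)%N => [|[|]].
exists l.
  have : (l.+2 <= q.+1 * 2)%N.
    by rewrite -l2 ltnW// ltn_divLR// -mulnA -expnS ltn_pmul2l.
  by move=> h; apply: leq_trans h; rewrite -addn2 leq_addr.
split=> // x s; rewrite -l2 [(n * _)%N]mulnC leq_divM => /(_ isT) main.
have lo : q.+1%:R * n%:R <= (l%:R + 3) * 2 ^+ i :> R.
  rewrite -natrX -natrM -[3]/(3%:R) -natrD -natrM ler_nat.
  by rewrite addn3 -l2 ltnW// ltn_ceil.
move: main; rewrite -[l.+1%:R]natr1 => main.
have /andP[L1 L2] := trmean_bracket n0; rewrite -/i in L1 L2.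
have Ls := scale_mean H i.
have a0 := scale_gt0 H i.
have Li0 := L2_gt0 H i; have Ln0 := trmean_gt0 n0.
have rL : rate n * L n = n%:R by rewrite divfK// gt_eqF.
have r0 := rate_gt0 n0.
have n2 : 2 ^+ i <= n%:R :> R by rewrite -natrX ler_nat.
have q0 : 0 < q.+1%:R :> R by [].
set Q := q.+1%:R in q0 qe main lo *; set r := rate n in r0 rL rn *.
have er : 2 <= r * e by rewrite -ler_pdivrMr.
have h1 : Q * r <= (l%:R + 3) * scale i.
  rewrite -(ler_pM2r Li0) -[leRHS]mulrA Ls; apply: le_trans lo.
  by rewrite -rL -[leLHS]mulrA ler_wpM2l ?(ltW q0)// ler_wpM2l// ltW.
have h2 : scale i <= 2 * r.
  rewrite -(ler_pM2r Li0) Ls; apply: (le_trans n2); rewrite -rL.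
  rewrite (_ : 2 * r * L (2 ^ i)%N = r * (2 * L (2 ^ i)%N)); last by ring.
  rewrite ler_wpM2l ?(ltW r0)//; apply: (le_trans L2).
  by rewrite ler_wpM2r ?(ltW Li0)//; have := hazard_le1 H i; lra.
rewrite -(ler_pM2r q0).
have h3 : 8 * r <= e * Q * r by rewrite ler_wpM2r// ltW.
have h4 : 2 * Q <= r * e * Q by rewrite ler_wpM2r// ltW.
move: main h1 h2; move: (scale i) => a main h1 h2; lra.
Qed.

(** A window is late with small probability only, and [late_miss_rate] leaves
    finitely many grid points to consider. *)
Theorem pr_lower (e e' : R) : 0 < e -> 0 < e' ->
  exists N, forall n, (N <= n)%N ->
    pr [set x | (S n x < (1 - e) * rate n)%R] <= e'.
Proof.
move=> e0 e'0; have [q [M [N HN]]] := late_miss_rate e0.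
have lv l : exists N, forall i, (N <= i)%N ->
    pr (late P tau phi (l.+1%:R / q.+1%:R) q.+1%:R^-1 i) <= e'.
  by apply: (late_vanish H hz) => //; rewrite ?divr_gt0 ?invr_gt0.
have [N' HN'] := uniform_bound M lv.
exists (maxn N (2 ^ N')) => n; rewrite geq_max => /andP[Nn N'n].
have [l lM [n0 main]] := HN n Nn.
have /andP[ni nS] := dyadic_bracket n0.
set i := trunc_log 2 n in main ni nS.
have N'i : (N' <= i)%N by have := leq_ltn_trans N'n nS; rewrite ltn_exp2l.
set kap : R := l.+1%:R / q.+1%:R; set eps : R := q.+1%:R^-1.
apply: le_trans (HN' i l N'i lM).
rewrite /late -(FE (win kap i) (fun n => (kap + eps) * 2 ^+ i < n%:R)).
have mlt : measurable [set x | S n x < (1 - e) * rate n].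
  exact: measurable_sublevel.
have mlate := mF (win kap i) (fun n => (kap + eps) * 2 ^+ i < n%:R).
have mc := measurable_core mOm hT.
have -> : pr [set x | S n x < (1 - e) * rate n] =
    pr ([set x | S n x < (1 - e) * rate n] `&` core).
  apply: (pr_eq_ae H mc (cond_measure_core mOm hT hc he Om0 Omf)) => //.
    exact: measurableI.
  by move=> x cx; split=> [?|[]].
apply: (pr_le PT) => //; first exact: measurableI.
move=> x [/= lt cx]; apply: contrapT => nl; move: lt; apply/negP; rewrite -leNgt.
by apply: (main x) => h; exact: late_miss nl h.
Qed.

End one_side.

Hypothesis hz : summable_hazard P phi.
Local Notation S1 := (birk T (\1_Om : X -> R)).
Local Notation S2 := (birk Tinv (\1_Om : X -> R)).
Local Notation bwd := (arrival sigma psi).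
Let hT' := invertible_sym hT.

Lemma measurable_bwd k (Q : set nat) : measurable [set x | Q (bwd k x)].
Proof.
apply: (measurable_cylinder (tau := sigma) (phi := psi) (k := k)).
- exact: (measurable_induced_map mOm hT').
- exact: (measurable_return_time mOm hT').
- exact: (@cyl_sum _ _ sigma psi id Q k).
Qed.

(** A shift by [k] turns backward arrival times into forward ones. *)
Lemma pr_bwd k (Q : set nat) :
  pr [set x | Q (bwd k x)] = pr [set x | Q (arrival tau phi k x)].
Proof.
have mQ := measurable_bwd k Q.
rewrite -(pr_preim H k mQ).
apply: (pr_eq_ae H (measurable_core mOm hT) (cond_measure_core mOm hT hc he Om0 Omf)).
- exact: (measurable_preim H).
- exact: (measurable_arrival H).
- by move=> x cx; rewrite /preimage/= (arrival_reverse hT k cx).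
Qed.

Let mS1 n : measurable_fun setT (S1 n).
Proof. by apply: measurable_birk; [exact: mpt_measurable hT|exact: measurable_indic]. Qed.
Let mS2 n : measurable_fun setT (S2 n).
Proof. by apply: measurable_birk; [exact: mpt_measurable hT'|exact: measurable_indic]. Qed.

Let FS1 k n x (cx : core x) := @birk_ge_arrival _ _ _ m T Tinv Om hT k n x cx.
Let SF1 k n x (cx : core x) := @birk_le_arrival _ _ _ m T Tinv Om hT k n x cx.
Let FS2 k n x (cx : core x) :=
  @birk_ge_arrival _ _ _ m Tinv T Om hT' k n x ((core_sym T Tinv Om x).1 cx).
Let SF2 k n x (cx : core x) :=
  @birk_le_arrival _ _ _ m Tinv T Om hT' k n x ((core_sym T Tinv Om x).1 cx).

Theorem ae_upper1 : {ae m, forall x, Om x -> forall e : R, 0 < e ->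
  exists N, forall n, (N <= n)%N -> S1 n x <= (1 + e) * rate n}.
Proof.
exact: (@ae_upper S1 (arrival tau phi) SF1
  (fun k Q => measurable_arrival H Q k) (fun _ _ => erefl) hz).
Qed.

Theorem ae_upper2 : {ae m, forall x, Om x -> forall e : R, 0 < e ->
  exists N, forall n, (N <= n)%N -> S2 n x <= (1 + e) * rate n}.
Proof. exact: (@ae_upper S2 bwd SF2 measurable_bwd pr_bwd hz). Qed.

Theorem pr_lower1 (e e' : R) : 0 < e -> 0 < e' -> exists N, forall n, (N <= n)%N ->
    pr [set x | S1 n x < (1 - e) * rate n] <= e'.
Proof.
exact: (@pr_lower S1 (arrival tau phi) FS1
  (fun k Q => measurable_arrival H Q k) (fun _ _ => erefl) mS1 hz).
Qed.

Theorem pr_lower2 (e e' : R) : 0 < e -> 0 < e' -> exists N, forall n, (N <= n)%N ->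
    pr [set x | S2 n x < (1 - e) * rate n] <= e'.
Proof. exact: (@pr_lower S2 bwd FS2 measurable_bwd pr_bwd mS2 hz). Qed.

(** After a shift, late arrivals in both directions are late arrivals in two
    adjacent windows, which [bdd_late_twice] excludes at all but finitely
    many scales. *)
Theorem ae_one_full : {ae m, forall x, Om x -> forall e : R, 0 < e ->
  exists N, forall n, (N <= n)%N ->
    (1 - e) * rate n <= S1 n x \/ (1 - e) * rate n <= S2 n x}.
Proof.
pose lt q l (F : nat -> X -> nat) i := [set x |
  ((l.+1%:R / q.+1%:R + q.+1%:R^-1) * 2 ^+ i < (F (win (l.+1%:R / q.+1%:R) i) x)%:R :> R)].
have A q l : {ae m, forall x, Om x -> exists N, forall i, (N <= i)%N ->
    ~ (lt q l (arrival tau phi) i `&` lt q l bwd i) x}.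
  have kap0 : 0 < l.+1%:R / q.+1%:R :> R by rewrite divr_gt0.
  have eps0 : 0 < q.+1%:R^-1 :> R by rewrite invr_gt0.
  have B := bdd_late_twice H hz kap0 eps0.
  pose Q i (n : nat) := (l.+1%:R / q.+1%:R + q.+1%:R^-1) * 2 ^+ i < n%:R :> R.
  have m1 i : measurable (lt q l (arrival tau phi) i).
    exact: (measurable_arrival H (Q i)).
  have m2 i : measurable (lt q l bwd i) by exact: (measurable_bwd _ (Q i)).
  apply: borel_cantelli => [i|]; first exact: measurableI.
  apply: bdd_series_le B => i; set k := win _ i.
  have m12 : measurable (lt q l (arrival tau phi) i `&` lt q l bwd i).
    exact: measurableI.
  rewrite -(pr_preim H k m12) le_eqVlt; apply/orP; left; apply/eqP.
  have mL := measurable_cyl H (@cyl_late _ _ _ P tau phi (l.+1%:R / q.+1%:R) q.+1%:R^-1 i).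
  apply: (pr_eq_ae H (measurable_core mOm hT) (cond_measure_core mOm hT hc he Om0 Omf)).
  - exact: (measurable_preim H).
  - by apply: measurableI => //; exact: (measurable_preim H).
  - move=> x cx; rewrite /preimage/= /lt/= (arrival_reverse hT k cx) /late/=.
    by split=> -[? ?]; split.
have cr := ae_core mOm Om0 hT hc he.
have {}A := ae_foralln (fun q => ae_foralln (fun l => A q l)).
apply: filterS2 cr A => x cx Hx Ox e e0.
have [q [M [N HN]]] := late_miss_rate e0.
have Hx' l := Hx q l Ox.
have [N' HN'] := uniform_bound M Hx'.
exists (maxn N (2 ^ N')) => n; rewrite geq_max => /andP[Nn N'n].
have [l lM [n0 main]] := HN n Nn.
have /andP[ni nS] := dyadic_bracket n0.
set i := trunc_log 2 n in main ni nS.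
have N'i : (N' <= i)%N by have := leq_ltn_trans N'n nS; rewrite ltn_exp2l.
have := HN' i l N'i lM; rewrite /setI/= => /not_andP[nl|nl]; [left|right].
- by apply: (main x) => h; exact: (late_miss FS1 (cx Ox) nl h).
- by apply: (main x) => h; exact: (late_miss FS2 (cx Ox) nl h).
Qed.

End asymptotics.

(** * Stalls, and the necessity of the series *)

Section spread.
Context {R : realType} {d : measure_display} {X : measurableType d}.
Variables (m : {measure set X -> \bar R}) (T Tinv : X -> X) (Om : set X).
Hypotheses (mOm : measurable Om) (hT : invertible_mpt m T Tinv)
  (hc : conservative m T) (he : ergodic m T) (Om0 : (0 < m Om)%E).

(** Almost every orbit meets [Om], so that a backward invariant property only
    has to be checked there. *)
Lemma ae_spread (Q : X -> Prop) : (forall x, Q (T x) -> Q x) ->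
  {ae m, forall x, Om x -> Q x} -> {ae m, forall x, Q x}.
Proof.
move=> QT QO; have r := ae_recurrent hT hc he mOm Om0.
have A := ae_foralln (fun n => ae_iter hT n QO).
apply: filterS2 r A => x rx Ax; have [n _ On] := rx 0%N.
have : Q (iter n T x) by exact: Ax.
by elim: n {On} => [//|n IH]; rewrite iterS => /QT.
Qed.

End spread.

Section conditions.
Context {R : realType} {d : measure_display} {X : measurableType d}.
Variables (m : {measure set X -> \bar R}) (T Tinv : X -> X) (Om : set X).
Hypotheses (mOm : measurable Om) (hT : invertible_mpt m T Tinv)
  (hc : conservative m T) (he : ergodic m T).
Hypotheses (Om0 : (0 < m Om)%E) (Omf : (m Om < +oo)%E).
Local Notation P := (cond_measure m mOm).
Local Notation phi := (return_time T Om).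
Local Notation psi := (return_time Tinv Om).
Local Notation tau := (induced_map T Om).
Local Notation sigma := (induced_map Tinv Om).
Local Notation pr := (rprob P).
Local Notation core := (core Om T Tinv).
Variable th : nat -> R.
Hypothesis H : psi_mixing P tau phi th.
Local Notation L := (trmean P phi).
Local Notation scale := (scale P phi).
Local Notation hazard := (hazard P phi).
Local Notation win := (win P phi).
Local Notation rate := (@rate _ _ _ m T Om mOm).
Local Notation S1 := (birk T (\1_Om : X -> R)).
Local Notation S2 := (birk Tinv (\1_Om : X -> R)).
Let PT := pm_total H.
Let hT' := invertible_sym hT.

Lemma truncated_meanE n : truncated_mean m T mOm n%:R = L n.
Proof.
rewrite /truncated_mean.
have mA s : measurable [set x | (s < phi x)%N].
  exact: (measurable_return_time_set mOm hT (fun n => (s < n)%N)).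
have E x : (Num.min (phi x)%:R n%:R)%:E =
    (\sum_(0 <= s < n) (\1_[set x | (s < phi x)%N] x)%:E)%E :> \bar R.
  rewrite sumEFin; congr _%:E.
  transitivity ((trunc 0 n (phi x))%:R : R).
    by rewrite truncE// minn0 subn0 natr_min.
  rewrite /trunc natr_sum; apply: eq_bigr => s _.
  by rewrite indicE; congr (nat_of_bool _)%:R; apply/idP/idP; rewrite ?inE.
under eq_integral do rewrite E.
rewrite ge0_integral_sum//; last first.
  by move=> s; apply/measurable_EFinP; exact: measurable_indic.
under eq_bigr do rewrite integral_indic// cond_measure_setI.
under eq_bigr do rewrite (prE PT)//.
by rewrite sumEFin.
Qed.

Lemma tailE n : (1 <= n)%N ->
  fine (P (Om `&` [set x | (n <= phi x)%N])) = tail P phi n.-1.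
Proof. by case: n => [//|n] _; rewrite setIC cond_measure_setI. Qed.

Lemma return_time_hazardP :
  (\sum_(1 <= n <oo) (n%:R * (fine (P (Om `&` [set x | (n <= phi x)%N])) /
     truncated_mean m T mOm n%:R) ^+ 2)%:E < +oo)%E <-> summable_hazard P phi.
Proof.
rewrite -(summable_hazardP H).
rewrite (bdd_series_nneseries 1); last by move=> n; rewrite mulr_ge0// sqr_ge0.
suff -> : (\sum_(1 <= n <oo) (n%:R * (fine (P (Om `&` [set x | (n <= phi x)%N])) /
     truncated_mean m T mOm n%:R) ^+ 2)%:E =
   \sum_(1 <= n <oo) (n%:R * (tail P phi n.-1 / L n) ^+ 2)%:E)%E by [].
apply: eq_eseriesr => n _; case: n => [|n]; first by rewrite !mul0r.
by rewrite tailE// truncated_meanE.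
Qed.

(** By Kac's formula, bounded truncated means would bound the total mass. *)
Lemma unbounded_trmean : m setT = +oo%E -> forall C, exists n, C < L n.
Proof.
move=> mX C; apply: contrapT => no.
have bd n : L n <= C by rewrite leNgt; apply/negP => ?; apply: no; exists n.
have := kac_le mOm Om0 hT hc he; rewrite mX; apply/negP; rewrite -ltNge.
have mA s : measurable [set x | (s < phi x)%N].
  exact: (measurable_return_time_set mOm hT (fun n => (s < n)%N)).
have c0 := mass_gt0 Om0 Omf; set c := fine (m Om) in c0.
have E s : m (Om `&` [set x | (s < phi x)%N]) = (c * tail P phi s)%:E.
  rewrite EFinM -(prE PT (mA s)) cond_measureE muleA -EFinM divff ?gt_eqF//.
  by rewrite mul1e setIC.
have S : bdd_series (fun s => c * tail P phi s).
  by apply: bdd_seriesZ; [exact: ltW|exists C => n; exact: bd].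
have /(bdd_series_nneseries 0) := S.
move=> /(_ (fun s => mulr_ge0 (ltW c0) (tail_ge0 _ _ _))).
by apply: le_lt_trans; rewrite le_eqVlt; apply/orP; left; apply/eqP;
  apply: eq_eseriesr => s _.
Qed.

(** The upper limit of the events has probability at least [del], hence meets
    every conull set. *)
Lemma infinitely_often_witness (E : nat -> set X) (del : R) (Q : X -> Prop) :
  (forall i, measurable (E i)) -> 0 < del ->
  (forall k, del <= pr (\bigcup_(i in [set i | (k <= i)%N]) E i)) ->
  {ae m, forall x, Q x} ->
  exists x, [/\ core x, Q x & forall k, exists2 i, (k <= i)%N & E i x].
Proof.
move=> mE del0 lo QO.
have mU k : measurable (\bigcup_(i in [set i | (k <= i)%N]) E i).
  exact: bigcup_measurable.
have mS : measurable (lim_sup_set E) by exact: bigcap_measurableType.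
have PS : (del%:E <= P (lim_sup_set E))%E.
  have fin : (P (\bigcup_(k in [set k | (0 <= k)%N]) E k) < +oo)%E.
    by rewrite (prE PT (mU 0%N)) ltry.
  have cv := lim_sup_set_cvg P E mE fin.
  have <- := cvg_lim (@ereal_hausdorff R) cv.
  apply: lime_ge; first by apply/cvg_ex; eexists; exact: cv.
  by apply: nearW => k; rewrite (prE PT (mU k)) lee_fin.
apply: contrapT => no.
have [N [mN N0 HN]] : {ae m, forall x, ~ (lim_sup_set E `&` Om) x}.
  have cr := ae_core mOm Om0 hT hc he.
  apply: filterS2 cr QO => x cx Qx [lx Ox]; apply: no; exists x; split=> //.
    exact: cx.
  by move=> k; have [i ki Ei] := lx k I; exists i.
move: PS; apply/negP; rewrite -ltNge cond_measureE.
have Z : m (lim_sup_set E `&` Om) = 0%E.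
  apply: (subset_measure0 _ mN _ N0); first exact: measurableI.
  by move=> x lx; apply: HN => /= h; exact: h lx.
by rewrite Z mule0 lte_fin.
Qed.

Let mS1 n : measurable_fun setT (S1 n).
Proof. by apply: measurable_birk; [exact: mpt_measurable hT|exact: measurable_indic]. Qed.
Let mS2 n : measurable_fun setT (S2 n).
Proof. by apply: measurable_birk; [exact: mpt_measurable hT'|exact: measurable_indic]. Qed.

Lemma arrival_ge_term (Y : X -> X) (f : X -> nat) j k x : (j < k)%N ->
  (proc Y f j x <= arrival Y f k x)%N.
Proof.
move=> jk; rewrite /arrival (bigD1_seq j) ?mem_index_iota ?iota_uniq//=.
exact: leq_addr.
Qed.

(** When the mean return time is infinite, a single excursion is now and then
    longer than everything before it. Otherwise the visits would dominate a
    multiple of [scale] up to a constant; this is an invariant property, so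
    that it would hold almost everywhere, against [forward_bursts]. *)
Theorem ae_stalls : hazard_small P phi -> m setT = +oo%E ->
  {ae m, forall x, forall e : R, 0 < e -> forall N, exists2 n,
    (N <= n)%N & S1 n x <= e * rate n}.
Proof.
move=> hs mX.
have nS := hazard_diverges H (unbounded_trmean mX).
have A j : {ae m, forall x, forall N, exists2 n, (N <= n)%N &
    S1 n x <= j.+1%:R^-1 * rate n}.
  set c : R := j.+1%:R^-1; have c0 : 0 < c by rewrite invr_gt0.
  have c20 : 0 < c / 2 by rewrite divr_gt0.
  have [mV [V0|V0]] := @tame_dichotomy _ _ _ m T he (fun i => S1 (2 ^ i))
    (fun i => c * scale i) 1 (fun i => mS1 _) (fun i x => birk_step T Om (2 ^ i) x).
    exists [set x | exists D, forall i, c * scale i <= S1 (2 ^ i) x + D].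
    split=> //; move=> x nx; apply: contrapT => nV; apply: nx => N.
    apply: contrapT => no; apply: nV; exists (c * scale N) => i.
    case: (leqP N i) => Ni; last first.
      have : c * scale i <= c * scale N by rewrite ler_wpM2l ?(ltW c0)// (scale_le H)// ltnW.
      have : 0 <= S1 (2 ^ i) x by apply: birk_ge0 => y; rewrite indicE.
      by move=> ? ?; lra.
    have : c * scale i < S1 (2 ^ i) x.
      rewrite ltNge; apply/negP => h; apply: no; exists (2 ^ i)%N.
        by apply: (leq_trans Ni); rewrite ltnW// ltn_expl.
      by rewrite rate_pow2.
    have : 0 < c * scale N by rewrite mulr_gt0// (scale_gt0 H).
    by move=> ? ?; lra.
  exfalso.
  have [del del0 lo] := forward_bursts H c20 hs nS.
  have mE i : measurable (hit tau phi (2 ^ i).-1 0 (win (c / 2) i)).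
    exact: (measurable_cyl H (@cyl_hit _ _ _ _ _ _ _)).
  have VO : {ae m, forall x, exists D, forall i, c * scale i <= S1 (2 ^ i) x + D}.
    by exists (~` [set x | exists D, forall i, c * scale i <= S1 (2 ^ i) x + D]);
      split=> //; exact: measurableC.
  have [x [cx [D HD] io]] := infinitely_often_witness mE del0 lo VO.
  have [N HN] := scale_large H ((D + 1) / (c / 2)).
  have [i Ni [k kw kh]] := io N.
  have := HN i Ni; rewrite ler_pdivrMr// => h1; have h2 := HD i.
  have h3 : (2 ^ i <= arrival tau phi (win (c / 2) i) x)%N.
    have kw' : (k < win (c / 2) i)%N by case/andP: kw.
    apply: leq_trans (arrival_ge_term tau phi x kw').
    by move: kh; rewrite -ltnS prednK ?expn_gt0.
  have h4 := birk_le_arrival hT cx h3.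
  have h5 := win_le H i (ltW c20).
  move: h1 h2 h4 h5; move: (S1 _ _) (scale i) ((win _ _)%:R) => s a w; lra.
have {}A := ae_foralln A.
apply: filterS A => x Hx e e0 N.
have [n Nn hn] := Hx (Num.truncn e^-1) N.
exists n => //; apply: (le_trans hn); rewrite ler_wpM2r//.
  by rewrite divr_ge0// sumr_ge0// => s _; exact: tail_ge0.
rewrite -[leRHS]invrK lef_pV2 ?posrE ?invr_gt0//.
by rewrite ltW// truncnS_gt.
Qed.

Lemma minn_sum_le (c : nat -> nat) k n :
  (minn (\sum_(0 <= j < k) c j) n <= \sum_(0 <= j < k) minn (c j) n)%N.
Proof.
elim: k => [|k IH]; first by rewrite !big_geq// min0n.
rewrite !big_nat_recr//=; move: IH.
set a := (\sum_(0 <= j < k) c j)%N; set b := (\sum_(0 <= j < k) minn _ _)%N.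
by move: a b (c k) => a b e h; lia.
Qed.

(** Few visits mean that a quarter of [rate n] returns take more time than
    [n]; Markov's inequality applies to the return times truncated at [n]. *)
Lemma pr_few_visits n : (0 < n)%N ->
  pr [set x | S1 n x < rate n / 4 - 1] <= 1 / 4.
Proof.
move=> n0; have n0' : 0 < n%:R :> R by rewrite ltr0n.
have Ln := trmean_gt0 H n0; have r0 := rate_gt0 H n0.
pose k := Num.truncn (rate n / 4).
have k1 : k%:R <= rate n / 4 by rewrite truncn_le divr_ge0// ltW.
have k2 : rate n / 4 - 1 < k%:R.
  by have := truncnS_gt (rate n / 4); rewrite -/k -natr1; lra.
have mlt : measurable [set x | S1 n x < rate n / 4 - 1].
  exact: measurable_sublevel.
have mc := measurable_core mOm hT.
have -> : pr [set x | S1 n x < rate n / 4 - 1] =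
    pr ([set x | S1 n x < rate n / 4 - 1] `&` core).
  apply: (pr_eq_ae H mc (cond_measure_core mOm hT hc he Om0 Omf)) => //.
    exact: measurableI.
  by move=> x cx; split=> [?|[]].
apply: (@le_trans _ _ (pr [set x | n%:R <=
    (\sum_(0 <= j < k) trunc 0 n (proc tau phi j x))%:R :> R])).
  apply: (pr_le PT).
  - exact: measurableI.
  - exact: (measurable_cyl H (@cyl_sum _ _ tau phi (trunc 0 n) (fun j => n%:R <= j%:R :> R) k)).
  move=> x [/= lt cx]; rewrite ler_nat.
  have na : (n < arrival tau phi k x)%N.
    rewrite ltnNge; apply/negP => h; have := birk_ge_arrival hT cx h.
    by apply/negP; rewrite -ltNge; apply: lt_trans lt _.
  have -> : (\sum_(0 <= j < k) trunc 0 n (proc tau phi j x) =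
     \sum_(0 <= j < k) minn (proc tau phi j x) n)%N.
    by apply: eq_bigr => j _; rewrite truncE// minn0 subn0.
  apply: leq_trans (minn_sum_le _ _ _); rewrite leq_min leqnn andbT.
  exact: ltnW.
apply: le_trans (pr_trunc_markov H k (leq0n n) n0') _.
rewrite (trmean0 P phi) subr0 ler_pdivrMr//.
have rL : rate n * L n = n%:R by rewrite divfK// gt_eqF.
by rewrite -rL; nra.
Qed.

Lemma symmetric_sum_birk (f : X -> R) n x : (0 < n)%N ->
  symmetric_sum T Tinv n f x = birk T f n x + birk Tinv f n x - f x.
Proof.
move=> n0; rewrite /symmetric_sum /birk [X in _ = _ + X - _]big_ltn//=.
by rewrite [f x + _]addrC addrA addrK.
Qed.

Let Sym n x : R := symmetric_sum T Tinv n \1_Om x.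

Let Sym_le n x : (0 < n)%N -> Sym n x <= S1 n x + S2 n x.
Proof.
by move=> n0; rewrite /Sym symmetric_sum_birk// lerBlDr lerDl indicE.
Qed.

Let Sym_ge n x : (0 < n)%N -> S1 n x <= Sym n x.
Proof.
move=> n0; rewrite /Sym symmetric_sum_birk// -addrA lerDl subr_ge0.
by rewrite -(birk1 Tinv); apply: birk_le => // y; rewrite indicE.
Qed.

Let measurable_Sym n : (0 < n)%N -> measurable_fun setT (Sym n).
Proof.
move=> n0; rewrite /Sym; under eq_fun do rewrite symmetric_sum_birk//.
by apply: measurable_funB; [exact: measurable_funD|exact: measurable_indic].
Qed.

(** Any normalization for which the symmetric visits are bounded above
    dominates [rate], since with positive probability the visits reach [rate]
    up to a factor. *)
Lemma rate_dominated (a : nat -> R) : (forall n, (1 <= n)%N -> 0 < a n) ->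
  {ae m, forall x, exists M : nat, forall n, (M < n)%N -> Sym n x <= M.+1%:R * a n} ->
  exists2 C, 0 < C & exists N, forall n, (N <= n)%N -> rate n <= C * a n + 4.
Proof.
move=> a0 hA.
pose A M := \bigcap_(n in [set n | (M < n)%N]) [set x | Sym n x <= M.+1%:R * a n].
have mA M : measurable (A M).
  apply: bigcap_measurableType => n /= Mn.
  by apply: measurable_sublevel_le; apply: measurable_Sym; exact: leq_ltn_trans Mn.
have [M HM] : exists M, 1 / 4 < pr (A M).
  apply: contrapT => no.
  have le4 k : pr (A k) <= 1 / 4 by rewrite leNgt; apply/negP => ?; apply: no; exists k.
  have mE k : measurable (~` A k) by exact: measurableC.
  have half0 : 0 < 1 / 2 :> R by rewrite divr_gt0.
  have lo k : 1 / 2 <= pr (\bigcup_(i in [set i | (k <= i)%N]) ~` A i).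
    have mU : measurable (\bigcup_(i in [set i | (k <= i)%N]) ~` A i).
      exact: bigcup_measurable.
    have sub : setT `<=` A k `|` \bigcup_(i in [set i | (k <= i)%N]) ~` A i.
      by move=> x _; case: (pselect (A k x)) => Ax; [left|right; exists k => /=].
    have := pr_leU PT measurableT (mA k) mU sub; rewrite (prT PT).
    by have := le4 k; move: (pr (A k)) (pr _) => u v; lra.
  have [x [_ [k Hk] io]] := infinitely_often_witness mE half0 lo hA.
  have [i ki nA] := io k; apply: nA => n /= ni.
  apply: (le_trans (Hk n (leq_ltn_trans ki ni))).
  rewrite ler_wpM2r ?ler_nat//; apply: ltW; apply: a0.
  exact: leq_ltn_trans ni.
exists (4 * M.+1%:R); first by rewrite mulr_gt0.
exists M.+1 => n Mn; have n0 : (0 < n)%N by exact: leq_ltn_trans Mn.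
have [x [Ax nlt]] : exists x, A M x /\ ~ (S1 n x < rate n / 4 - 1).
  apply: contrapT => no; move: HM; apply/negP; rewrite -leNgt.
  apply: le_trans (pr_few_visits n0); apply: (pr_le PT) => //.
    exact: measurable_sublevel.
  by move=> x Ax; apply: contrapT => nlt; apply: no; exists x.
move/negP: nlt; rewrite -leNgt => h1.
have h2 := Sym_ge x n0; have h3 := Ax n Mn; rewrite /= in h3.
move: h1 h2 h3; move: (S1 n x) (Sym n x) (rate n) (a n) => s t r b; lra.
Qed.

(** By [rate_dominated] the comparison passes from the given normalization to
    [rate], and by [tame_dichotomy] it holds almost everywhere with the same
    factor. Were the squares of the hazards not summable, long returns would
    occur on both sides at the same scale: up to time [2 ^ i] each direction
    then collects only a small multiple of [scale i] visits. *)
Theorem asymp_visits_summable_hazard (a : nat -> R) : (forall n, (1 <= n)%N -> 0 < a n) ->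
  {ae m, forall x, asymp (fun n => Sym n x) a} -> summable_hazard P phi.
Proof.
move=> a0 hA.
(* the two halves of the comparison, with one natural number for all
   constants *)
have hA' : {ae m, forall x, exists M : nat, forall n, (M < n)%N ->
    Sym n x <= M.+1%:R * a n /\ a n <= M.+1%:R * Sym n x}.
  apply: filterS hA => x [M M1 [N _ HN]].
  pose K := maxn N (Num.truncn M); exists K => n Kn.
  have n0 : (1 <= n)%N by exact: leq_ltn_trans Kn.
  have [] := HN n; first by rewrite /= (leq_trans _ (ltnW Kn))// leq_maxl.
  have an := a0 n n0; have M0 : 0 < M by exact: lt_trans M1.
  have MK : M <= K.+1%:R.
    by apply: (le_trans (ltW (truncnS_gt _))); rewrite ler_nat ltnS leq_maxr.
  rewrite ltr_pdivlMr// ltr_pdivrMr// => h1 h2.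
  have s0 : 0 < Sym n x.
    by apply: lt_trans h1; rewrite mulr_gt0// invr_gt0.
  split.
    by apply: (le_trans (ltW h2)); rewrite ler_wpM2r// ltW.
  apply: (@le_trans _ _ (M * Sym n x)).
    by rewrite -ler_pdivrMl// ltW.
  by rewrite ler_wpM2r// ltW.
have [C C0 [N HN]] : exists2 C, 0 < C & exists N, forall n, (N <= n)%N ->
    rate n <= C * a n + 4.
  apply: rate_dominated => //; apply: filterS hA' => x [M HM]; exists M => n.
  by move=> /HM[].
have s0 n x : 0 <= S1 n x + S2 n x.
  by rewrite addr_ge0// birk_ge0// => y; rewrite indicE.
pose V (K : nat) := [set x | exists D, forall n, rate n <= K.+1%:R * (S1 n x + S2 n x) + D].
have aeV : {ae m, forall x, exists K, V K x}.
  apply: filterS hA' => x [M HM].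
  pose K := Num.truncn (C * M.+1%:R); exists K.
  exists ((maxn N M.+1)%:R + 4) => n.
  have k0 : 0 <= K.+1%:R * (S1 n x + S2 n x) by rewrite mulr_ge0.
  case: (leqP (maxn N M.+1) n) => Nn; last first.
    have := rate_le_nat H n; have : n%:R <= (maxn N M.+1)%:R :> R by rewrite ler_nat ltnW.
    by move=> ? ?; lra.
  move: (Nn); rewrite geq_max => /andP[Nn1 Mn].
  have n0 : (0 < n)%N by exact: leq_ltn_trans Mn.
  have h1 := HN n Nn1; have [_ h2] := HM n Mn; have h3 := Sym_le x n0.
  have h4 : C * a n <= C * (M.+1%:R * (S1 n x + S2 n x)).
    by rewrite ler_wpM2l ?(ltW C0)//; apply: (le_trans h2); rewrite ler_wpM2l.
  have h5 : C * M.+1%:R * (S1 n x + S2 n x) <= K.+1%:R * (S1 n x + S2 n x).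
    by rewrite ler_wpM2r// ltW// truncnS_gt.
  have h6 : 0 <= (maxn N M.+1)%:R :> R by [].
  move: h1 h4 h5 h6; rewrite mulrA; move: (rate n) (a n) (_ + _) (_%:R) => r b s u; lra.
have dich K : measurable (V K) /\ (m (V K) = 0%E \/ m (~` V K) = 0%E).
  apply: (@tame_dichotomy _ _ _ m T he (fun n x => K.+1%:R * (S1 n x + S2 n x))
    rate (K.+1%:R * 2)).
    by move=> n; apply: measurable_funM => //; exact: measurable_funD.
  move=> n x; rewrite -mulrBr normrM ger0_norm// ler_wpM2l// opprD addrACA.
  apply: (le_trans (ler_normD _ _)); have := birk_step T Om n x (R := R).
  have := birk_step_inv Om hT n x (R := R); lra.
have [K VK] : exists K, m (~` V K) = 0%E.
  apply: contrapT => no.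
  have nV : {ae m, forall x, ~ (exists K, V K x)}.
    have [N1 [mN N0 sub]] : m.-negligible (\bigcup_K V K).
      apply: negligible_bigcup => K; have [mV [V0|V0]] := dich K.
        by exists (V K); split.
      by case: no; exists K.
    exists N1; split=> // x /= nn; apply: sub; apply: contrapT => nV.
    by apply: nn => -[K VK]; apply: nV; exists K.
  have {nV aeV} [N1 [mN N0 sub]] : {ae m, forall x : X, False}.
    by apply: filterS2 aeV nV => x h1 h2; exact: h2 h1.
  move: Om0; apply/negP; rewrite -leNgt -N0.
  by apply: le_measure; rewrite ?inE// => x _; apply: sub => /=; tauto.
apply: contrapT => nS.
(* windows so short that the visits of both sides amount to half of what [V
   K] requires *)
have c0 : 0 < (4 * K.+1%:R)^-1 :> R by rewrite invr_gt0 mulr_gt0.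
set c := (4 * K.+1%:R)^-1 in c0.
pose bk j x := proc sigma psi j x.
have mbk j (Q : set nat) : measurable [set x | Q (bk j x)].
  apply: (measurable_cylinder (tau := sigma) (phi := psi) (k := j.+1)).
  - exact: (measurable_induced_map mOm hT').
  - exact: (measurable_return_time mOm hT').
  - exact: (@cyl_crd _ _ sigma psi j Q).
have bkP x j k : core x -> (j < k)%N ->
    bk j (iter k tau x) = proc tau phi (k - j.+1) x.
  by move=> cx jk; exact: (core_reversal hT cx jk).
have [g [del del0 lo]] := two_sided_bursts H mbk (measurable_core mOm hT)
  (cond_measure_core mOm hT hc he Om0 Omf) bkP c0 nS.
have aeVK : {ae m, forall x, V K x}.
  by exists (~` V K); split=> //; apply: measurableC; have [] := dich K.
have mE i : measurable (burst P tau phi bk c g i) by exact: (measurable_burst H mbk).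
have [x [cx [D HD] io]] := infinitely_often_witness mE del0 lo aeVK.
have [N1 HN1] := scale_large H (2 * (K.+1%:R * g%:R + D) + 1).
have [i Ni [[j jk hj] [j' jk' hj']]] := io N1.
have h1 := HN1 i Ni; have h2 := HD (2 ^ i)%N; rewrite rate_pow2 in h2.
have cx' := (core_sym T Tinv Om x).1 cx.
have p2 : (0 < 2 ^ i)%N by rewrite expn_gt0.
have b1 : (2 ^ i <= arrival sigma psi (win c i) x)%N.
  apply: leq_trans (arrival_ge_term sigma psi x jk).
  by move: hj; rewrite -ltnS prednK.
have b2 : (2 ^ i <= arrival tau phi (g + win c i) x)%N.
  have jk2 : (j' < g + win c i)%N by case/andP: jk'.
  apply: leq_trans (arrival_ge_term tau phi x jk2).
  by move: hj'; rewrite -ltnS prednK.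
have e1 := birk_le_arrival hT' cx' b1; have e2 := birk_le_arrival hT cx b2.
have w := win_le H i (ltW c0); rewrite natrD in e2.
have cK : K.+1%:R * (c * scale i) = scale i / 4.
  by rewrite /c; move: (scale i) => u; field; rewrite nat1r pnatr_eq0.
have h3 : K.+1%:R * (S1 (2 ^ i) x + S2 (2 ^ i) x) <=
    K.+1%:R * (g%:R + c * scale i + c * scale i).
  by rewrite ler_wpM2l//; lra.
rewrite !mulrDr cK in h3; rewrite mulrDr in h2.
move: h1 h2 h3.
move: (scale i) (K.+1%:R * S1 _ _) (K.+1%:R * S2 _ _) (K.+1%:R * g%:R) => u v z y; lra.
Qed.

End conditions.

(** * Asymptotics almost everywhere *)

Section hopf_ratio.
Context {R : realType} {d : measure_display} {X : measurableType d}.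
Variables (m : {measure set X -> \bar R}) (Om : set X).
Hypotheses (mOm : measurable Om) (Om0 : (0 < m Om)%E) (Omf : (m Om < +oo)%E).
Let mu := fine (m Om).

Lemma integrable_indic_fin A : measurable A -> (m A < +oo)%E ->
  m.-integrable setT (EFin \o (\1_A : X -> R)).
Proof.
move=> mA fA; apply/integrableP; split.
  by apply/measurable_EFinP; exact: measurable_indic.
under eq_integral do rewrite /= ger0_norm ?indicE//.
by rewrite -/(\1_A) integral_indic// setIT.
Qed.

(** Both inequalities are instances of [birk_bounded], for combinations of
    [f] and of the indicator of [Om] whose integral is slightly negative. *)
Theorem hopf_ratio (T Tinv : X -> X) (f : X -> R) :
  invertible_mpt m T Tinv -> ergodic m T -> m.-integrable setT (EFin \o f) ->
  {ae m, forall x, forall e : R, 0 < e -> exists D, forall n,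
    `|birk T f n x - fine (\int[m]_y (f y)%:E) / mu * birk T \1_Om n x| <=
      e * birk T \1_Om n x + D}.
Proof.
move=> hT he If; set F := fine _.
have mu0 : 0 < mu by exact: mass_gt0.
have IF : (\int[m]_y (f y)%:E = F%:E)%E.
  by rewrite fineK//; exact: integrable_fin_num.
have IO := integrable_indic_fin mOm Omf.
have JO : (\int[m]_y (\1_Om y)%:E = mu%:E)%E.
  by rewrite integral_indic// setIT massE.
have one (a b : R) : a * F + b * mu < 0 ->
    {ae m, forall x, exists D, forall n,
      a * birk T f n x + b * birk T \1_Om n x <= D}.
  move=> neg.
  have I1 : m.-integrable setT (fun x => a%:E * (f x)%:E)%E by exact: integrableZl.
  have I2 : m.-integrable setT (fun x => b%:E * (\1_Om x)%:E)%E by exact: integrableZl.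
  have Ih : m.-integrable setT (EFin \o (fun x => a * f x + b * \1_Om x)).
    rewrite (_ : EFin \o _ = (fun x => a%:E * (f x)%:E) \+ (fun x => b%:E * (\1_Om x)%:E))%E//.
    exact: integrableD.
  have := birk_bounded hT he Ih.
  have -> : (\int[m]_x (a * f x + b * \1_Om x)%:E = (a * F + b * mu)%:E)%E.
    under eq_integral do rewrite EFinD !EFinM.
    rewrite integralD//= !integralZl// ?IF ?JO -?EFinM ?EFinD//.
  rewrite lte_fin => /(_ neg); apply: filterS => x [D HD]; exists D => n.
  have := HD n; rewrite /birk big_split/= -!mulr_sumr; exact.
have A j : {ae m, forall x, exists D, forall n,
    `|birk T f n x - F / mu * birk T \1_Om n x| <= j.+1%:R^-1 * birk T \1_Om n x + D}.
  set e : R := j.+1%:R^-1; have e0 : 0 < e by rewrite invr_gt0.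
  have h1 : 1 * F + (- (F / mu + e)) * mu < 0.
    rewrite mulNr mulrDl divfK ?gt_eqF// mul1r opprD addrA subrr sub0r oppr_lt0.
    exact: mulr_gt0.
  have h2 : (- 1) * F + (F / mu - e) * mu < 0.
    rewrite mulrBl divfK ?gt_eqF// mulN1r addrA addNr sub0r oppr_lt0.
    exact: mulr_gt0.
  apply: filterS2 (one _ _ h1) (one _ _ h2) => x [D1 H1] [D2 H2].
  exists (Num.max D1 D2) => n; have := H1 n; have := H2 n.
  have : D2 <= Num.max D1 D2 by rewrite le_max lexx orbT.
  have : D1 <= Num.max D1 D2 by rewrite le_max lexx.
  move: (Num.max _ _) (birk T f n x) (birk T _ n x) (F / mu) => D u v w.
  by move=> d1 d2 g1 g2; rewrite ler_norml; apply/andP; split; nra.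
have {}A := ae_foralln A; apply: filterS A => x Hx e e0.
have [D HD] := Hx (Num.truncn e^-1); exists D => n; apply: (le_trans (HD n)).
rewrite lerD2r ler_wpM2r//; first by apply: birk_ge0 => y; rewrite indicE.
rewrite -[leRHS]invrK lef_pV2 ?posrE ?invr_gt0//.
by rewrite ltW// truncnS_gt.
Qed.

End hopf_ratio.

Section pointwise.
Context {R : realType} {d : measure_display} {X : measurableType d}.
Variables (m : {measure set X -> \bar R}) (T Tinv : X -> X) (Om : set X).
Hypotheses (mOm : measurable Om) (hT : invertible_mpt m T Tinv)
  (hc : conservative m T) (he : ergodic m T).
Hypotheses (Om0 : (0 < m Om)%E) (Omf : (m Om < +oo)%E).
Local Notation P := (cond_measure m mOm).
Local Notation phi := (return_time T Om).
Local Notation tau := (induced_map T Om).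
Local Notation pr := (rprob P).
Variable th : nat -> R.
Hypothesis H : psi_mixing P tau phi th.
Local Notation L := (trmean P phi).
Local Notation rate := (@rate _ _ _ m T Om mOm).
Local Notation S1 := (birk T (\1_Om : X -> R)).
Local Notation S2 := (birk Tinv (\1_Om : X -> R)).
Let PT := pm_total H.
Let hT' := invertible_sym hT.
Hypothesis hz : summable_hazard P phi.
Let mu := fine (m Om).

Let absorb (e : R) : 0 < e ->
  exists N, forall n, (N <= n)%N -> 2 <= e * rate n /\ 0 < rate n.
Proof.
move=> e0; have [N HN] := rate_large H (2 / e).
exists (maxn N 1) => n; rewrite geq_max => /andP[/HN h n1].
by rewrite (rate_gt0 H n1) mulrC -ler_pdivrMr.
Qed.

Let spread_upper (S : nat -> X -> R) :
  (forall n x, `|S n (T x) - S n x| <= 1) ->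
  {ae m, forall x, Om x -> forall e : R, 0 < e ->
     exists N, forall n, (N <= n)%N -> S n x <= (1 + e) * rate n} ->
  {ae m, forall x, forall e : R, 0 < e ->
     exists N, forall n, (N <= n)%N -> S n x <= (1 + e) * rate n}.
Proof.
move=> St; apply: (ae_spread mOm hT hc he Om0) => x Hx e e0.
have e2 : 0 < e / 2 by rewrite divr_gt0.
have [N1 HN1] := Hx _ e2; have [N2 HN2] := absorb e2.
exists (maxn N1 N2) => n; rewrite geq_max => /andP[/HN1 h1 /HN2 [h2 r0]].
move: (St n x) h1 h2; rewrite ler_norml => /andP[].
move: (S n x) (S n (T x)) (rate n) r0 => s t r r0; lra.
Qed.

Lemma ae_upper_all : {ae m, forall x, forall e : R, 0 < e ->
  exists N, forall n, (N <= n)%N ->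
    S1 n x <= (1 + e) * rate n /\ S2 n x <= (1 + e) * rate n}.
Proof.
have A1 := spread_upper (fun n x => birk_step T Om n x)
  (ae_upper1 hT hc he Om0 Omf H hz).
have A2 := spread_upper (fun n x => birk_step_inv Om hT n x)
  (ae_upper2 hT hc he Om0 Omf H hz).
apply: filterS2 A1 A2 => x H1 H2 e e0.
have [N1 HN1] := H1 e e0; have [N2 HN2] := H2 e e0.
by exists (maxn N1 N2) => n; rewrite geq_max => /andP[/HN1 ? /HN2].
Qed.

Lemma ae_full_all : {ae m, forall x, forall e : R, 0 < e ->
  exists N, forall n, (N <= n)%N ->
    (1 - e) * rate n <= S1 n x \/ (1 - e) * rate n <= S2 n x}.
Proof.
have := ae_one_full hT hc he Om0 Omf H hz.
apply: (ae_spread mOm hT hc he Om0) => x Hx e e0.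
have e2 : 0 < e / 2 by rewrite divr_gt0.
have [N1 HN1] := Hx _ e2; have [N2 HN2] := absorb e2.
exists (maxn N1 N2) => n; rewrite geq_max => /andP[/HN1 h1 /HN2 [h2 r0]].
move: (birk_step T Om n x (R := R)) (birk_step_inv Om hT n x (R := R)).
rewrite !ler_norml => /andP[a1 a2] /andP[b1 b2].
by case: h1 => h1; [left|right]; move: h1 h2 r0 a1 a2 b1 b2;
  move: (S1 n x) (S1 n (T x)) (S2 n x) (S2 n (T x)) (rate n) => s s' t t' r; lra.
Qed.

Let geo_series : bdd_series (fun l => (1 / 2) ^+ l : R).
Proof.
apply: (@bdd_series_recursion _ _ (fun=> 0) (1 / 2)).
- lra.
- by move=> i; rewrite exprn_ge0// divr_ge0.
- by move=> i; rewrite exprS addr0.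
- by exists 0 => n; rewrite big1.
Qed.

(** Visits are asymptotic to [rate] in probability, hence almost everywhere
    along a subsequence of any prescribed infinite set of times. *)
Lemma ae_subsequence (Bad : nat -> Prop) :
  (forall N, exists2 n, (N <= n)%N & Bad n) ->
  exists nu : nat -> nat, (forall l, (l < nu l)%N /\ Bad (nu l)) /\
  {ae m, forall x, forall e : R, 0 < e -> exists N, forall l, (N <= l)%N ->
    (1 - e) * rate (nu l) <= S1 (nu l) x /\ (1 - e) * rate (nu l) <= S2 (nu l) x}.
Proof.
move=> inf.
have ex l : exists n, [/\ (l < n)%N, Bad n,
    pr [set x | S1 n x < (1 - l.+1%:R^-1) * rate n] <= (1 / 2) ^+ l &
    pr [set x | S2 n x < (1 - l.+1%:R^-1) * rate n] <= (1 / 2) ^+ l].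
  have e0 : 0 < l.+1%:R^-1 :> R by rewrite invr_gt0.
  have e1 : 0 < (1 / 2) ^+ l :> R by rewrite exprn_gt0// divr_gt0.
  have [N1 HN1] := pr_lower1 hT hc he Om0 Omf H hz e0 e1.
  have [N2 HN2] := pr_lower2 hT hc he Om0 Omf H hz e0 e1.
  have [n + bn] := inf (maxn l.+1 (maxn N1 N2)).
  rewrite !geq_max => /and3P[ln n1 n2]; exists n; split=> //; [exact: HN1|exact: HN2].
have [nu Hnu] := choice ex.
exists nu; split; first by move=> l; have [] := Hnu l.
have mset (S : nat -> X -> R) : (forall n, measurable_fun setT (S n)) ->
    forall l, measurable [set x | S (nu l) x < (1 - l.+1%:R^-1) * rate (nu l)].
  by move=> mS l; exact: measurable_sublevel.
have mi : measurable_fun setT (\1_Om : X -> R) by exact: measurable_indic.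
have B1 : {ae m, forall x, Om x -> exists N, forall l, (N <= l)%N ->
    ~ (S1 (nu l) x < (1 - l.+1%:R^-1) * rate (nu l))}.
  apply: (borel_cantelli Om0 Omf H (mset S1 (fun n => measurable_birk n (mpt_measurable hT) mi))).
  by apply: bdd_series_le geo_series => l; have [] := Hnu l.
have B2 : {ae m, forall x, Om x -> exists N, forall l, (N <= l)%N ->
    ~ (S2 (nu l) x < (1 - l.+1%:R^-1) * rate (nu l))}.
  apply: (borel_cantelli Om0 Omf H (mset S2 (fun n => measurable_birk n (mpt_measurable hT') mi))).
  by apply: bdd_series_le geo_series => l; have [] := Hnu l.
apply: (ae_spread mOm hT hc he Om0 (Q := fun x => forall e : R, 0 < e ->
    exists N, forall l, (N <= l)%N ->
    (1 - e) * rate (nu l) <= S1 (nu l) x /\ (1 - e) * rate (nu l) <= S2 (nu l) x)).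
  move=> x Hx e e0; have e2 : 0 < e / 2 by rewrite divr_gt0.
  have [N1 HN1] := Hx _ e2; have [N2 HN2] := absorb e2.
  exists (maxn N1 N2) => l; rewrite geq_max => /andP[/HN1 [h1 h1'] N2l].
  have [ln _ _ _] := Hnu l.
  have [h2 r0] := HN2 (nu l) (leq_trans N2l (ltnW ln)).
  move: (birk_step T Om (nu l) x (R := R)) (birk_step_inv Om hT (nu l) x (R := R)).
  rewrite !ler_norml => /andP[a1 a2] /andP[b1 b2].
  by split; move: h1 h1' h2 r0 a1 a2 b1 b2;
  move: (S1 _ x) (S1 _ (T x)) (S2 _ x) (S2 _ (T x)) (rate _) => s s' t t' r; lra.
apply: filterS2 B1 B2 => x H1 H2 Ox e e0.
have [N1 HN1] := H1 Ox; have [N2 HN2] := H2 Ox.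
exists (maxn (maxn N1 N2) (Num.truncn e^-1)) => l.
rewrite !geq_max => /andP[/andP[/HN1 h1 /HN2 h2] el].
have le : l.+1%:R^-1 <= e.
  rewrite -[leRHS]invrK lef_pV2 ?posrE ?invr_gt0//.
  by apply: (le_trans (ltW (truncnS_gt _))); rewrite ler_nat ltnS.
have [ln _ _ _] := Hnu l.
have r0 : 0 < rate (nu l) by apply: (rate_gt0 H); exact: leq_ltn_trans ln.
have mono : (1 - e) * rate (nu l) <= (1 - l.+1%:R^-1) * rate (nu l).
  by rewrite ler_wpM2r ?(ltW r0)// lerD2l lerN2.
by split; apply: (le_trans mono); rewrite leNgt; apply/negP.
Qed.

(** By the ratio theorem in both directions of time, the symmetric sums of an
    integrable function are governed by the visits to [Om]. *)
Theorem ae_symmetric_ratio (f : X -> R) : m.-integrable setT (EFin \o f) ->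
  {ae m, forall x, forall e : R, 0 < e -> exists N, forall n, (N <= n)%N ->
    `|symmetric_sum T Tinv n f x / rate n -
      fine (\int[m]_y (f y)%:E) / mu * ((S1 n x + S2 n x) / rate n)| <= e}.
Proof.
move=> If.
have R1 := hopf_ratio mOm Om0 Omf hT he If.
have R2 := hopf_ratio mOm Om0 Omf hT' (ergodic_sym hT he) If.
apply: filterS3 R1 R2 ae_upper_all => x H1 H2 Up e e0.
set c := fine _ / mu.
have e8 : 0 < e / 8 by rewrite divr_gt0.
have [D1 HD1] := H1 _ e8; have [D2 HD2] := H2 _ e8.
have [N1 HN1] := Up 1 ltr01.
set D := Num.max 0 (D1 + D2 + `|f x|).
have D0 : 0 <= D by rewrite le_max lexx.
have DD : D1 + D2 + `|f x| <= D by rewrite le_max lexx orbT.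
have [N2 HN2] := rate_large H (2 * D / e).
exists (maxn (maxn N1 N2) 1) => n; rewrite !geq_max => /andP[/andP[/HN1 [u1 u2] /HN2 h] n0].
have r0 := rate_gt0 H n0.
rewrite mulrA -mulrBl normrM normfV (gtr0_norm r0) ler_pdivrMr//.
rewrite symmetric_sum_birk//.
have g1 := HD1 n; have g2 := HD2 n; rewrite -/c in g1 g2.
have h' : 2 * D <= e * rate n by move: h; rewrite ler_pdivrMr// [_ * e]mulrC.
have := ler_norm (f x); have := ler_norm (- f x); rewrite normrN.
move: g1 g2 u1 u2 h' DD; rewrite !ler_norml.
move: (birk T f n x) (birk Tinv f n x) (S1 n x) (S2 n x) (rate n) r0 `|f x| (f x).
move=> p q s t r r0 af y /andP[g1 g1'] /andP[g2 g2'] u1 u2 h' DD v1 v2.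
have es : e / 8 * (s + t) <= e / 2 * r.
  have -> : e / 2 * r = e / 8 * (4 * r) by field.
  by rewrite ler_wpM2l ?(ltW e8)//; lra.
rewrite mulrDr; move: es; rewrite mulrDr.
move: (c * s) (c * t) (e / 8 * s) (e / 8 * t) g1 g1' g2 g2'.
move=> cs ct es et g1 g1' g2 g2' es'.
by apply/andP; split; lra.
Qed.

End pointwise.

(** * Return sequences *)

Section average.
Context {R : realType} {d : measure_display} {X : measurableType d}.
Variables (m : {measure set X -> \bar R}) (T Tinv : X -> X) (A : set X).
Hypotheses (hT : invertible_mpt m T Tinv) (mA : measurable A).
Hypotheses (A0 : (0 < m A)%E) (Af : (m A < +oo)%E).
Let a := fine (m A).

Let visits n x : R := birk T \1_A n x.

Let a0 : 0 < a. Proof. by rewrite /a fine_gt0// A0 Af. Qed.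
Let aE : m A = a%:E. Proof. by rewrite /a fineK// ge0_fin_numE. Qed.

Let measurable_visits n : measurable_fun setT (visits n).
Proof.
by apply: measurable_birk; [exact: mpt_measurable hT|exact: measurable_indic].
Qed.

Lemma integrable_cst_fin (k : R) : m.-integrable A (fun=> k%:E).
Proof.
apply/integrableP; split; first exact: measurable_cst.
by rewrite /= integral_cst// aE -EFinM ltry.
Qed.

Lemma integral_visits n :
  m.-integrable A (EFin \o visits n) /\
  (\int[m]_(x in A) (visits n x)%:E = (avg_return m T A n * a ^+ 2)%:E)%E.
Proof.
have mk k : measurable (iter k T @^-1` A) by exact: (iter_preim_measurable hT).
have E x : (visits n x)%:E = (\sum_(0 <= k < n) (\1_(iter k T @^-1` A) x)%:E)%E.
  by rewrite sumEFin.
have I1 k : m.-integrable A (fun x => (\1_(iter k T @^-1` A) x)%:E).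
  apply: le_integrable (integrable_cst_fin 1) => //.
    by apply/measurable_EFinP; apply: measurable_funTS; exact: measurable_indic.
  by move=> x _; rewrite lee_fin indicE !ger0_norm//; case: (_ \in _).
split.
  rewrite (_ : EFin \o _ = fun x => \sum_(0 <= k < n) (\1_(iter k T @^-1` A) x)%:E)%E.
    exact: integrable_sum.
  by apply/funext => x; exact: E.
under eq_integral do rewrite E.
rewrite integral_sum//; under eq_bigr do rewrite integral_indic//.
rewrite /avg_return -mulr_suml divfK ?gt_eqF ?exprn_gt0// -sumEFin.
apply: eq_bigr => k _; rewrite setIC fineK// ge0_fin_numE//.
by apply: le_lt_trans Af; apply: le_measure; rewrite ?inE//; exact: measurableI.
Qed.

Lemma avg_return_gt0 n : (0 < n)%N -> 0 < avg_return m T A n.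
Proof.
move=> n0; rewrite /avg_return big_ltn//= setIid -/a ltr_pwDl//.
  by rewrite divr_gt0// exprn_gt0.
by apply: sumr_ge0 => k _; rewrite divr_ge0 ?fine_ge0// sqr_ge0.
Qed.

(** Dominated convergence for the visits normalized by [b]; the weights [v]
    allow a domination that is relative to another normalization. *)
Lemma weighted_average (nu : nat -> nat) (b v : nat -> R) (c V M : R) :
  (forall l, 0 < b l) -> (forall l, 0 <= v l <= V) ->
  {ae m, forall x, A x -> forall l, v l * (visits (nu l) x / b l) <= M} ->
  {ae m, forall x, forall e : R, 0 < e -> exists N, forall l, (N <= l)%N ->
    `|visits (nu l) x / b l - c| <= e} ->
  forall e : R, 0 < e -> exists N, forall l, (N <= l)%N ->
    `|v l * (avg_return m T A (nu l) * a ^+ 2 / b l - c * a)| <= e.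
Proof.
move=> b0 vV dom cv e e0.
pose g l x := v l * (visits (nu l) x / b l - c).
have mg l : measurable_fun A (EFin \o g l).
  apply/measurable_EFinP; apply: measurable_funTS; apply: measurable_funM => //.
  by apply: measurable_funB => //; apply: measurable_funM.
have V0 : 0 <= V by have /andP[h1 h2] := vV 0%N; exact: le_trans h1 h2.
have visits0 n x : 0 <= visits n x by apply: birk_ge0 => y; rewrite indicE.
have [] := @dominated_convergence _ X R m A mA (fun l => EFin \o g l) (cst 0%E)
  (fun=> (M + V * `|c|)%:E) mg.
- exact: measurable_cst.
- apply: filterS cv => x Hx Ax; apply/fine_cvgP; split; first exact: nearW.
  apply/cvgrPdist_le => /= ep ep0.
  have epV : 0 < ep / (V + 1) by rewrite divr_gt0// ltr_wpDl.
  have [N HN] := Hx _ epV; exists N => // l /= Nl.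
  have /andP[v0 vl] := vV l.
  rewrite sub0r normrN /g normrM (ger0_norm v0).
  apply: (@le_trans _ _ (V * (ep / (V + 1)))); first by apply: ler_pM => //; exact: HN.
  by rewrite mulrCA ler_piMr ?(ltW ep0)// ler_pdivrMr ?ltr_wpDl// mul1r lerDl.
- exact: integrable_cst_fin.
- apply: filterS dom => x Hx l Ax /=; rewrite lee_fin.
  have /andP[v0 vl] := vV l; have h := Hx Ax l.
  have h0 : 0 <= v l * (visits (nu l) x / b l) by rewrite mulr_ge0// divr_ge0// ltW.
  rewrite /g mulrBr; apply: le_trans (ler_normB _ _) _.
  rewrite (ger0_norm h0) normrM (ger0_norm v0); apply: lerD => //.
  by rewrite ler_wpM2r.
move=> _ _; rewrite integral0 => /fine_cvgP[_] /cvgrPdist_le /(_ _ e0) [N _ HN].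
exists N => l /HN; rewrite /= sub0r normrN.
suff -> : (\int[m]_(x in A) (g l x)%:E =
   (v l * (avg_return m T A (nu l) * a ^+ 2 / b l - c * a))%:E)%E by [].
have [I1 J1] := integral_visits (nu l).
have E x : (g l x)%:E = ((v l / b l)%:E * (visits (nu l) x)%:E - (v l * c)%:E)%E.
  by rewrite -EFinM -EFinB /g; congr _%:E; ring.
under eq_integral do rewrite E.
rewrite integralB//; last 2 first.
- exact: integrableZl.
- exact: integrable_cst_fin.
rewrite integralZl// J1 integral_cst// aE -!EFinM -EFinB; congr _%:E; ring.
Qed.

End average.

Section constants.
Context {R : realType} {d : measure_display} {X : measurableType d}.
Variables (m : {measure set X -> \bar R}) (T Tinv : X -> X) (Om : set X).
Hypotheses (mOm : measurable Om) (hT : invertible_mpt m T Tinv)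
  (hc : conservative m T) (he : ergodic m T).
Hypotheses (Om0 : (0 < m Om)%E) (Omf : (m Om < +oo)%E).
Local Notation P := (cond_measure m mOm).
Local Notation phi := (return_time T Om).
Local Notation tau := (induced_map T Om).
Variable th : nat -> R.
Hypothesis H : psi_mixing P tau phi th.
Local Notation rate := (@rate _ _ _ m T Om mOm).
Local Notation S1 := (birk T (\1_Om : X -> R)).
Local Notation S2 := (birk Tinv (\1_Om : X -> R)).
Hypothesis hz : summable_hazard P phi.
Let mu := fine (m Om).
Let mu0 : 0 < mu. Proof. exact: mass_gt0. Qed.

Let absorb (C e : R) : 0 < e ->
  exists N, forall n, (N <= n)%N -> C <= e * rate n /\ 0 < rate n.
Proof.
move=> e0; have [N HN] := rate_large H (C / e).
exists (maxn N 1) => n; rewrite geq_max => /andP[/HN h n1].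
by rewrite (rate_gt0 H n1) mulrC -ler_pdivrMr.
Qed.

(** The subsequence is the one that works for the visits to [Om]; the ratio
    theorem carries it over to [A]. *)
Lemma ae_visits_subsequence (A : set X) (Bad : nat -> Prop) :
  measurable A -> (m A < +oo)%E ->
  (forall N, exists2 n, (N <= n)%N & Bad n) ->
  exists nu : nat -> nat, (forall l, (l < nu l)%N /\ Bad (nu l)) /\
  {ae m, forall x, forall e : R, 0 < e -> exists N, forall l, (N <= l)%N ->
    `|birk T \1_A (nu l) x / rate (nu l) - fine (m A) / mu| <= e}.
Proof.
move=> mA Af inf.
have [nu [nuP sub]] := ae_subsequence hT hc he Om0 Omf H hz inf.
exists nu; split=> //.
have IA := integrable_indic_fin mA Af.
have R1 := hopf_ratio mOm Om0 Omf hT he IA.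
have Up := ae_upper_all hT hc he Om0 Omf H hz.
apply: filterS3 R1 sub Up => x Hx Sx Ux e e0.
have JA : fine (\int[m]_y (\1_A y)%:E) = fine (m A) by rewrite integral_indic// setIT.
rewrite JA -/mu in Hx; set c := fine (m A) / mu in Hx *.
have c0 : 0 <= c by rewrite divr_ge0 ?fine_ge0// ltW.
have e8 : 0 < e / 8 by rewrite divr_gt0.
have e2 : 0 < e / (2 * (c + 1)) by rewrite divr_gt0// mulr_gt0// ltr_wpDl.
have [D HD] := Hx _ e8; have [N1 HN1] := Sx _ e2.
have [N2 HN2] := Ux 1 ltr01; have [N3 HN3] := Ux _ e2.
have e4 : 0 < e / 4 by rewrite divr_gt0.
have [N4 HN4] := absorb D e4.
exists (maxn (maxn N1 N2) (maxn N3 N4)) => l.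
rewrite !geq_max => /andP[/andP[/HN1 [lo _] N2l] /andP[N3l N4l]].
have [ln _] := nuP l.
have [u1 _] := HN2 (nu l) (leq_trans N2l (ltnW ln)).
have [u2 _] := HN3 (nu l) (leq_trans N3l (ltnW ln)).
have [dr r0] := HN4 (nu l) (leq_trans N4l (ltnW ln)).
have := HD (nu l).
move: lo u1 u2 dr r0.
move: (birk T \1_Om (nu l) x) (rate (nu l)) (birk T \1_A (nu l) x) => s r b.
move=> lo u1 u2 dr r0 hb.
have -> : b / r - c = ((b - c * s) + c * (s - r)) / r.
  by field; rewrite gt_eqF.
rewrite normrM normfV (gtr0_norm r0) ler_pdivrMr//.
apply: le_trans (ler_normD _ _) _.
have sr : `|s - r| <= e / (2 * (c + 1)) * r.
  by rewrite ler_norml; apply/andP; split; lra.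
have cr : c * `|s - r| <= e / 2 * r.
  apply: (@le_trans _ _ (c * (e / (2 * (c + 1)) * r))); first by rewrite ler_wpM2l.
  have -> : c * (e / (2 * (c + 1)) * r) = c / (c + 1) * (e / 2 * r).
    by field; rewrite gt_eqF// ltr_wpDl.
  rewrite ler_piMl ?mulr_ge0 ?divr_ge0 ?(ltW e0) ?(ltW r0)//.
  by rewrite ler_pdivrMr ?ltr_wpDl// mul1r lerDl.
have bs : e / 8 * s <= e / 4 * r.
  have -> : e / 4 * r = e / 8 * (2 * r) by field.
  by rewrite ler_wpM2l ?(ltW e8)//; lra.
by rewrite normrM (ger0_norm c0); lra.
Qed.

Lemma mass_pos (A : set X) : (0 < m A)%E -> (m A < +oo)%E -> 0 < fine (m A).
Proof. by move=> A0 Af; rewrite fine_gt0// A0 Af. Qed.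

Lemma not_eventually (Q : nat -> Prop) : ~ (exists N, forall n, (N <= n)%N -> Q n) ->
  forall N, exists2 n, (N <= n)%N & ~ Q n.
Proof.
move=> no N; apply: contrapT => no'; apply: no; exists N => n Nn.
by apply: contrapT => nQ; apply: no'; exists n.
Qed.

(** Otherwise [weighted_average] would make [avg_return] asymptotic to [rate
    / mu] along a sequence of exceptional times. *)
Let rate_avg_bounded_core (A : set X) (C : R) : measurable A -> (0 < m A)%E ->
  (m A < +oo)%E -> 0 < C ->
  {ae m, forall x, A x -> forall n, (0 < n)%N -> birk T \1_A n x <= C * rate n} ->
  exists N, forall n, (N <= n)%N -> rate n <= 2 * mu * avg_return m T A n.
Proof.
move=> mA A0 Af C0 dom; apply: contrapT => /not_eventually inf.
have a0 := mass_pos A0 Af; set a := fine (m A) in a0.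
have [nu [nuP cv]] := ae_visits_subsequence mA Af inf.
have nu0 l : (0 < nu l)%N by have [h _] := nuP l; exact: leq_ltn_trans h.
have b0 l : 0 < rate (nu l) by exact: (rate_gt0 H).
have v01 (l : nat) : 0 <= (fun=> 1 : R) l <= 1 by rewrite ler01 lexx.
have dom' : {ae m, forall x, A x -> forall l,
    (fun=> 1 : R) l * (birk T \1_A (nu l) x / rate (nu l)) <= C}.
  apply: filterS dom => x Hx Ax l; rewrite mul1r ler_pdivrMr//; exact: Hx.
have e0 : 0 < a ^+ 2 / (4 * mu) by rewrite divr_gt0 ?exprn_gt0// mulr_gt0.
have [N HN] := weighted_average hT mA A0 Af b0 v01 dom' cv e0.
have := HN N (leqnn N); rewrite mul1r -/a.
have [_ /negP] := nuP N; rewrite -ltNge => bad.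
have r0 := b0 N; move: bad r0; move: (rate _) (avg_return _ _ _ _) => r g bad r0.
rewrite ler_norml => /andP[h _].
have : g * a ^+ 2 / r < a ^+ 2 / (2 * mu).
  have k0 : 0 < a ^+ 2 / (2 * mu) by rewrite divr_gt0 ?exprn_gt0// mulr_gt0.
  rewrite ltr_pdivrMr// [ltRHS]mulrC.
  have -> : g * a ^+ 2 = 2 * mu * g * (a ^+ 2 / (2 * mu)) by field; rewrite gt_eqF.
  by rewrite ltr_pM2r.
have -> : a ^+ 2 / (2 * mu) = a ^+ 2 / mu / 2 by field; rewrite gt_eqF.
move: h; have -> : a ^+ 2 / (4 * mu) = a ^+ 2 / mu / 4 by field; rewrite gt_eqF.
have -> : a / mu * a = a ^+ 2 / mu by field; rewrite gt_eqF.
have : 0 < a ^+ 2 / mu by rewrite divr_gt0// exprn_gt0.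
by clear v01 dom HN; move: (a ^+ 2 / mu) (g * _ / r) => p q; lra.
Qed.

(** The points of [Om] whose visits never exceed a large multiple of [rate]
    form a set witnessing bounded rational ergodicity. *)
Theorem exists_bre_set : boundedly_rationally_ergodic m T.
Proof.
have Up := ae_upper_all hT hc he Om0 Omf H hz.
pose A M := Om `&` \bigcap_(n in [set n | (0 < n)%N]) [set x | S1 n x <= M.+1%:R * rate n].
have mi : measurable_fun setT (\1_Om : X -> R) by exact: measurable_indic.
have mS1 n : measurable_fun setT (S1 n) := measurable_birk n (mpt_measurable hT) mi.
have mA M : measurable (A M).
  apply: measurableI => //; apply: bigcap_measurableType => n _.
  exact: measurable_sublevel_le.
have [M AM] : exists M, (0 < m (A M))%E.
  apply: contrapT => no.
  have z M : m.-negligible (A M).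
    exists (A M); split=> //; apply/eqP; rewrite -measure_le0 leNgt.
    by apply/negP => ?; apply: no; exists M.
  have [N1 [mN1 N10 sub1]] := negligible_bigcup z.
  have [N2 [mN2 N20 sub2]] := Up.
  move: Om0; apply/negP; rewrite -leNgt.
  apply: (@le_trans _ _ (m (N1 `|` N2))); last by rewrite measureU0// N10.
  apply: le_measure; rewrite ?inE//; first exact: measurableU.
  move=> x Ox; case: (pselect (N2 x)) => N2x; [by right|left].
  apply: sub1; have Ux : forall e : R, 0 < e -> exists N, forall n, (N <= n)%N ->
      S1 n x <= (1 + e) * rate n /\ S2 n x <= (1 + e) * rate n.
    by apply: contrapT => h; apply: N2x; apply: sub2.
  have [N HN] := Ux 1 ltr01.
  exists N.+1 => //; split=> // n /= n0.
  have r1 := rate_ge1 H n0.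
  case: (leqP N n) => Nn.
    have [h _] := HN n Nn; apply: (le_trans h).
    by rewrite ler_wpM2r ?(le_trans _ r1)// -[1 + 1]/(2%:R) ler_nat.
  apply: (le_trans (birk_indic_le T Om n x)).
  apply: (@le_trans _ _ N.+2%:R); first by rewrite ler_nat; apply: leqW; apply: leqW; exact: ltnW.
  by rewrite ler_peMr.
have AMf : (m (A M) < +oo)%E.
  by apply: le_lt_trans Omf; apply: le_measure; rewrite ?inE//; exact: subIsetl.
have dom n x : A M x -> (0 < n)%N -> birk T \1_(A M) n x <= M.+1%:R * rate n.
  move=> [_ Ax] n0; apply: le_trans (Ax n n0); apply: ler_sum => k _.
  rewrite !indicE ler_nat; case: (boolP (_ \in A M)) => //.
  by rewrite inE => -[Ok _]; rewrite mem_set.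
have M0 : 0 < M.+1%:R :> R by [].
have [N HN] := rate_avg_bounded_core (mA M) AM AMf M0
  (aeW m (fun x Ax n n0 => dom n x Ax n0)).
have a0 := mass_pos AM AMf; set a := fine (m (A M)) in a0.
exists (A M); split=> //.
exists (M.+1%:R * (2 * mu + N%:R * a)).
  by rewrite mulr_gt0// ltr_wpDr ?mulr_ge0 ?(ltW a0)// mulr_gt0.
apply: aeW => x Ax n n1; apply: (le_trans (dom n x Ax n1)).
rewrite -mulrA ler_wpM2l//.
have g0 := avg_return_gt0 T AM AMf n1.
case: (leqP N n) => Nn.
  apply: (le_trans (HN n Nn)); rewrite ler_wpM2r ?(ltW g0)//.
  by rewrite lerDl mulr_ge0// ltW.
have g1 : 1 <= a * avg_return m T (A M) n.
  rewrite /avg_return -/a big_ltn//= setIid -/a mulrDr.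
  have -> : a * (a / a ^+ 2) = 1 by field; rewrite gt_eqF.
  rewrite lerDl mulr_ge0 ?(ltW a0)//; apply: sumr_ge0 => k _.
  by rewrite divr_ge0 ?fine_ge0// sqr_ge0.
apply: (le_trans (rate_le_nat H n)).
have nN : n%:R <= N%:R :> R by rewrite ler_nat ltnW.
have N0 : 0 <= N%:R :> R by [].
have m1 : 0 <= 2 * mu * avg_return m T (A M) n by rewrite !mulr_ge0 ?(ltW mu0) ?(ltW g0).
have m2 : N%:R <= N%:R * (a * avg_return m T (A M) n) by rewrite ler_peMr.
by rewrite mulrDl -[N%:R * a * _]mulrA; lra.
Qed.

(** The visits to [A] are dominated by the return sequence and, along a
    subsequence of any set of times, asymptotic to a multiple of [rate]. At a
    single point this bounds the quotient of the two, which then serves as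
    the weight in [weighted_average]. *)
Theorem rate_over_avg (A : set X) : bre_set m T A -> forall e : R, 0 < e ->
  exists N, forall n, (N <= n)%N -> `|rate n / avg_return m T A n - mu| <= e.
Proof.
move=> [mA A0 Af [M M0 dom]] e e0; apply: contrapT => /not_eventually inf.
have a0 := mass_pos A0 Af; set a := fine (m A) in a0.
have [nu [nuP cv]] := ae_visits_subsequence mA Af inf.
have nu0 l : (0 < nu l)%N by have [h _] := nuP l; exact: leq_ltn_trans h.
have b0 l : 0 < rate (nu l) by exact: (rate_gt0 H).
have g0 l : 0 < avg_return m T A (nu l) by exact: avg_return_gt0.
pose v l := rate (nu l) / avg_return m T A (nu l).
have v0 l : 0 < v l by rewrite divr_gt0.
have c0 : 0 < a / mu by rewrite divr_gt0.
have vb x l : A x -> (forall n, (1 <= n)%N ->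
    \sum_(0 <= k < n) \1_A (iter k T x) <= M * avg_return m T A n) ->
    v l * (birk T \1_A (nu l) x / rate (nu l)) <= M.
  move=> Ax Dx; have := Dx (nu l) (nu0 l); rewrite -/(birk T \1_A (nu l) x).
  rewrite /v mulrAC mulrCA mulrA mulfK ?gt_eqF// => h.
  by rewrite ler_pdivrMr.
have [x [Ax Dx Cx]] : exists x, [/\ A x, forall n, (1 <= n)%N ->
    \sum_(0 <= k < n) \1_A (iter k T x) <= M * avg_return m T A n &
    forall e : R, 0 < e -> exists N, forall l, (N <= l)%N ->
    `|birk T \1_A (nu l) x / rate (nu l) - a / mu| <= e].
  apply: contrapT => no.
  have [N [mN N0 sub]] : {ae m, forall x, ~ A x}.
    by apply: filterS2 dom cv => x Dx Cx Ax; apply: no; exists x; split=> //; exact: Dx.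
  move: A0; apply/negP; rewrite -leNgt -N0; apply: le_measure; rewrite ?inE//.
  by move=> x Ax; apply: sub => /=; apply.
have c20 : 0 < a / mu / 2 by rewrite divr_gt0.
have [N HN] := Cx _ c20.
have vV l : (N <= l)%N -> v l <= 2 * M / (a / mu).
  move=> /HN; rewrite ler_norml => /andP[h _]; have := vb x l Ax Dx.
  rewrite ler_pdivlMr//; move: h (v0 l); move: (birk _ _ _ _ / _) (v l) (a / mu) => w u c; nra.
pose nu' l := nu (l + N)%N; pose v' l := v (l + N)%N.
have v'V l : 0 <= v' l <= 2 * M / (a / mu).
  by rewrite (ltW (v0 _)) vV// leq_addl.
have b'0 l : 0 < rate (nu' l) by exact: b0.
have dom' : {ae m, forall x, A x -> forall l,
    v' l * (birk T \1_A (nu' l) x / rate (nu' l)) <= M}.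
  by apply: filterS dom => y Dy Ay l; apply: vb => //; exact: Dy.
have cv' : {ae m, forall x, forall e : R, 0 < e -> exists N, forall l, (N <= l)%N ->
    `|birk T \1_A (nu' l) x / rate (nu' l) - a / mu| <= e}.
  apply: filterS cv => y Hy ep ep0; have [N' HN'] := Hy ep ep0.
  by exists N' => l Nl; apply: HN'; exact: leq_trans (leq_addr _ _).
have ee : 0 < e * (a / mu * a) / 2 by rewrite divr_gt0// mulr_gt0// mulr_gt0.
have [N' HN'] := weighted_average hT mA A0 Af b'0 v'V dom' cv' ee.
have [_ bad] := nuP (N' + N)%N; apply: bad; rewrite -/(v (N' + N)%N).
have := HN' N' (leqnn _); rewrite -/a /nu' /v' /v.
have := g0 (N' + N)%N; have := b0 (N' + N)%N.
move: (rate _) (avg_return _ _ _ _) => r g r0 gg0.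
have -> : r / g * (g * a ^+ 2 / r - a / mu * a) = - (r / g - mu) * (a / mu * a).
  by field; rewrite !gt_eqF.
have k0 : 0 < a / mu * a by rewrite mulr_gt0.
rewrite normrM normrN (gtr0_norm k0) => h.
rewrite -(ler_pM2r k0); apply: (le_trans h).
by rewrite ler_pdivrMr// ler_peMr ?ler1n// mulr_ge0// ltW.
Qed.

End constants.

(** * The two constants *)

Section limits.
Context {R : realType}.
Implicit Types (u w : nat -> R) (l F q : R).

Lemma limn_esup_eq u l :
  (forall e : R, 0 < e -> exists N, forall n, (N <= n)%N -> u n <= l + e) ->
  (forall e : R, 0 < e -> forall N, exists2 n, (N <= n)%N & l - e <= u n) ->
  limn_esup (EFin \o u) = l%:E.
Proof.
move=> up lo; apply/eqP; rewrite eq_le; apply/andP; split.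
  apply/lee_addgt0Pr => e e0; have [N HN] := up e e0.
  apply: (@le_trans _ _ (ereal_sup ((EFin \o u) @` [set n | (N <= n)%N]))).
    by apply: ereal_inf_lbound; exists [set n | (N <= n)%N] => //; exists N.
  by apply: ge_ereal_sup => _ [n /= Nn <-]; rewrite -EFinD lee_fin HN.
apply: le_ereal_inf_tmp => _ [V [N _ NV] <-].
apply/lee_addgt0Pr => e e0; have [n Nn h] := lo e e0 N.
apply: (@le_trans _ _ ((u n)%:E + e%:E)%E).
  by rewrite -EFinD lee_fin -lerBlDr.
by rewrite leeD2r//; apply: ereal_sup_ubound; exists n => //; exact: NV.
Qed.

Lemma limn_esup_scaled u w F q : 0 <= F ->
  (forall e : R, 0 < e -> exists N, forall n, (N <= n)%N -> `|u n - F * w n| <= e) ->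
  (forall e : R, 0 < e -> exists N, forall n, (N <= n)%N -> w n <= q + e) ->
  (forall e : R, 0 < e -> forall N, exists2 n, (N <= n)%N & q - e <= w n) ->
  limn_esup (EFin \o u) = (q * F)%:E.
Proof.
move=> F0 close up lo.
have F1 : 0 < F + 1 by rewrite ltr_wpDl.
have e' (e : R) : 0 < e -> 0 < e / (2 * (F + 1)) by move=> ?; rewrite divr_gt0// mulr_gt0.
have Fe (e : R) : 0 < e -> F * (e / (2 * (F + 1))) <= e / 2.
  move=> e0; have -> : F * (e / (2 * (F + 1))) = F / (F + 1) * (e / 2).
    by field; rewrite gt_eqF.
  by rewrite ler_piMl ?divr_ge0 ?(ltW e0)// ler_pdivrMr// mul1r lerDl.
have sp (e : R) : 0 < e -> exists N, forall n, (N <= n)%N ->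
    F * w n - e / 2 <= u n <= F * w n + e / 2.
  move=> e0; have e2 : 0 < e / 2 by rewrite divr_gt0.
  have [N HN] := close _ e2; exists N => n /HN; rewrite ler_norml.
  by move: (F * w n) => p /andP[? ?]; apply/andP; split; lra.
apply: limn_esup_eq => e e0.
  have [N1 HN1] := sp e e0; have [N2 HN2] := up _ (e' e e0).
  exists (maxn N1 N2) => n; rewrite geq_max => /andP[/HN1 /andP[_ h] /HN2 h2].
  have := ler_wpM2l F0 h2; have := Fe e e0; rewrite [F * (q + _)]mulrDr [F * q]mulrC; move: h.
  by move: (F * w n) (q * F) (F * _) => p p' r; lra.
move=> N; have [N1 HN1] := sp e e0; have [n + h2] := lo _ (e' e e0) (maxn N N1).
rewrite geq_max => /andP[Nn /HN1 /andP[h _]]; exists n => //.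
have := ler_wpM2l F0 h2; have := Fe e e0; rewrite [F * (q - _)]mulrBr [F * q]mulrC; move: h.
by move: (F * w n) (q * F) (F * _) => p p' r; lra.
Qed.

Lemma limn_einf_scaled u w F q : 0 <= F ->
  (forall e : R, 0 < e -> exists N, forall n, (N <= n)%N -> `|u n - F * w n| <= e) ->
  (forall e : R, 0 < e -> exists N, forall n, (N <= n)%N -> q - e <= w n) ->
  (forall e : R, 0 < e -> forall N, exists2 n, (N <= n)%N & w n <= q + e) ->
  limn_einf (EFin \o u) = (q * F)%:E.
Proof.
move=> F0 close lo up; rewrite /limn_einf.
have -> : (\- (EFin \o u))%E = EFin \o (fun n => - u n) by apply/funext => n /=.
rewrite (@limn_esup_scaled _ (fun n => - w n) F (- q)) ?mulNr ?EFinN ?oppeK// => e e0.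
- have [N HN] := close e e0; exists N => n /HN.
  by rewrite mulrN -opprD normrN.
- by have [N HN] := lo e e0; exists N => n /HN; lra.
- by move=> N; have [n Nn h] := up e e0 N; exists n => //; lra.
Qed.

End limits.

Section conclusion.
Context {R : realType} {d : measure_display} {X : measurableType d}.
Variables (m : {measure set X -> \bar R}) (T Tinv : X -> X) (Om : set X).
Hypotheses (mOm : measurable Om) (hT : invertible_mpt m T Tinv)
  (hc : conservative m T) (he : ergodic m T).
Hypotheses (Om0 : (0 < m Om)%E) (Omf : (m Om < +oo)%E).
Local Notation P := (cond_measure m mOm).
Local Notation phi := (return_time T Om).
Local Notation tau := (induced_map T Om).
Variable th : nat -> R.
Hypothesis H : psi_mixing P tau phi th.
Local Notation rate := (@rate _ _ _ m T Om mOm).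
Local Notation S1 := (birk T (\1_Om : X -> R)).
Local Notation S2 := (birk Tinv (\1_Om : X -> R)).
Hypothesis hz : summable_hazard P phi.
Let mu := fine (m Om).
Let mu0 : 0 < mu. Proof. exact: mass_gt0. Qed.

Let both n x : R := (S1 n x + S2 n x) / rate n.

Let ae_both_bounds : {ae m, forall x, forall e : R, 0 < e ->
  exists N, forall n, (N <= n)%N -> 1 - e <= both n x <= 2 + e}.
Proof.
have Up := ae_upper_all hT hc he Om0 Omf H hz.
have Lo := ae_full_all hT hc he Om0 Omf H hz.
apply: filterS2 Up Lo => x Ux Lx e e0.
have e2 : 0 < e / 2 by rewrite divr_gt0.
have [N1 HN1] := Ux _ e2; have [N2 HN2] := Lx _ e0.
exists (maxn (maxn N1 N2) 1) => n; rewrite !geq_max => /andP[/andP[/HN1 [u1 u2] /HN2 l] n0].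
have r0 := rate_gt0 H n0.
have s1 : 0 <= S1 n x by apply: birk_ge0 => y; rewrite indicE.
have s2 : 0 <= S2 n x by apply: birk_ge0 => y; rewrite indicE.
rewrite /both ler_pdivlMr// ler_pdivrMr//.
move: r0 s1 s2 u1 u2 l; move: (rate n) (S1 n x) (S2 n x) => r s t r0 s1 s2 u1 u2 l.
apply/andP; split; last lra.
by case: l => l; lra.
Qed.

(** Two-sided visits stay between [rate] and twice [rate]; the ratio theorem
    carries this over to every set of finite mass. *)
Theorem asymp_rate A : measurable A -> (0 < m A)%E -> (m A < +oo)%E ->
  {ae m, forall x, asymp (fun n => symmetric_sum T Tinv n \1_A x) rate}.
Proof.
move=> mA A0 Af; have IA := integrable_indic_fin mA Af.
have := ae_symmetric_ratio hT hc he Om0 Omf H hz IA.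
have -> : fine (\int[m]_y (\1_A y)%:E) = fine (m A) by rewrite integral_indic// setIT.
set c := _ / _ => Ra.
have c0 : 0 < c by rewrite divr_gt0// mass_gt0. clearbody c.
apply: filterS2 Ra ae_both_bounds => x Rx Bx.
have c4 : 0 < c / 4 by rewrite divr_gt0.
have h4 : 0 < (1 / 4 : R) by rewrite divr_gt0.
have [N1 HN1] := Rx _ c4; have [N2 HN2] := Bx _ h4.
have v0 : 0 < 4 / c by rewrite divr_gt0.
exists (1 + 4 * c + 4 / c); first lra.
exists (maxn N1 N2) => // n /=; rewrite geq_max => /andP[/HN1 h1 /HN2].
move: h1; rewrite -/(both n x) ler_norml.
move: (both n x) (_ / rate n) => b s /andP[l u] /andP[l' u'].
have cb1 : c * (3 / 4) <= c * b by rewrite ler_wpM2l ?(ltW c0)//; lra.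
have cb2 : c * b <= c * (9 / 4) by rewrite ler_wpM2l ?(ltW c0)//; lra.
split; last by move: cb2 u v0; move: (c * b) => p; lra.
have M0 : 0 < 1 + 4 * c + 4 / c by rewrite !addr_gt0// mulr_gt0.
have s0 : c / 2 <= s by move: cb1 l; move: (c * b) => p; lra.
have s1 : 0 < s by apply: lt_le_trans s0; rewrite divr_gt0.
rewrite invf_plt ?posrE//.
apply: (@le_lt_trans _ _ (2 / c)).
  have -> : 2 / c = (c / 2)^-1 by rewrite invf_div.
  by rewrite lef_pV2 ?posrE// divr_gt0.
have -> : 2 / c = 4 / c / 2 by field; rewrite gt_eqF.
by move: v0; move: (4 / c) => v; lra.
Qed.

(** For the return sequence of any witnessing set, symmetric sums of [f] are
    asymptotic to half the normalized two-sided visits, times the integral. *)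
Lemma ae_symmetric_avg (A : set X) (f : X -> R) : bre_set m T A ->
  (forall x, 0 <= f x) -> m.-integrable setT (EFin \o f) ->
  {ae m, forall x, forall e : R, 0 < e -> exists N, forall n, (N <= n)%N ->
    `|symmetric_sum T Tinv n f x / (2 * avg_return m T A n) -
      fine (\int[m]_y (f y)%:E) * (both n x / 2)| <= e}.
Proof.
move=> bA f0 If; have Ra := ae_symmetric_ratio hT hc he Om0 Omf H hz If.
have Va := rate_over_avg hT hc he Om0 Omf H hz bA.
have [mA A0 Af _] := bA.
set F := fine _ in Ra *.
have F0 : 0 <= F by apply/fine_ge0/integral_ge0 => x _; rewrite lee_fin.
apply: filterS2 Ra ae_both_bounds => x Rx Bx e e0.
set K := 3 * (F / mu) + 1.
have Fm : 0 <= F / mu by rewrite divr_ge0// ltW.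
have K0 : 0 < K by rewrite /K; move: Fm; move: (F / mu) => q; lra.
have e1 : 0 < e / (2 * mu) by rewrite divr_gt0// mulr_gt0.
have e2 : 0 < e / K by rewrite divr_gt0.
have [N1 HN1] := Rx _ e1; have [N1' HN1'] := Rx _ ltr01.
have [N2 HN2] := Bx _ ltr01; have [N3 HN3] := Va _ e2; have [N4 HN4] := Va _ mu0.
exists (maxn (maxn (maxn N1 N1') (maxn N2 (maxn N3 N4))) 1) => n; rewrite !geq_max.
move=> /andP[/andP[/andP[/HN1 h1 /HN1' h1'] /and3P[/HN2 h2 /HN3 h3 /HN4 h4]] n0].
have r0 := rate_gt0 H n0; have g0 := avg_return_gt0 T A0 Af n0.
move: h1 h1' h2 h3 h4; rewrite -/(both n x) -/mu.
have -> : symmetric_sum T Tinv n f x / (2 * avg_return m T A n) =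
   symmetric_sum T Tinv n f x / rate n * (rate n / avg_return m T A n) / 2.
  by move: g0 r0; move: (avg_return _ _ _ _) (rate n) => g r g0 r0; field; rewrite !gt_eqF.
move: (symmetric_sum _ _ _ _ _ / _) (rate n / _) (both n x) => s v b h1 h1' /andP[b1 b2] h3 h4.
have -> : s * v / 2 - F * (b / 2) = ((s - F / mu * b) * mu + s * (v - mu)) / 2.
  by field; rewrite gt_eqF.
rewrite normrM [`|2^-1|]gtr0_norm ?invr_gt0// ler_pdivrMr//.
apply: le_trans (ler_normD _ _) _; rewrite !normrM (gtr0_norm mu0).
have p1 : `|s - F / mu * b| * mu <= e / 2.
  have -> : e / 2 = e / (2 * mu) * mu by field; rewrite gt_eqF.
  by rewrite ler_wpM2r// ltW.
have sK : `|s| <= K.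
  have -> : s = (s - F / mu * b) + F / mu * b by ring.
  apply: le_trans (ler_normD _ _) _; rewrite [K]addrC; apply: lerD => //.
  rewrite normrM (ger0_norm Fm) mulrC; apply: ler_wpM2r => //.
  by rewrite ler_norml; apply/andP; split; lra.
have p2 : `|s| * `|v - mu| <= e.
  have -> : e = K * (e / K) by field; rewrite gt_eqF.
  exact: ler_pM.
by move: p1 p2; move: (`|s - _| * mu) (`|s| * _) => p q; lra.
Qed.

(** In probability, hence along a subsequence almost everywhere, both
    directions are full at the same times. *)
Lemma ae_half_both_upper : {ae m, forall x,
  (forall e : R, 0 < e -> exists N, forall n, (N <= n)%N -> both n x / 2 <= 1 + e) /\
  (forall e : R, 0 < e -> forall N, exists2 n, (N <= n)%N & 1 - e <= both n x / 2)}.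
Proof.
have inf N : exists2 n : nat, (N <= n)%N & True by exists N.
have [nu [nuP sub]] := ae_subsequence hT hc he Om0 Omf H hz inf.
apply: filterS2 ae_both_bounds sub => x Bx Sx; split=> e e0.
  by have [N HN] := Bx e e0; exists N => n /HN /andP[_]; move: (both n x) => b; lra.
move=> N; have [N' HN'] := Sx e e0.
have [ln _] := nuP (maxn N N').
exists (nu (maxn N N')); first by apply: leq_trans (leq_maxl N N') (ltnW ln).
have r0 : 0 < rate (nu (maxn N N')) by apply: (rate_gt0 H); exact: leq_ltn_trans ln.
have [] := HN' _ (leq_maxr N N'); rewrite /both; move: r0.
move: (rate _) (S1 _ _) (S2 _ _) => r s t r0 h1 h2.
by rewrite ler_pdivlMr// ler_pdivlMr//; lra.
Qed.

(** One direction is always full; during a stall of the forward direction it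
    is the only one that counts. *)
Lemma ae_half_both_lower : m setT = +oo%E -> {ae m, forall x,
  (forall e : R, 0 < e -> exists N, forall n, (N <= n)%N -> 1 / 2 - e <= both n x / 2) /\
  (forall e : R, 0 < e -> forall N, exists2 n, (N <= n)%N & both n x / 2 <= 1 / 2 + e)}.
Proof.
move=> moo.
have St := ae_stalls hT hc he Om0 Omf H (summable_hazard_small H hz) moo.
have Up := ae_upper_all hT hc he Om0 Omf H hz.
apply: filterS3 ae_both_bounds St Up => x Bx Sx Ux; split=> e e0.
  by have [N HN] := Bx e e0; exists N => n /HN /andP[]; move: (both n x) => b; lra.
move=> N; have [N' HN'] := Ux e e0.
have [n + h1] := Sx e e0 (maxn (maxn N N') 1).
rewrite !geq_max => /andP[/andP[Nn /HN' [_ h2]] n0]; exists n => //.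
have r0 := rate_gt0 H n0; move: h1 h2 r0; rewrite /both.
move: (rate _) (S1 _ _) (S2 _ _) => r s t h1 h2 r0.
by rewrite ler_pdivrMr// ler_pdivrMr//; lra.
Qed.

Theorem upper_constant : has_upper_constant m T Tinv 1%E.
Proof.
split; first exact: (exists_bre_set hT hc he Om0 Omf H hz).
move=> A bA f f0 If.
have F0 : 0 <= fine (\int[m]_y (f y)%:E).
  by apply/fine_ge0/integral_ge0 => x _; rewrite lee_fin.
apply: filterS2 (ae_symmetric_avg bA f0 If) ae_half_both_upper => x Sx [Bx1 Bx2].
have h := limn_esup_scaled F0 Sx Bx1 Bx2.
rewrite (_ : (fun n => _) = EFin \o (fun n =>
  symmetric_sum T Tinv n f x / (2 * avg_return m T A n)))//.
by rewrite h EFinM fineK//; exact: integrable_fin_num If.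
Qed.

Theorem lower_constant : m setT = +oo%E -> has_lower_constant m T Tinv (2^-1)%:E.
Proof.
move=> moo; split; first exact: (exists_bre_set hT hc he Om0 Omf H hz).
move=> A bA f f0 If.
have F0 : 0 <= fine (\int[m]_y (f y)%:E).
  by apply/fine_ge0/integral_ge0 => x _; rewrite lee_fin.
apply: filterS2 (ae_symmetric_avg bA f0 If) (ae_half_both_lower moo) => x Sx [Bx1 Bx2].
have h := limn_einf_scaled F0 Sx Bx1 Bx2.
rewrite (_ : (fun n => _) = EFin \o (fun n =>
  symmetric_sum T Tinv n f x / (2 * avg_return m T A n)))//.
by rewrite h EFinM fineK ?div1r//; exact: integrable_fin_num If.
Qed.

End conclusion.

Theorem theorem5 (R : realType) (d : measure_display) (X : measurableType d)
    (m : {sigma_finite_measure set X -> \bar R})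
    (T Tinv : X -> X) (Omega : set X) (mOmega : measurable Omega)
    (hstd : standard_space R X)
    (hT : invertible_mpt m T Tinv)
    (hcons : conservative m T)
    (herg : ergodic m T)
    (Omega_gt0 : (0 < m Omega)%E) (Omega_fin : (m Omega < +oo)%E)
    (hmix : continued_fraction_mixing Omega (cond_measure m mOmega)
              (interarrival T Omega))
    (hsum : (\sum_(1 <= n <oo)
               mixing_coef Omega (cond_measure m mOmega)
                 (interarrival T Omega) n * (n%:R^-1)%:E < +oo)%E) :
  let cond_a :=
    exists2 a : nat -> R, (forall n, (1 <= n)%N -> 0 < a n) &
      forall A, measurable A -> (0 < m A)%E -> (m A < +oo)%E ->
        {ae m, forall x, asymp (fun n => symmetric_sum T Tinv n \1_A x) a} in
  let cond_b :=
    (\sum_(1 <= n <oo)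
       (n%:R * (fine (cond_measure m mOmega
                   (Omega `&` [set x | (n <= return_time T Omega x)%N])) /
                truncated_mean m T mOmega n%:R) ^+ 2)%:E < +oo)%E in
  (cond_a <-> cond_b) /\
  (cond_a -> m setT = +oo%E ->
     has_upper_constant m T Tinv 1%E /\
     has_lower_constant m T Tinv (2^-1)%:E).
Proof.
move=> cond_a cond_b.
have H := induced_psi_mixing hT hcons herg Omega_gt0 Omega_fin hmix hsum.
have ab : cond_a -> summable_hazard (cond_measure m mOmega) (return_time T Omega).
  move=> [a a0 /(_ _ mOmega Omega_gt0 Omega_fin)].
  exact: (asymp_visits_summable_hazard hT hcons herg Omega_gt0 Omega_fin H a0).
have bP := return_time_hazardP hT H.
split; first split.
- by move=> /ab /bP.
- move=> /bP hz; exists (@rate _ _ _ m T Omega mOmega) => [n n1|A mA A0 Af].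
    exact: (rate_gt0 H).
  exact: (asymp_rate hT hcons herg Omega_gt0 Omega_fin H hz).
- move=> /ab hz moo; split.
    exact: (upper_constant hT hcons herg Omega_gt0 Omega_fin H hz).
  exact: (lower_constant hT hcons herg Omega_gt0 Omega_fin H hz).
Qed.
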